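(* Let $G$ be a reflection group of type $I_2(m)$, $A_{n-1}$, $B_n$, $D_n$, $H_3$, or $F_4$ acting on $V$, and let $X \subseteq V$ be a nonempty $G$-invariant real variety. Let $1 \le k \le \dim V$. If $X$ is $k$-sparse, then $X \cap \mathcal{H}_k(G) \neq \emptyset$.
   Context: A (real) reflection group $G$ acting on a Euclidean space $V \cong \mathbb{R}^N$ is a finite group of orthogonal transformations generated by reflections. Its reflection arrangement is $\mathcal{H}(G) = \{\ker(g-\mathrm{id}) : g \in G \text{ a reflection}\}$, the set of reflection hyperplanes. The flats are the linear subspaces arising as intersections of hyperplanes in $\mathcal{H}(G)$ (including $V$ itself, the empty intersection). For each $i$, $\mathcal{H}_i(G) = \{p \in V : p \text{ is contained in a flat of dimension } i\}$; in particular $\mathcal{H}_N(G) = V$. $G$ acts on $\mathbb{R}[V]$ by $(g\cdot f)(x) = f(g^{-1}x)$. By Chevalley's theorem, the invariant ring $\mathbb{R}[V]^G$ is generated by $N$ algebraically independent homogeneous polynomials $\pi_1,\dots,\pi_N$, called a set of basic invariants, always labelled so that $\deg\pi_1 \le \dots \le \deg\pi_N$. They are not unique, but their degrees are. A real variety is a set $\mathrm{V}_{\mathbb{R}}(f_1,\dots,f_m) = \{p \in V : f_1(p) = \dots = f_m(p) = 0\}$ with $f_i\in\mathbb{R}[V]$. A $G$-invariant real variety $X$ is $k$-sparse if $X = \mathrm{V}_{\mathbb{R}}(f_1,\dots,f_m)$ for some $f_1,\dots,f_m \in \mathbb{R}[\pi_1,\dots,\pi_k]$ and some choice of basic invariants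 $\pi_1,\dots,\pi_N$ ordered by nondecreasing degree. The types are the usual ones: $A_{n-1}$ is the symmetric group $\mathfrak{S}_n$ permuting coordinates of $\mathbb{R}^n$ (or its essential restriction to $\{x_1+\dots+x_n=0\}$); $B_n$ is the group of signed permutations of $\mathbb{R}^n$; $D_n$ (with $n\ge 2$) is the subgroup of $B_n$ of signed permutations with an even number of sign changes; $I_2(m)$ is the dihedral group of order $2m$ on $\mathbb{R}^2$; $H_3$ and $F_4$ are the exceptional reflection groups of rank $3$ and $4$ acting on $\mathbb{R}^3$ and $\mathbb{R}^4$. *)

(* Defs.v *)
(* The ground field is an abstract realType R. The Euclidean
   space V is R^N as 'cV[R]_N with the standard inner product, and linear maps
   are matrices acting by g *m x. *)
(* mpoly has to be loaded before the classical/analysis files: the opposite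
   order is rejected because of incompatible notation levels. *)
From mathcomp Require Import all_boot all_order all_algebra all_fingroup.
From mathcomp Require Import mpoly.
From mathcomp Require Import boolp classical_sets cardinality reals trigo.

Set Implicit Arguments.
Unset Strict Implicit.
Unset Printing Implicit Defensive.

Import Order.TTheory GRing.Theory Num.Theory.
Local Open Scope classical_set_scope.
Local Open Scope ring_scope.

Definition orthogonal (R : realType) (N : nat) : set 'M[R]_N :=
  [set g | g^T *m g = 1%:M].

(* x |-> x - 2 (a . x) / (a . a) a *)
Definition reflmx (R : realType) (N : nat) (a : 'cV[R]_N) : 'M[R]_N :=
  1%:M - (2 / (a^T *m a) 0 0) *: (a *m a^T).

Definition reflection (R : realType) (N : nat) : set 'M[R]_N :=
  [set g | exists2 a : 'cV[R]_N, a != 0 & g = reflmx a].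

Inductive generated (R : realType) (N : nat) (S : set 'M[R]_N) :
    set 'M[R]_N :=
| gen_base g : S g -> generated S g
| gen_one : generated S 1%:M
| gen_mul g h : generated S g -> generated S h -> generated S (g *m h)
| gen_inv g : generated S g -> generated S (invmx g).

Definition reflection_group (R : realType) (N : nat) (G : set 'M[R]_N) : Prop :=
  [/\ finite_set G, G `<=` @orthogonal R N
    & G = generated (G `&` @reflection R N)].

Definition arrangement (R : realType) (N : nat) (G : set 'M[R]_N) :
    set {vspace 'cV[R]_N} :=
  [set H | exists2 g, G g /\ reflection g
                    & H = fixedSpace (linfun (mulmx g))].

(* s = [::] gives the flat V; for a finite group the arrangement is finite, so
   finite intersections are all intersections. *)
Definition flat (R : realType) (N : nat) (G : set 'M[R]_N) :
    set {vspace 'cV[R]_N} :=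
  [set U | exists2 s : seq {vspace 'cV[R]_N},
             (forall H, H \in s -> arrangement G H)
           & U = (\bigcap_(H <- s) H)%VS].

(* the union H_i(G) of the flats of dimension i *)
Definition flat_stratum (R : realType) (N : nat) (G : set 'M[R]_N) (i : nat) :
    set 'cV[R]_N :=
  [set p | exists U, [/\ flat G U, \dim U = i & p \in U]].

Definition peval (R : realType) (N : nat) (f : {mpoly R[N]}) (x : 'cV[R]_N) : R :=
  f.@[fun i => x i 0].

(* (g . f)(x) = f (g^-1 x); polynomials over R are determined by their values *)
Definition invariant_poly (R : realType) (N : nat) (G : set 'M[R]_N)
    (f : {mpoly R[N]}) : Prop :=
  forall g, G g -> forall x, peval f (invmx g *m x) = peval f x.

Definition alg_independent (R : realType) (N n : nat)
    (q : n.-tuple {mpoly R[N]}) : Prop :=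
  forall Q : {mpoly R[n]}, Q \mPo q = 0 -> Q = 0.

(* msize is the degree plus one on nonzero polynomials, and algebraically
   independent polynomials are nonzero. *)
Definition basic_invariants (R : realType) (N : nat) (G : set 'M[R]_N)
    (q : N.-tuple {mpoly R[N]}) : Prop :=
  [/\ forall i, tnth q i \is ishomog mdeg,
      alg_independent q,
      forall f, invariant_poly G f <-> exists Q : {mpoly R[N]}, f = Q \mPo q
    & forall i j : 'I_N, (i <= j)%N ->
        (msize (tnth q i) <= msize (tnth q j))%N].

(* f belongs to R[q_1, ..., q_k], for k <= N *)
Definition in_first_subalgebra (R : realType) (N : nat)
    (q : N.-tuple {mpoly R[N]}) (k : nat) (f : {mpoly R[N]}) : Prop :=
  exists Q : {mpoly R[k]}, f = Q \mPo [tuple q`_i | i < k].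

Definition zero_locus (R : realType) (N : nat) (fs : seq {mpoly R[N]}) :
    set 'cV[R]_N :=
  [set p | forall f, f \in fs -> peval f p = 0].

Definition real_variety (R : realType) (N : nat) (X : set 'cV[R]_N) : Prop :=
  exists fs : seq {mpoly R[N]}, X = zero_locus fs.

Definition invariant_set (R : realType) (N : nat) (G : set 'M[R]_N)
    (X : set 'cV[R]_N) : Prop :=
  forall g, G g -> forall x, X x -> X (g *m x).

Definition sparse (R : realType) (N : nat) (G : set 'M[R]_N) (k : nat)
    (X : set 'cV[R]_N) : Prop :=
  exists q : N.-tuple {mpoly R[N]}, basic_invariants G q /\
    exists2 fs : seq {mpoly R[N]},
      (forall f, f \in fs -> in_first_subalgebra q k f) & X = zero_locus fs.

Definition symmetric_model (R : realType) (n : nat) : set 'M[R]_n :=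
  [set g | exists s : 'S_n, g = perm_mx s].

Definition signed_perm_mx (R : realType) (n : nat) (e : {ffun 'I_n -> bool})
    (s : 'S_n) : 'M[R]_n :=
  diag_mx (\row_i (-1) ^+ e i) *m perm_mx s.

Definition B_model (R : realType) (n : nat) : set 'M[R]_n :=
  [set g | exists (e : {ffun 'I_n -> bool}) (s : 'S_n), g = signed_perm_mx R e s].

Definition D_model (R : realType) (n : nat) : set 'M[R]_n :=
  [set g | exists (e : {ffun 'I_n -> bool}) (s : 'S_n),
     ~~ odd (\sum_i e i)%N /\ g = signed_perm_mx R e s].

Definition rotation_mx (R : realType) (t : R) : 'M[R]_2 :=
  \matrix_(i, j)
    (nth [::] [:: [:: cos t; - sin t]; [:: sin t; cos t]] i)`_j.

Definition flip_mx (R : realType) : 'M[R]_2 := diag_mx (\row_i (-1) ^+ i).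

Definition dihedral_model (R : realType) (m : nat) : set 'M[R]_2 :=
  [set g | exists (j : 'I_m) (b : bool),
     g = rotation_mx (2 * pi * j%:R / m%:R) *m (if b then flip_mx R else 1%:M)].

Definition vec (R : realType) (n : nat) (s : seq R) : 'cV[R]_n := \col_i s`_i.

Definition golden (R : realType) : R := (1 + Num.sqrt 5) / 2.

(* Unit simple roots a1, a2, a3 of H_3, with a1 . a2 = - cos (pi/5),
   a2 . a3 = - cos (pi/3) and a1 . a3 = 0. *)
Definition H3_simple_roots (R : realType) : seq 'cV[R]_3 :=
  [:: vec 3 [:: 1; 0; 0];
      vec 3 [:: - golden R / 2; (golden R)^-1 / 2; 1 / 2];
      vec 3 [:: 0; 0; -1]].

(* Bourbaki's simple roots e2 - e3, e3 - e4, e4, (e1 - e2 - e3 - e4) / 2. *)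
Definition F4_simple_roots (R : realType) : seq 'cV[R]_4 :=
  [:: vec 4 [:: 0; 1; -1; 0];
      vec 4 [:: 0; 0; 1; -1];
      vec 4 [:: 0; 0; 0; 1];
      vec 4 [:: 1 / 2; - (1 / 2); - (1 / 2); - (1 / 2)]].

Definition root_group (R : realType) (n : nat) (s : seq 'cV[R]_n) :
    set 'M[R]_n :=
  generated [set g | exists2 a, a \in s & g = reflmx a].

(* E is a linear isometry of R^N onto the subspace U of R^n, and G is the
   restriction of W to U, transported to R^N along E: as E^T is the inverse of
   E on U, the matrix E^T *m h *m E is that of h restricted to U. *)
Definition realizes (R : realType) (n N : nat) (W : set 'M[R]_n)
    (U : set 'cV[R]_n) (G : set 'M[R]_N) : Prop :=
  exists E : 'M[R]_(n, N),
    [/\ E^T *m E = 1%:M, range (mulmx E : 'cV[R]_N -> 'cV[R]_n) = U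
      & G = [set E^T *m h *m E | h in W]].

Definition sum_zero (R : realType) (n : nat) : set 'cV[R]_n :=
  [set x | \sum_i x i 0 = 0].

(* TypeA r is A_r, with symmetric group on r + 1 letters *)
Variant group_type :=
  TypeI2 of nat | TypeA of nat | TypeB of nat | TypeD of nat | TypeH3 | TypeF4.

Definition has_type (R : realType) (N : nat) (T : group_type)
    (G : set 'M[R]_N) : Prop :=
  match T with
  | TypeI2 m => (0 < m)%N /\ realizes (@dihedral_model R m) setT G
  | TypeA r => realizes (@symmetric_model R r.+1) setT G \/
               realizes (@symmetric_model R r.+1) (@sum_zero R r.+1) G
  | TypeB n => realizes (@B_model R n) setT G
  | TypeD n => (2 <= n)%N /\ realizes (@D_model R n) setT G
  | TypeH3 => realizes (root_group (H3_simple_roots R)) setT G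
  | TypeF4 => realizes (root_group (F4_simple_roots R)) setT G
  end.

(* Main.v *)
(**
   Let P_1, ..., P_N be explicit invariants of the model group (power sums of
   suitable linear forms, the product of the coordinates for D, the real part of
   (x + iy)^m for I_2(m)) whose degrees add up to N plus the number of mirrors and
   whose Jacobian is not identically zero. Comparing Jacobians, which vanish on every
   mirror, shows that all basic invariants have the same degrees, and that the
   Jacobian of the P_j vanishes on the mirrors only. When the degrees are distinct,
   the first k basic invariants have the same fibres as P_1, ..., P_k, so it is
   enough to find in every fibre of the latter a point on a k-dimensional flat.

   Such a point is a critical point of a further invariant on the fibre. The fibres
   may be singular, so Lagrange multipliers are replaced by a penalty: one minimises
   f + M * sum_j (P_j - P_j(p))^2 and lets M grow. The relation between gradients
   says for A, B, D that the coordinates (or their squares) are roots of one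
   polynomial and thus take few values; for k = N - 1 it says that the
   Jacobian vanishes, hence that the point is on a mirror. For F_4 and k = 2 the
   argument is repeated inside a mirror: there the Jacobian of the restrictions of
   P_1, P_2, P_3 is a product of linear forms that cut out other mirrors.
*)
From mathcomp Require Import all_boot all_order all_algebra all_fingroup.
From mathcomp Require Import mpoly ring lra zify.
From mathcomp Require Import boolp classical_sets cardinality reals trigo topology normedtype derive.
Require Import Defs.

Set Implicit Arguments.
Unset Strict Implicit.
Unset Printing Implicit Defensive.

Import Order.TTheory GRing.Theory Num.Theory.
Import numFieldNormedType.Exports.
Local Open Scope classical_set_scope.
Local Open Scope ring_scope.

(** * Polynomial functions and gradients *)

(** Only the given basic invariants are known to generate, so each P_j is a polynomial in them, and
    it is this relation that has to be inverted. It is weighted homogeneous, hence its matrix of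
    first derivatives is block triangular with respect to the degrees; a nonzero Jacobian makes the
    diagonal blocks, made of the coefficients of the linear terms, invertible. A basic invariant is
    thus fixed by the P_j of lower degree together with one linear combination of the P_j of its own
    degree. For I_2(2) and for D_n with n even two degrees coincide and this combination is unknown,
    so the critical points are then found for an arbitrary combination. The Jacobian has at most as
    many roots on a line as there are mirrors, and a generic line spends them all on the mirrors.
    The penalty method ends with a limit, so the property wanted of the point must be closed: it is
    encoded as the vanishing of one polynomial Phi, a product of linear forms or a product of sums
    of squares. The minimisers stay bounded because a function dominating the squared norm is always
    among the invariants that are fixed or minimised. *)

Definition dot (R : realType) (n : nat) (a b : 'cV[R]_n) : R := \sum_i a i 0 * b i 0.

Definition grad (R : realType) (n : nat) (f : {mpoly R[n]}) (x : 'cV[R]_n) : 'cV[R]_n :=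
  \col_i peval f^`M(i) x.

Definition linear_form (R : realType) (n : nat) (a : 'cV[R]_n) : {mpoly R[n]} :=
  \sum_i a i 0 *: 'X_i.

(** Along a line gradients become derivatives at 0, and zeros of f can be counted as roots of a
    polynomial in the parameter. *)
Definition on_line (R : realType) (n : nat) (x v : 'cV[R]_n) (f : {mpoly R[n]}) : {poly R} :=
  mmap polyC (fun i => (x i 0)%:P + v i 0 *: 'X) f.

Section Dot.
Variables (R : realType) (n : nat).
Implicit Types (a b x y : 'cV[R]_n).

Lemma dotE a b : (a^T *m b) 0 0 = dot a b.
Proof. by rewrite mxE; apply: eq_bigr => i _; rewrite mxE. Qed.

Lemma dotC a b : dot a b = dot b a.
Proof. by apply: eq_bigr => i _; rewrite mulrC. Qed.

Lemma dotDr a x y : dot a (x + y) = dot a x + dot a y.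
Proof. by rewrite -big_split; apply: eq_bigr => i _; rewrite mxE mulrDr. Qed.

Lemma dotZr a t x : dot a (t *: x) = t * dot a x.
Proof. by rewrite mulr_sumr; apply: eq_bigr => i _; rewrite mxE mulrCA. Qed.

Lemma dotDl a b x : dot (a + b) x = dot a x + dot b x.
Proof. by rewrite dotC dotDr !(dotC x). Qed.

Lemma dotZl a t x : dot (t *: a) x = t * dot a x.
Proof. by rewrite dotC dotZr dotC. Qed.

Lemma dotNr a x : dot a (- x) = - dot a x.
Proof. by rewrite -scaleN1r dotZr mulN1r. Qed.

Lemma dotBr a x y : dot a (x - y) = dot a x - dot a y.
Proof. by rewrite dotDr dotNr. Qed.

Lemma dot0r a : dot a 0 = 0.
Proof. by rewrite -(scale0r 0) dotZr mul0r. Qed.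

Lemma dot_sumr a (I : finType) (F : I -> 'cV[R]_n) :
  dot a (\sum_i F i) = \sum_i dot a (F i).
Proof.
by apply: (big_morph (dot a) (id1 := 0) (op1 := +%R)); [exact: dotDr|exact: dot0r].
Qed.

Lemma dot_ge0 x : 0 <= dot x x.
Proof. by apply: sumr_ge0 => i _; rewrite -expr2 sqr_ge0. Qed.

Lemma dot_eq0 x : (dot x x == 0) = (x == 0).
Proof.
apply/idP/eqP => [|->]; last by rewrite dot0r.
rewrite psumr_eq0 => [/allP x0|i _]; last by rewrite -expr2 sqr_ge0.
apply/colP => i; rewrite mxE; apply/eqP; have := x0 i (mem_index_enum i).
by rewrite -expr2 sqrf_eq0.
Qed.

Lemma dot_delta i x : dot (delta_mx i 0) x = x i 0.
Proof.
rewrite /dot (bigD1 i) //= big1 => [|j ji]; last by rewrite mxE (negPf ji) mul0r.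
by rewrite mxE !eqxx mul1r addr0.
Qed.

End Dot.

Lemma dot_mulmx (R : realType) (m n : nat) (E : 'M[R]_(m, n)) (a : 'cV[R]_m) x :
  dot a (E *m x) = dot (E^T *m a) x.
Proof. by rewrite -!dotE trmx_mul trmxK mulmxA. Qed.

Section MPoly.
Variables (R : realType) (n : nat).
Implicit Types (f g : {mpoly R[n]}) (a x v : 'cV[R]_n).

Lemma mpoly_alg_ind (P : {mpoly R[n]} -> Prop) :
  (forall c, P c%:MP) -> (forall i, P 'X_i) ->
  (forall f g, P f -> P g -> P (f + g)) -> (forall f g, P f -> P g -> P (f * g)) ->
  forall f, P f.
Proof.
move=> PC PX PD PM f; rewrite (mpolyE f).
apply: (big_ind P) => [||m _]; [by rewrite -mpolyC0|exact: PD|].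
rewrite -mul_mpolyC; apply: (PM); first exact: PC.
rewrite mpolyXE_id; apply: (big_ind P) => [|f1 f2|i _]; [by rewrite -mpolyC1|exact: (PM)|].
elim: (m i) => [|k IH]; first by rewrite expr0 -mpolyC1.
by rewrite exprS; apply: (PM).
Qed.

Lemma pevalD f g x : peval (f + g) x = peval f x + peval g x.
Proof. exact: mevalD. Qed.

Lemma pevalB f g x : peval (f - g) x = peval f x - peval g x.
Proof. exact: mevalB. Qed.

Lemma pevalM f g x : peval (f * g) x = peval f x * peval g x.
Proof. exact: mevalM. Qed.

Lemma pevalZ c f x : peval (c *: f) x = c * peval f x.
Proof. exact: mevalZ. Qed.

Lemma pevalC c x : peval (c%:MP : {mpoly R[n]}) x = c.
Proof. exact: mevalC. Qed.

Lemma peval0 x : peval (0 : {mpoly R[n]}) x = 0.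
Proof. exact: meval0. Qed.

Lemma pevalXU i x : peval ('X_i : {mpoly R[n]}) x = x i 0.
Proof. exact: mevalXU. Qed.

Lemma pevalXn f k x : peval (f ^+ k) x = peval f x ^+ k.
Proof. exact: rmorphXn. Qed.

Lemma peval_sum (I : Type) (r : seq I) (P : pred I) (F : I -> {mpoly R[n]}) x :
  peval (\sum_(i <- r | P i) F i) x = \sum_(i <- r | P i) peval (F i) x.
Proof. exact: raddf_sum. Qed.

Lemma peval_prod (I : Type) (r : seq I) (P : pred I) (F : I -> {mpoly R[n]}) x :
  peval (\prod_(i <- r | P i) F i) x = \prod_(i <- r | P i) peval (F i) x.
Proof. exact: rmorph_prod. Qed.

Lemma peval_linear_form a x : peval (linear_form a) x = dot a x.
Proof. by rewrite peval_sum; apply: eq_bigr => i _; rewrite pevalZ pevalXU. Qed.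

Lemma gradE f x i : grad f x i 0 = peval f^`M(i) x.
Proof. by rewrite mxE. Qed.

Lemma gradD f g x : grad (f + g) x = grad f x + grad g x.
Proof. by apply/colP => i; rewrite !mxE mderivD pevalD. Qed.

Lemma gradM f g x : grad (f * g) x = peval g x *: grad f x + peval f x *: grad g x.
Proof. by apply/colP => i; rewrite !mxE mderivM pevalD !pevalM [_ * peval g x]mulrC. Qed.

Lemma gradZ c f x : grad (c *: f) x = c *: grad f x.
Proof. by apply/colP => i; rewrite !mxE mderivZ pevalZ. Qed.

Lemma gradN f x : grad (- f) x = - grad f x.
Proof. by rewrite -scaleN1r gradZ scaleN1r. Qed.

Lemma gradC c x : grad (c%:MP : {mpoly R[n]}) x = 0.
Proof. by apply/colP => i; rewrite !mxE mderivC peval0. Qed.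

Lemma grad_sum (I : Type) (r : seq I) (P : pred I) (F : I -> {mpoly R[n]}) x :
  grad (\sum_(i <- r | P i) F i) x = \sum_(i <- r | P i) grad (F i) x.
Proof.
apply: (big_morph (fun f => grad f x)) => [f g|]; first exact: gradD.
by rewrite -mpolyC0 gradC.
Qed.

Lemma mderivXU i j : ('X_i : {mpoly R[n]})^`M(j) = (i == j)%:R%:MP.
Proof.
rewrite mderivX mnmE; case: eqP => [->|_]; last by rewrite scale0r mpolyC0.
by rewrite scale1r -{1}[U_(j)%MM]add0m addmK mpolyX0 mpolyC1.
Qed.

Lemma gradXU i x : grad ('X_i : {mpoly R[n]}) x = delta_mx i 0.
Proof.
by apply/colP => j; rewrite !mxE mderivXU pevalC eqxx andbT eq_sym.
Qed.

Lemma gradXn f k x : grad (f ^+ k) x = (k%:R * peval f x ^+ k.-1) *: grad f x.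
Proof.
elim: k => [|k IH]; first by rewrite expr0 -mpolyC1 gradC mul0r scale0r.
rewrite exprS gradM IH scalerA -scalerDl pevalXn; congr (_ *: _).
by case: k {IH} => [|k] /=; rewrite ?mul0r ?mulr0 ?addr0 ?mul1r // mulrCA -exprS [in RHS]mulrSr mulrDl mul1r addrC.
Qed.

Lemma grad_linear_form a x : grad (linear_form a) x = a.
Proof.
rewrite grad_sum; apply/colP => j; rewrite summxE (bigD1 j) //= big1 => [|i ij].
  by rewrite gradZ gradXU !mxE !eqxx mulr1 addr0.
by rewrite gradZ gradXU !mxE [j == _]eq_sym (negPf ij) mulr0.
Qed.

Lemma on_lineE f x v t : (on_line x v f).[t] = peval f (x + t *: v).
Proof.
elim/mpoly_alg_ind: f => [c|i|f g|f g].
- by rewrite /on_line mmapC hornerC pevalC.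
- by rewrite /on_line mmapX mmap1U !hornerE pevalXU !mxE mulrC.
- by rewrite /on_line raddfD hornerD pevalD /= => -> ->.
- by rewrite /on_line rmorphM hornerM pevalM /= => -> ->.
Qed.

Lemma deriv_on_line f x v :
  (on_line x v f)^`() = \sum_i v i 0 *: on_line x v f^`M(i).
Proof.
elim/mpoly_alg_ind: f => [c|i|f g|f g].
- by rewrite /on_line mmapC derivC big1 // => i _; rewrite mderivC raddf0 scaler0.
- rewrite /on_line mmapX mmap1U (bigD1 i) //= big1 => [|j ji].
    by rewrite mderivXU eqxx mmapC derivD derivZ derivX derivC add0r addr0 alg_polyC.
  by rewrite mderivXU [i == _]eq_sym (negPf ji) mmapC scaler0.
- rewrite /on_line raddfD derivD /= => -> ->; rewrite -big_split; apply: eq_bigr => i _.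
  by rewrite mderivD raddfD scalerDr.
- rewrite /on_line rmorphM derivM /= => -> ->; rewrite mulr_suml mulr_sumr -big_split.
  apply: eq_bigr => i _; rewrite mderivM raddfD /= !rmorphM scalerDr /=.
  by rewrite scalerAl scalerAr.
Qed.

Lemma deriv_on_line0 f x v : (on_line x v f)^`().[0] = dot (grad f x) v.
Proof.
rewrite deriv_on_line horner_sum; apply: eq_bigr => i _.
by rewrite hornerZ on_lineE scale0r addr0 gradE mulrC.
Qed.

Lemma size_on_line f x v : (size (on_line x v f) <= msize f)%N.
Proof.
rewrite /on_line /mmap big_seq; apply: (leq_trans (size_sum _ _ _)).
apply/bigmax_leqP_seq => m mf _; rewrite mul_polyC; apply: (leq_trans (size_scale_leq _ _)).
apply: leq_trans (msize_mdeg_lt mf); rewrite /mmap1 mdegE.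
elim/big_rec2: _ => [|i k p _ IH]; first by rewrite size_poly1.
apply: (leq_trans (size_polyMleq _ _)).
have : (size (((x i 0)%:P + v i 0 *: 'X) ^+ m i)%R <= (m i).+1)%N.
  apply: (leq_trans (size_poly_exp_leq _ _)); rewrite ltnS.
  suff: ((size ((x i 0)%:P + v i 0 *: 'X)%R).-1 <= 1)%N by move=> h; rewrite -[leqRHS]mul1n leq_mul2r h orbT.
  have: (size ((x i 0)%:P + v i 0 *: 'X)%R <= 2)%N.
    apply: (leq_trans (size_polyD _ _)); rewrite geq_max (leq_trans (size_polyC_leq1 _)) //.
    by apply: (leq_trans (size_scale_leq _ _)); rewrite size_polyX.
  by lia.
by move=> h; rewrite -subn1 leq_subLR add1n -addSn -addnS; apply: leq_add.
Qed.

End MPoly.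

Section Composition.
Variables (R : realType) (n k : nat).

Lemma mderiv_comp_mpoly (q : n.-tuple {mpoly R[k]}) (f : {mpoly R[n]}) i :
  (f \mPo q)^`M(i) = \sum_l (f^`M(l) \mPo q) * (tnth q l)^`M(i).
Proof.
elim/mpoly_alg_ind: f => [c|l|f g|f g].
- by rewrite comp_mpolyC mderivC big1 // => l _; rewrite mderivC comp_mpoly0 mul0r.
- rewrite comp_mpolyXU -tnth_nth (bigD1 l) //= big1 => [|j jl].
    by rewrite mderivXU eqxx comp_mpolyC mul1r addr0.
  by rewrite mderivXU [l == _]eq_sym (negPf jl) comp_mpolyC mul0r.
- move=> IHf IHg; rewrite comp_mpolyD mderivD IHf IHg -big_split; apply: eq_bigr => l _.
  by rewrite mderivD comp_mpolyD mulrDl.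
- move=> IHf IHg; rewrite rmorphM /= mderivM IHf IHg mulr_suml mulr_sumr -big_split.
  by apply: eq_bigr => l _; rewrite mderivM comp_mpolyD !rmorphM /=; ring.
Qed.

End Composition.

(** * Minima of polynomials on a ball *)

Lemma deriv_min0 (R : realType) (P : {poly R}) (e : R) :
  0 < e -> (forall t, - e < t < e -> P.[0] <= P.[t]) -> P^`().[0] = 0.
Proof.
move=> e0 Pmin.
have h : is_derive (0 : R) (1 : R) (horner P) 0.
  apply: (@derive1_at_min _ _ (- e) e).
  - by lra.
  - by move=> t _; exact: derivable_horner.
  - by rewrite in_itv /=; apply/andP; split; lra.
  - by move=> t; rewrite in_itv /= => /Pmin.
have h' := is_derive_poly P 0.
have <- := @derive_val _ _ _ _ _ _ _ h'.
by have := @derive_val _ _ _ _ _ _ _ h.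
Qed.

Lemma interior_min_grad (R : realType) (n : nat) (F : {mpoly R[n]}) (x : 'cV[R]_n) (r : R) :
  dot x x < r -> (forall y, dot y y <= r -> peval F x <= peval F y) -> grad F x = 0.
Proof.
move=> xr xmin; apply/eqP; rewrite -dot_eq0 -deriv_on_line0.
(* For |t| <= 1 the squared norm of x + tv exceeds that of x by at most |t| B, and s is the room
   left in the ball; |t| < s / (B + s) gives both |t| <= 1 and |t| B <= s. *)
set v := grad F x; pose B := 2 * `|dot x v| + dot v v; pose s := r - dot x x.
have s0 : 0 < s by rewrite subr_gt0.
have B0 : 0 <= B by rewrite addr_ge0 ?dot_ge0 // mulr_ge0.
have Bs : 0 < B + s by lra.
apply/eqP; apply: (@deriv_min0 _ _ (s / (B + s))); first by rewrite divr_gt0.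
move=> t te; rewrite !on_lineE scale0r addr0; apply: xmin.
have {te}: `|t| < s / (B + s) by rewrite ltr_norml.
rewrite ltr_pdivlMr // => te.
rewrite dotDl !dotDr !dotZl !dotZr [dot v x]dotC.
have t1 : `|t| <= 1.
  rewrite leNgt; apply/negP => t1; move: te; rewrite ltNge => /negP; apply.
  by apply: (@le_trans _ _ (1 * (B + s))); [lra|rewrite ler_wpM2r // ltW].
have tt : t * t = `|t| ^+ 2 by rewrite -normrX -expr2 ger0_norm // sqr_ge0.
have h1 : t * dot x v <= `|t| * `|dot x v| by rewrite -normrM ler_norm.
have h2 : t * (t * dot v v) <= `|t| * dot v v.
  by rewrite mulrA tt expr2 -mulrA ler_wpM2l // ler_piMl ?dot_ge0.
have h3 : 0 <= `|t| * s by rewrite mulr_ge0 // ltW.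
by move: te; rewrite /B mulrDr mulrDr mulrCA /s; move: h1 h2 h3; rewrite /s; lra.
Qed.

(** Compactness will be applied to sets of row vectors, hence the transpose. *)
Lemma peval_continuous (R : realType) (n : nat) (f : {mpoly R[n]}) :
  continuous (fun u : 'rV[R]_n => peval f u^T).
Proof.
elim/mpoly_alg_ind: f => [c|i|f g cf cg|f g cf cg].
- under [X in continuous X]eq_fun do rewrite pevalC; exact: cst_continuous.
- under [X in continuous X]eq_fun do rewrite pevalXU mxE; exact: coord_continuous.
- under [X in continuous X]eq_fun do rewrite pevalD.
  by move=> u; exact: (@continuousD _ _ _ (fun u => peval f u^T) (fun u => peval g u^T) u (cf u) (cg u)).
- under [X in continuous X]eq_fun do rewrite pevalM.
  by move=> u; exact: (@continuousM _ _ (fun u => peval f u^T) (fun u => peval g u^T) u (cf u) (cg u)).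
Qed.

(** Needed in two ways below: with Phi = 0, to minimise the penalised function over the ball, and
    with a proper Phi, to turn approximate solutions on its zero set into an exact one. *)
Lemma peval_min (R : realType) (n : nat) (F Phi : {mpoly R[n]}) (r : R) (x0 : 'cV[R]_n) :
  dot x0 x0 <= r -> peval Phi x0 = 0 ->
  exists x, [/\ dot x x <= r, peval Phi x = 0 &
    forall y, dot y y <= r -> peval Phi y = 0 -> peval F x <= peval F y].
Proof.
move=> x0r x00.
pose N2 : {mpoly R[n]} := \sum_i 'X_i ^+ 2.
have N2E x : peval N2 x = dot x x.
  by rewrite peval_sum; apply: eq_bigr => i _; rewrite pevalXn pevalXU expr2.
pose A := [set u : 'rV[R]_n | dot u^T u^T <= r] `&` [set u : 'rV[R]_n | peval Phi u^T = 0].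
have A0 : A !=set0 by exists x0^T; rewrite /A /= trmxK.
have cA : compact A.
  apply: bounded_closed_compact.
    exists (r + 1); split; first exact: num_real.
    move=> M rM u [/= ur _]; rewrite /Num.norm /= mx_normrE.
    have r0 : 0 <= r by apply: le_trans ur; exact: dot_ge0.
    apply: bigmax_le => [|[i j] _ /=]; first by apply: ltW; apply: le_lt_trans rM; lra.
    apply: ltW; apply: le_lt_trans rM; rewrite (ord1 i).
    have : u 0 j ^+ 2 <= r.
      apply: le_trans ur; rewrite /dot (bigD1 j) //= !mxE -expr2 lerDl.
      by apply: sumr_ge0 => l _; rewrite -expr2 sqr_ge0.
    rewrite -real_normK ?num_real // => h.
    by have := sqr_ge0 (`|u 0 j| - 1); nra.
  apply: closedI.
    rewrite [X in closed X](_ : _ = (fun u => peval N2 u^T) @^-1` [set x | x <= r]).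
      by apply: preimage_closed => [u _|]; [exact: peval_continuous|exact: closed_le].
    by apply/seteqP; split => u /=; rewrite N2E.
  rewrite [X in closed X](_ : _ = (fun u => peval Phi u^T) @^-1` [set x | x = 0]) //.
  by apply: preimage_closed => [u _|]; [exact: peval_continuous|exact: closed_eq].
have [|c /set_mem [cr c0] cmin] := @compact_EVT_min _ _ (fun u => peval F u^T) A A0 cA.
  by apply: continuous_subspaceT; exact: peval_continuous.
exists c^T; split=> // y yr y0; have := cmin y^T; rewrite trmxK; apply; apply/mem_set.
by rewrite /A /= trmxK.
Qed.

(** * The penalty method *)

(* Minimising f + M * sum (g - g(p))^2 over a large ball yields critical points
   at which grad f is a combination of the grad g; they lie on Phi = 0 and
   approach the fibre of g through p as M grows. *)
Lemma penalty_point (R : realType) (n : nat) (f Phi h : {mpoly R[n]})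
    (g : seq {mpoly R[n]}) (p : 'cV[R]_n) :
  h \in f :: g -> (forall x, dot x x <= peval h x) ->
  (forall x (c : {mpoly R[n]} -> R), grad f x = \sum_(k <- g) c k *: grad k x ->
     ((forall k, k \in g -> c k = 0) -> forall k, k \in g -> peval k x = peval k p) ->
     peval Phi x = 0) ->
  exists2 x, peval Phi x = 0 & forall k, k \in g -> peval k x = peval k p.
Proof.
move=> hin hge crit.
pose S : {mpoly R[n]} := \sum_(k <- g) (k - (peval k p)%:MP) ^+ 2.
have SE x : peval S x = \sum_(k <- g) (peval k x - peval k p) ^+ 2.
  by rewrite peval_sum; apply: eq_bigr => k _; rewrite pevalXn pevalB pevalC.
have S0 x : 0 <= peval S x by rewrite SE; apply: sumr_ge0 => k _; rewrite sqr_ge0.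
have Sp : peval S p = 0 by rewrite SE big1 // => k _; rewrite subrr expr0n.
(* On the sphere of squared radius r the function h exceeds its value at p by at least 1. As h is f
   or one of the g, such a point costs too much to be a minimiser once M > C, so minimisers are
   interior. *)
pose r := peval h p + 1.
have pr : dot p p <= r by rewrite (le_trans (hge p)) // lerDl.
have [m0 [m0r _ m0min]] := peval_min f pr (peval0 p).
(* The most that f can drop below its value at p on the ball; it bounds the total penalty M S of any
   minimiser. *)
pose C := peval f p - peval f m0.
have C0 : 0 <= C by rewrite subr_ge0; apply: m0min; rewrite ?peval0.
have approx M : C < M -> exists x, [/\ dot x x <= r, peval Phi x = 0 & M * peval S x <= C].
  move=> CM; have M0 : 0 < M by apply: le_lt_trans CM.
  have [x [xr _ xmin]] := peval_min (f + M *: S) pr (peval0 p).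
  have FE y : peval (f + M *: S) y = peval f y + M * peval S y by rewrite pevalD pevalZ.
  have xp : peval f x + M * peval S x <= peval f p.
    by have := xmin p pr (peval0 p); rewrite !FE Sp mulr0 addr0.
  have fx : peval f m0 <= peval f x by apply: m0min; rewrite ?peval0.
  have SC : M * peval S x <= C by rewrite /C; lra.
  exists x; split=> //.
  have xr' : dot x x < r.
    rewrite lt_neqAle xr andbT; apply/eqP => xE.
    have hx : peval h p + 1 <= peval h x by rewrite -/r -xE.
    move: hin; rewrite in_cons => /orP[/eqP hf|hg].
      have : 0 <= M * peval S x by rewrite mulr_ge0 // ltW.
      by move: hx; rewrite hf; lra.
    have : 1 <= peval S x.
      rewrite SE (big_rem h) //=; apply: ler_wpDr.
        by apply: sumr_ge0 => k _; rewrite sqr_ge0.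
      by nra.
    by move=> S1; have : M <= M * peval S x; [rewrite ler_peMr // ltW|lra].
  have gF : grad (f + M *: S) x = 0.
    by apply: interior_min_grad xr' _ => y yr; apply: xmin; rewrite ?peval0.
  (* The multiplier of k is - 2M (k(x) - k(p)), so if all multipliers vanish then x is already on
     the fibre of p; this is the second fact offered to the hypothesis on critical points. *)
  apply: (crit x (fun k => - (M * (2 * (peval k x - peval k p))))).
    apply/eqP; rewrite -subr_eq0 -[X in _ == X]gF gradD gradZ; apply/eqP; congr (_ + _).
    rewrite -sumrN /S grad_sum scaler_sumr; apply: eq_bigr => k _.
    by rewrite gradXn gradD gradN gradC subr0 pevalB pevalC scaleNr opprK scalerA.
  move=> c0 k kg; apply/eqP; rewrite -subr_eq0; move/eqP: (c0 k kg).
  by rewrite oppr_eq0 !mulf_eq0 (gt_eqF M0) pnatr_eq0.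
clearbody C.
have [x1 [x1r x10 _]] := approx (C + 1) ltac:(lra).
have [x [xr x0 xmin]] := peval_min S x1r x10.
have Sx0 : peval S x = 0.
  apply/eqP; rewrite eq_le S0 andbT leNgt; apply/negP => Spos.
  (* M is chosen with M S(x) > C, which contradicts the minimality of S at x among the zeros of Phi
     in the ball. *)
  have [|y [yr y0]] := approx (C / peval S x + C + 1).
    by rewrite -addrA ltr_wpDl ?divr_ge0 //; lra.
  apply/negP; rewrite -ltNge; have := xmin y yr y0 => Sxy.
  have Mpos : 0 < C / peval S x + C + 1.
    by rewrite -addrA ltr_wpDl ?divr_ge0 //; lra.
  apply: lt_le_trans (ler_wpM2l (ltW Mpos) Sxy).
  by rewrite !mulrDl divfK ?gt_eqF // mul1r; have := mulr_ge0 C0 (ltW Spos); lra.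
exists x => // k kg; apply/eqP; rewrite -subr_eq0 -sqrf_eq0.
move/eqP: Sx0; rewrite SE psumr_eq0 => [/allP /(_ k kg) //|i _]; exact: sqr_ge0.
Qed.

(** * Jacobians and mirrors *)

Lemma msize_mderiv (R : realType) (n : nat) (f : {mpoly R[n]}) i :
  (msize f^`M(i) <= (msize f).-1)%N.
Proof.
rewrite msizeE; apply/bigmax_leqP_seq => m; rewrite mcoeff_msupp mcoeff_mderiv => h _.
have : (m + U_(i))%MM \in msupp f.
  by rewrite mcoeff_msupp; apply: contraNneq h => ->; rewrite mul0rn.
by move/msize_mdeg_lt; rewrite mdegD mdeg1; lia.
Qed.

Lemma poly_nonroot (R : realType) (P : {poly R}) : P != 0 -> exists t, P.[t] != 0.
Proof.
move=> P0; apply: contrapT => /forallNP h.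
pose s := [seq k%:R : R | k <- iota 0 (size P)].
have : (size s < size P)%N.
  apply: max_poly_roots P0 _ _.
    by apply/allP => t _; rewrite rootE; apply/negPn/negP; exact: h.
  by rewrite map_inj_uniq ?iota_uniq // => i j /eqP; rewrite eqr_nat => /eqP.
by rewrite size_map size_iota ltnn.
Qed.

Section Generic.
Variables (R : realType) (n : nat).

Definition somewhere_nonzero (f : {mpoly R[n]}) := exists x, peval f x != 0.

(** On the line joining the two points both restrictions are nonzero polynomials in one variable,
    and so is their product. *)
Lemma somewhere_nonzeroM f g :
  somewhere_nonzero f -> somewhere_nonzero g -> somewhere_nonzero (f * g).
Proof.
move=> [x fx] [y gy].
have fl : on_line x (y - x) f != 0.
  by apply: contraNneq fx => h; rewrite -[x]addr0 -(scale0r (y - x)) -on_lineE h horner0.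
have gl : on_line x (y - x) g != 0.
  apply: contraNneq gy => h.
  by rewrite -[y](subrK x) addrC -[y - x]scale1r -on_lineE h horner0.
have [t ht] := poly_nonroot (mulf_neq0 fl gl).
by exists (x + t *: (y - x)); rewrite pevalM -!on_lineE -hornerM.
Qed.

Lemma somewhere_nonzero_prod (I : finType) (P : pred I) (F : I -> {mpoly R[n]}) :
  (forall i, P i -> somewhere_nonzero (F i)) -> somewhere_nonzero (\prod_(i | P i) F i).
Proof.
move=> h; apply: (big_ind somewhere_nonzero) h; last exact: somewhere_nonzeroM.
by exists 0; rewrite -mpolyC1 pevalC oner_eq0.
Qed.

Lemma somewhere_nonzero_affine (a : 'cV[R]_n) c :
  a != 0 -> somewhere_nonzero (linear_form a - c%:MP).
Proof.
move=> a0; exists (((c + 1) / dot a a) *: a).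
by rewrite pevalB pevalC peval_linear_form dotZr divfK ?dot_eq0 // addrC addKr oner_eq0.
Qed.

End Generic.

Definition jac (R : realType) (n N : nat) (r : 'I_N -> {mpoly R[n]}) (x : 'cV[R]_n) :
    'M[R]_(N, n) :=
  \matrix_(i, j) grad (r i) x j 0.

Definition jacobian (R : realType) (N : nat) (r : 'I_N -> {mpoly R[N]}) : {mpoly R[N]} :=
  \det (\matrix_(i, j) (r i)^`M(j)).

(** No two of the vectors are proportional, so their mirrors are distinct. Concluding s = 0 is
    enough: t = 0 is the same clause with i and j exchanged. *)
Definition pairwise_independent (R : realType) (N : nat) (I : finType) (a : I -> 'cV[R]_N) :=
  (forall i, a i != 0) /\
  (forall i j, i != j -> forall s t, s *: a i + t *: a j = 0 -> s = 0).

Section Jacobian.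
Variables (R : realType) (N : nat) (r : 'I_N -> {mpoly R[N]}).

Lemma peval_jacobian x : peval (jacobian r) x = \det (jac r x).
Proof.
rewrite /peval /jacobian -det_map_mx; congr (\det _).
by apply/matrixP => i j; rewrite !mxE.
Qed.

Lemma jac_singular x w :
  w != 0 -> (forall i, dot (grad (r i) x) w = 0) -> \det (jac r x) = 0.
Proof.
move=> w0 h; apply/eqP; rewrite -det_tr; apply/det0P; exists w^T.
  by apply: contra_neq w0 => /(congr1 trmx); rewrite trmxK trmx0.
apply/matrixP => i j; rewrite ord1 -trmx_mul !mxE -[RHS](h j).
by apply: eq_bigr => k _; rewrite !mxE.
Qed.

Lemma jac_nonsingular x :
  (forall c : 'I_N -> R, \sum_i c i *: grad (r i) x = 0 -> forall i, c i = 0) ->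
  \det (jac r x) != 0.
Proof.
move=> h; apply/negP => /det0P[c /eqP c0 hc]; apply: c0; apply/rowP => i; rewrite mxE.
apply: (h (fun i => c 0 i)); apply/colP => j; rewrite summxE mxE.
move/rowP/(_ j): hc; rewrite !mxE => hc; rewrite -[RHS]hc.
by apply: eq_bigr => k _; rewrite !mxE.
Qed.

Variables (e : 'I_N -> nat) (I : finType) (a : I -> 'cV[R]_N) (x1 : 'cV[R]_N).
Hypothesis r_deg : forall i, (msize (r i) <= (e i).+1)%N.
Hypothesis a_indep : pairwise_independent a.
Hypothesis r_van : forall i x, dot (a i) x = 0 -> \det (jac r x) = 0.
Hypothesis r_x1 : \det (jac r x1) != 0.

(** Row i of the Jacobian matrix has degree at most e i - 1, so the determinant has degree at most
    the sum of the e i minus N; its size may be one more. *)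
Lemma size_jacobian_on_line x v :
  (size (on_line x v (jacobian r)) <= (\sum_i e i).+1 - N)%N.
Proof.
rewrite /on_line /jacobian.
pose phi := fun f : {mpoly R[N]} => on_line x v f.
rewrite -[mmap _ _ _]/((mmap polyC (fun i => (x i 0)%:P + v i 0 *: 'X) : {rmorphism {mpoly R[N]} -> {poly R}}) _).
rewrite -det_map_mx; apply: (leq_trans (size_sum _ _ _)).
apply/bigmax_leqP => s _; rewrite -signr_odd; case: (odd _).
  rewrite expr1 mulN1r size_polyN.
  apply: (leq_trans (size_poly_prod_leq _ _)); rewrite cardE size_enum_ord leq_sub2r // ltnS.
  apply: leq_sum => i _; rewrite !mxE; apply: (leq_trans (size_on_line _ _ _)).
  by apply: (leq_trans (msize_mderiv _ _)); have := r_deg i; lia.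
rewrite expr0 mul1r.
apply: (leq_trans (size_poly_prod_leq _ _)); rewrite cardE size_enum_ord leq_sub2r // ltnS.
apply: leq_sum => i _; rewrite !mxE; apply: (leq_trans (size_on_line _ _ _)).
by apply: (leq_trans (msize_mderiv _ _)); have := r_deg i; lia.
Qed.

(* A generic line through x meets the #|I| mirrors in distinct points, none of
   them x; the Jacobian vanishes there. *)
Lemma mirror_count x : (forall i, dot (a i) x != 0) ->
  (#|I| + (\det (jac r x) == 0 :> R)%R + N <= \sum_i e i)%N.
Proof.
move=> ax.
(* A point y where F is nonzero spans a generic line with x: the first factor keeps the Jacobian
   from vanishing on the whole line, the second makes the line cross every mirror, and the third
   makes the crossings distinct. *)
pose F := jacobian r * \prod_i (linear_form (a i) - (dot (a i) x)%:MP) *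
  \prod_(ij : I * I | ij.1 != ij.2)
    (linear_form (dot (a ij.1) x *: a ij.2 - dot (a ij.2) x *: a ij.1) - 0%:MP).
have [y] : somewhere_nonzero F.
  apply: somewhere_nonzeroM.
    apply: somewhere_nonzeroM; first by exists x1; rewrite peval_jacobian.
    by apply: somewhere_nonzero_prod => i _; apply: somewhere_nonzero_affine; apply a_indep.
  apply: somewhere_nonzero_prod => -[i j] /= ij; apply: somewhere_nonzero_affine.
  apply: contraNneq (ax i) => h; apply/eqP.
  by apply: (a_indep.2 j i _ _ (- dot (a j) x)); rewrite 1?eq_sym // scaleNr.
rewrite /F !pevalM !mulf_eq0 !negb_or !peval_prod => /andP[/andP[Jy /prodf_neq0 ay] /prodf_neq0 aay].
pose v := y - x; pose P := on_line x v (jacobian r).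
have av i : dot (a i) v != 0.
  by have := ay i isT; rewrite pevalB pevalC peval_linear_form -dotBr.
pose tt i := - (dot (a i) x / dot (a i) v).
have P0 : P != 0.
  apply: contraNneq Jy => h.
  by rewrite -[y](subrK x) addrC -[y - x]scale1r -on_lineE -/v -/P h horner0.
have rootP i : root P (tt i).
  rewrite rootE /P on_lineE peval_jacobian; apply/eqP; apply: (r_van (i := i)).
  by rewrite dotDr dotZr mulNr divfK // subrr.
have tt0 i : tt i != 0 by rewrite oppr_eq0 mulf_neq0 ?invr_eq0.
have tt_inj : injective tt.
  move=> i j /oppr_inj /eqP; rewrite eqr_div // => /eqP h.
  apply/eqP/negPn/negP => ij; have := aay (i, j) ij.
  rewrite pevalB pevalC subr0 peval_linear_form dotDl -scaleNr !dotZl /= => /eqP; apply.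
  move: h; rewrite /v !dotBr; lra.
(* If the Jacobian vanishes at x, the parameter 0 is one more root, distinct from the crossings
   because x is on no mirror. *)
pose s := [seq tt i | i <- enum I] ++ nseq (\det (jac r x) == 0 :> R) 0.
have : (size s < size P)%N.
  apply: max_poly_roots P0 _ _.
    rewrite all_cat; apply/andP; split; first by apply/allP => _ /mapP[i _ ->].
    case: eqP => //= h; rewrite andbT rootE /P on_lineE scale0r addr0 peval_jacobian.
    exact/eqP.
  rewrite cat_uniq map_inj_uniq ?enum_uniq //=; case: eqP => //= _; rewrite orbF andbT.
  by apply/mapP => -[i _ /esym/eqP]; exact/negP.
have := size_jacobian_on_line x v; rewrite -/P size_cat size_map size_nseq -cardE => h1 h2.
by have := leq_trans h2 h1; rewrite ltn_subRL ltnS addnC.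
Qed.

(** The count is made from [x1] itself, which is off the mirrors because the Jacobian is nonzero
    there. *)
Lemma mirror_number : (#|I| + N <= \sum_i e i)%N.
Proof.
have := @mirror_count x1; rewrite (negPf r_x1) addn0; apply=> i.
by apply: contraNneq r_x1 => /r_van ->.
Qed.

(** When the degrees leave room for no root besides the crossings with the mirrors, the Jacobian
    cannot vanish at x as well. *)
Lemma jac_neq0 x : (\sum_i e i <= #|I| + N)%N ->
  (forall i, dot (a i) x != 0) -> \det (jac r x) != 0.
Proof. move=> h /mirror_count; case: eqP => //= _; rewrite addn1 => /leq_trans /(_ h).
by rewrite addSn ltnn. Qed.

End Jacobian.

(** * Reflections and gradients of invariants *)

Section Reflections.
Variables (R : realType) (n : nat).
Implicit Types (a x y : 'cV[R]_n).

Lemma reflmxE a x : reflmx a *m x = x - (2 * dot a x / dot a a) *: a.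
Proof.
rewrite /reflmx mulmxBl mul1mx -scalemxAl -mulmxA dotE; congr (_ - _).
rewrite (mx11_scalar (a^T *m x)) dotE mul_mx_scalar scalerA; congr (_ *: _).
by rewrite mulrAC.
Qed.

Lemma dot_reflmx a x : a != 0 -> dot a (reflmx a *m x) = - dot a x.
Proof. by move=> a0; rewrite reflmxE dotBr dotZr divfK ?dot_eq0 //; ring. Qed.

Lemma reflmxK a x : a != 0 -> reflmx a *m (reflmx a *m x) = x.
Proof.
move=> a0; rewrite {1}reflmxE dot_reflmx // reflmxE mulrN mulNr scaleNr opprK.
by rewrite subrK.
Qed.

Lemma reflmx_unit a : a != 0 -> reflmx a \in unitmx.
Proof.
move=> a0; suff h : reflmx a *m reflmx a = 1%:M by have [] := mulmx1_unit h.
apply/row_matrixP => i; apply/rowP => j.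
have /colP/(_ i) := reflmxK (delta_mx j 0) a0.
by rewrite mulmxA -colE !mxE eqxx andbT.
Qed.

(** From a point x of the mirror, the reflection sends x + ta to x - ta, so f is an even function of
    t and its derivative at 0 vanishes. *)
Lemma grad_reflmx (f : {mpoly R[n]}) a x : a != 0 ->
  (forall y, peval f (reflmx a *m y) = peval f y) ->
  dot a x = 0 -> dot (grad f x) a = 0.
Proof.
move=> a0 finv ax; pose P := on_line x a f.
have PE : P \Po (- 'X) = P.
  apply/eqP; rewrite -subr_eq0; apply: contraT => /poly_nonroot[t /eqP[]].
  rewrite hornerD hornerN horner_comp hornerN hornerX !on_lineE.
  apply/eqP; rewrite subr_eq0 -finv reflmxE dotDr dotZr ax add0r mulrA mulfK ?dot_eq0 //.
  by rewrite -addrA -scalerBl; apply/eqP; congr (peval f (_ + _ *: _)); ring.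
have := congr1 (fun Q : {poly R} => Q^`().[0]) PE.
rewrite deriv_comp derivN derivX mulrN1 hornerN horner_comp hornerN hornerX oppr0.
by rewrite deriv_on_line0 => h; lra.
Qed.

End Reflections.

Lemma invariant_poly_unit (R : realType) (n : nat) (G : set 'M[R]_n) f g y :
  invariant_poly G f -> G g -> g \in unitmx -> peval f (g *m y) = peval f y.
Proof. by move=> finv Gg gu; rewrite -{2}(mulKmx gu y) finv. Qed.

(** * Weighted homogeneous expressions *)

Definition weight (N : nat) (e : 'I_N -> nat) (m : 'X_{1..N}) : nat := \sum_i m i * e i.

Section Weighted.
Variables (R : realType) (N n : nat) (q : N.-tuple {mpoly R[n]}) (e : 'I_N -> nat).
Hypothesis q_homog : forall l, tnth q l \is (e l).-homog.

Lemma comp_mpolyX_homog m : 'X_[m] \mPo q \is (weight e m).-homog.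
Proof.
rewrite comp_mpolyX /weight.
elim/big_rec2: _ => [|i k f _ h]; first exact: dhomog1.
by apply: dhomogM => //; rewrite mulnC; apply: dhomogMn.
Qed.

Lemma weighted_homog_lift (Q : {mpoly R[N]}) d : Q \mPo q \is d.-homog ->
  exists2 Q' : {mpoly R[N]}, Q \mPo q = Q' \mPo q & forall m, m \in msupp Q' -> weight e m = d.
Proof.
move=> Qd; exists (\sum_(m <- msupp Q | weight e m == d) Q@_m *: 'X_[m]).
  rewrite -{1}(pihomog_dE Qd) {1}(mpolyE Q) (raddf_sum (comp_mpoly q)) (raddf_sum (pihomog mdeg d)).
  rewrite (raddf_sum (comp_mpoly q)) [RHS]big_mkcond /=.
  apply: eq_bigr => m _; rewrite comp_mpolyZ linearZ /=; case: eqP => [h|/eqP h].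
    by rewrite pihomog_dE // -h comp_mpolyX_homog.
  by rewrite (pihomog_ne0 h) ?scaler0 // comp_mpolyX_homog.
move=> m; rewrite mcoeff_msupp; apply: contraNeq => mw.
rewrite raddf_sum /= big1 // => m' /eqP m'w; rewrite mcoeffZ mcoeffX.
by case: eqP => [mm|_]; [rewrite -m'w mm eqxx in mw|rewrite mulr0].
Qed.

End Weighted.

Definition values (R : realType) (N n : nat) (q : N.-tuple {mpoly R[n]}) (x : 'cV[R]_n) : 'cV[R]_N :=
  \col_l peval (tnth q l) x.

Lemma peval_comp_mpoly (R : realType) (N n : nat) (q : N.-tuple {mpoly R[n]}) f x :
  peval (f \mPo q) x = peval f (values q x).
Proof. by rewrite /peval comp_mpoly_meval; apply: meval_eq => i; rewrite mxE. Qed.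

Lemma jac_comp_mpoly (R : realType) (N n M : nat) (q : N.-tuple {mpoly R[n]})
    (Q : 'I_M -> {mpoly R[N]}) x :
  jac (fun j => Q j \mPo q) x = jac Q (values q x) *m jac (tnth q) x.
Proof.
apply/matrixP => j i; rewrite !mxE mderiv_comp_mpoly peval_sum; apply: eq_bigr => l _.
by rewrite pevalM peval_comp_mpoly !mxE.
Qed.

(* Conjugating by diagonal matrices of powers of t and letting t tend to 0. *)
Lemma det_weighted (R : realType) (N : nat) (M : 'M[R]_N) (d e : 'I_N -> nat) :
  (forall j l, (d j < e l)%N -> M j l = 0) -> (\sum_j d j = \sum_l e l)%N ->
  \det M = \det (\matrix_(j, l) if e l == d j then M j l else 0).
Proof.
move=> M0 de.
pose D (w : 'I_N -> nat) : 'M[{poly R}]_N := diag_mx (\row_j 'X^(w j)).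
pose Mt : 'M[{poly R}]_N := \matrix_(j, l) if (e l <= d j)%N then (M j l)%:P * 'X^(d j - e l) else 0.
have DM : D d *m map_mx polyC M = Mt *m D e.
  rewrite mul_diag_mx mul_mx_diag; apply/matrixP => j l; rewrite !mxE.
  case: leqP => [h|/M0 ->]; last by rewrite polyC0 mulr0 mul0r.
  by rewrite -mulrA -exprD subnK // mulrC.
have detD w : \det (D w) = 'X^(\sum_j w j).
  by rewrite det_diag (eq_bigr (fun j => 'X^(w j))) ?prodrXr // => j _; rewrite mxE.
(* Since d and e have the same sum, the two diagonal determinants are the same power of X and
   cancel. At X = 0 only the entries of [Mt] with e l = d j survive. *)
have := congr1 determinant DM; rewrite !det_mulmx !detD de [RHS]mulrC => /mulfI h.
have {}h : (\det M)%:P = \det Mt.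
  by rewrite -h ?det_map_mx // expf_neq0 ?polyX_eq0.
have := congr1 (horner_eval 0) h; rewrite /horner_eval hornerC => ->.
rewrite -/(horner_eval 0 _) -det_map_mx; congr (\det _); apply/matrixP => j l; rewrite !mxE.
case: ltngtP => [h1|h1|->] /=.
- by rewrite /horner_eval hornerM hornerXn expr0n subn_eq0 leqNgt h1 mulr0.
- by rewrite /horner_eval horner0.
- by rewrite subnn expr0 mulr1 /horner_eval hornerC.
Qed.

(** * Basic invariants *)

Lemma leq_sum_eq (N : nat) (d e : 'I_N -> nat) :
  (forall j, (e j <= d j)%N) -> (\sum_j d j <= \sum_j e j)%N -> forall j, e j = d j.
Proof.
move=> ed de j; apply/eqP; rewrite eqn_leq ed /= leqNgt; apply/negP => h.
move: de; rewrite (bigD1 j) //= [leqRHS](bigD1 j) //= leqNgt => /negP; apply.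
by rewrite -addSn; apply: leq_add => //; apply: leq_sum.
Qed.

Definition degree (R : realType) (n N : nat) (q : N.-tuple {mpoly R[n]}) (l : 'I_N) : nat :=
  (msize (tnth q l)).-1.

Section BasicInvariants.
Variables (R : realType) (N : nat) (G : set 'M[R]_N) (q : N.-tuple {mpoly R[N]}).
Variables (p : 'I_N -> {mpoly R[N]}) (d : 'I_N -> nat) (x1 : 'cV[R]_N).
Variables (I : finType) (a : I -> 'cV[R]_N).
Hypothesis q_basic : basic_invariants G q.
Hypothesis p_homog : forall j, p j \is (d j).-homog.
Hypothesis p_inv : forall j, invariant_poly G (p j).
Hypothesis p_x1 : \det (jac p x1) != 0.
Hypothesis a_indep : pairwise_independent a.
Hypothesis a_refl : forall i, G (reflmx (a i)).
Hypothesis d_count : (\sum_j d j <= #|I| + N)%N.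

Local Notation e := (degree q).

Let q_homog l : tnth q l \is (e l).-homog.
Proof. by case: q_basic => /(_ l). Qed.

Let q_inv l : invariant_poly G (tnth q l).
Proof.
by case: q_basic => _ _ h _; apply/h; exists 'X_l; rewrite comp_mpolyXU -tnth_nth.
Qed.

(** At a point of the mirror of a i all the gradients are orthogonal to a i. *)
Lemma det_jac_mirror (r : 'I_N -> {mpoly R[N]}) i x :
  (forall l, invariant_poly G (r l)) -> dot (a i) x = 0 -> \det (jac r x) = 0.
Proof.
move=> r_inv ax; have a0 : a i != 0 by apply a_indep.
apply: (jac_singular a0) => l; apply: grad_reflmx => // y.
by apply: (invariant_poly_unit _ (r_inv l)) => //; exact: reflmx_unit.
Qed.

Lemma weighted_expression : exists Q : 'I_N -> {mpoly R[N]},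
  (forall j, p j = Q j \mPo q) /\ (forall j m, m \in msupp (Q j) -> weight e m = d j).
Proof.
have /choice[Q hQ] j : exists Q : {mpoly R[N]},
    p j = Q \mPo q /\ forall m, m \in msupp Q -> weight e m = d j.
  have [_ _ h _] := q_basic; have [Q pQ] := (h (p j)).1 (p_inv j).
  have := p_homog j; rewrite pQ => /(weighted_homog_lift q_homog)[Q' -> hQ'].
  by exists Q'.
by exists Q; split => j; have [] := hQ j.
Qed.

Lemma weight_ge (m : 'X_{1..N}) l : (m l * e l <= weight e m)%N.
Proof. by rewrite /weight (bigD1 l) //= leq_addr. Qed.

(** With p j = Q j (q), the matrix M of the derivatives of the Q j is invertible at [x1] by the
    chain rule. Keeping only its entries between equal degrees gives an invertible matrix C of
    constants, and u is a row of its inverse: up to terms in basic invariants of lower degree, q l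
    is the sum of the u j p j. *)
Lemma basic_invariants_structure :
  (exists s : 'S_N, forall j, e (s j) = d j) /\
  forall l, exists u : 'I_N -> R, [/\ exists j, u j != 0,
    forall j, u j != 0 -> d j = e l
  & forall x y, (forall j, (d j < e l)%N -> peval (p j) x = peval (p j) y) ->
      \sum_j u j * peval (p j) x = \sum_j u j * peval (p j) y ->
      peval (tnth q l) x = peval (tnth q l) y].
Proof.
have [Q [pQ Qw]] := weighted_expression.
pose M := jac Q (values q x1).
have pM : jac p x1 = M *m jac (tnth q) x1.
  by rewrite -jac_comp_mpoly; congr (jac _ _); apply/funext => j.
have [M0 q_x1] : \det M != 0 /\ \det (jac (tnth q) x1) != 0.
  by move: p_x1; rewrite pM det_mulmx mulf_eq0 negb_or => /andP[].
have e_gt0 l : (0 < e l)%N.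
  rewrite lt0n; apply: contraNneq q_x1 => el.
  rewrite (expand_det_row _ l) big1 // => i _; rewrite mxE gradE.
  have : (msize (tnth q l) <= 1)%N by move: el; rewrite /degree; case: (msize _) => [|[]].
  by move=> /msize1_polyC ->; rewrite mderivC peval0 mul0r.
have weight0 m : weight e m = 0%N -> m = 0%MM.
  move=> m0; apply/mnmP => l; rewrite mnm0E; have := weight_ge m l.
  by rewrite m0 leqn0 muln_eq0 => /orP[/eqP //|/eqP h]; have := e_gt0 l; rewrite h.
(* A monomial containing the variable l has weight at least e l, too much for Q j. *)
have M_lt j l : (d j < e l)%N -> M j l = 0.
  move=> djl; rewrite mxE gradE (_ : (Q j)^`M(l) = 0) ?peval0 //.
  apply/mpolyP => m; rewrite mcoeff0 mcoeff_mderiv; apply/eqP/negPn/negP => h.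
  have : (m + U_(l))%MM \in msupp (Q j).
    by rewrite mcoeff_msupp; apply: contraNneq h => ->; rewrite mul0rn.
  move=> /Qw w; have := weight_ge (m + U_(l))%MM l; rewrite w mnmDE mnm1E eqxx addn1.
  by rewrite leqNgt mulSn => /negP; apply; rewrite ltn_addr.
(* In equal degree the variable l can only occur in Q j as a linear term, so the derivative is its
   coefficient. *)
have M_eq j l : d j = e l -> M j l = (Q j)@_(U_(l)).
  move=> djl; rewrite mxE gradE.
  have /msize1_polyC -> : (msize (Q j)^`M(l) <= 1)%N.
    rewrite msizeE; apply/bigmax_leqP_seq => m; rewrite mcoeff_msupp mcoeff_mderiv => h _.
    have : (m + U_(l))%MM \in msupp (Q j).
      by rewrite mcoeff_msupp; apply: contraNneq h => ->; rewrite mul0rn.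
    move=> /Qw; rewrite /weight (eq_bigr (fun i => m i * e i + U_(l)%MM i * e i)%N); last first.
      by move=> i _; rewrite mnmDE mulnDl.
    rewrite big_split /= [X in (_ + X)%N](bigD1 l) //= [X in (_ + (_ + X))%N]big1 ?addn0; last first.
      by move=> i il; rewrite mnm1E eq_sym (negPf il).
    rewrite mnm1E eqxx mul1n djl => /eqP; rewrite -[X in _ == X]add0n eqn_add2r => /eqP /weight0 ->.
    by rewrite mdeg0.
  by rewrite pevalC mcoeff_mderiv mnm0E mulr1n add0m.
have e_count : (#|I| + N <= \sum_l e l)%N.
  apply: (@mirror_number _ _ (tnth q) e I a x1) => // [l|i x]; first exact: leqSpred.
  exact: det_jac_mirror.
(* A nonzero term of the determinant. Its entries give e (s j) <= d j for all j, and the mirror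
   count bounds the sums the other way, so equality holds throughout. *)
have [s hs] : exists s : 'S_N, forall j, M j (s j) != 0.
  apply: contrapT => /forallNP h; move/eqP: M0; apply; rewrite /determinant big1 // => s _.
  have /existsNP[j /negP/negPn/eqP Mj] := h s.
  by rewrite (bigD1 j) //= Mj mul0r mulr0.
have es j : e (s j) = d j.
  apply: (@leq_sum_eq _ d (fun i => e (s i))) => [i|].
    by rewrite leqNgt; apply: contra (hs i) => /M_lt ->.
  by rewrite (leq_trans d_count) // (leq_trans e_count) // (reindex_inj (@perm_inj _ s)).
split; first by exists s.
have de : (\sum_j d j = \sum_l e l)%N.
  by rewrite [RHS](reindex_inj (@perm_inj _ s)); apply: eq_bigr => j _; rewrite -es.
pose C : 'M[R]_N := \matrix_(j, l) if e l == d j then M j l else 0.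
have Cu : C \in unitmx by rewrite unitmxE unitfE -(det_weighted M_lt de).
pose u l j : R := if d j == e l then invmx C l j else 0.
have uC l l' : \sum_j u l j * C j l' = (l == l')%:R.
  have [ell'|ell'] := eqVneq (e l') (e l); last first.
    rewrite big1 => [|j _]; first by case: (l =P l') ell' => // ->; rewrite eqxx.
    rewrite /u mxE; case: eqP => [->|_]; last by rewrite mul0r.
    by rewrite (negPf ell') mulr0.
  have := mulVmx Cu => /matrixP/(_ l l'); rewrite !mxE => <-.
  apply: eq_bigr => j _; rewrite /u; case: eqP => // /eqP dj.
  by rewrite !mxE ell' eq_sym (negPf dj) mul0r mulr0.
(* When x and y agree on the basic invariants of degree below d j, the values of p j differ only
   through the linear terms of Q j. *)
have lin j x y : (forall l, (e l < d j)%N -> peval (tnth q l) x = peval (tnth q l) y) ->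
    peval (p j) x - peval (p j) y =
    \sum_l C j l * (peval (tnth q l) x - peval (tnth q l) y).
  move=> low; rewrite pQ !peval_comp_mpoly /peval !mevalE -sumrB.
  have term m : m \in msupp (Q j) ->
      (Q j)@_m * (\prod_i values q x i 0 ^+ m i) - (Q j)@_m * (\prod_i values q y i 0 ^+ m i) =
      \sum_l (if e l == d j then (Q j)@_m * (U_(l)%MM == m)%:R else 0)
          * (peval (tnth q l) x - peval (tnth q l) y).
    move=> mQ; have w := Qw j m mQ.
    (* A monomial of weight d j that contains a variable of degree at least d j is that variable
       alone; any other monomial involves only lower degrees, where x and y agree. *)
    have [[l /andP[ml el]]|/forallNP h] := pselect (exists l, (0 < m l)%N && (d j <= e l)%N).
      have ml1 : m = U_(l)%MM.
        have mE : m = (m - U_(l) + U_(l))%MM.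
          by rewrite submK //; apply/mnm_lepP => i; rewrite mnm1E; case: eqP => // <-.
        rewrite mE; suff -> : (m - U_(l) = 0)%MM by rewrite add0m.
        apply: weight0; have : (weight e (m - U_(l))%MM + e l = d j)%N.
          rewrite -w {2}mE /weight -[in RHS](big_mkcond xpredT) /=.
          under [RHS]eq_bigr do rewrite mnmDE mulnDl.
          rewrite big_split /=; congr (_ + _)%N.
          rewrite (bigD1 l) //= big1 ?addn0 => [|i il]; first by rewrite mnm1E eqxx mul1n.
          by rewrite mnm1E eq_sym (negPf il).
        by move: el => /[swap] <-; rewrite -[leqRHS]add0n leq_add2r leqn0 => /eqP.
      have el' : e l = d j.
        rewrite -w ml1 /weight (bigD1 l) //= big1 ?addn0 => [|i il].
          by rewrite mnm1E eqxx mul1n.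
        by rewrite mnm1E eq_sym (negPf il).
      rewrite [RHS](bigD1 l) //= [X in _ = _ + X]big1 ?addr0 => [|i il]; last first.
        case: ifP => _; last by rewrite mul0r.
        rewrite ml1; case: eqP => [/mnmP/(_ l)|_]; last by rewrite mulr0 mul0r.
        by rewrite !mnm1E eqxx (negPf il).
      rewrite el' eqxx ml1 eqxx mulr1 -mulrBr; congr (_ * (_ - _)).
        rewrite (bigD1 l) //= big1 ?mulr1 => [|i il]; first by rewrite mnm1E eqxx expr1 mxE.
        by rewrite mnm1E eq_sym (negPf il) expr0.
      rewrite (bigD1 l) //= big1 ?mulr1 => [|i il]; first by rewrite mnm1E eqxx expr1 mxE.
      by rewrite mnm1E eq_sym (negPf il) expr0.
    rewrite -mulrBr (eq_bigr (fun i => values q y i 0 ^+ m i)) => [|i _]; last first.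
      have [->|m0] := posnP (m i); first by rewrite !expr0.
      rewrite !mxE low // ltnNge; apply/negP => hd.
      by have := h i; rewrite m0 hd.
    rewrite subrr mulr0 big1 // => l _; case: eqP => [el|_]; last by rewrite mul0r.
    case: eqP => [lm|_]; last by rewrite mulr0 mul0r.
    by have := h l; rewrite -lm mnm1E eqxx el leqnn.
  rewrite big_seq (eq_bigr _ term) -big_seq exchange_big /=; apply: eq_bigr => l _.
  rewrite -mulr_suml; congr (_ * _); rewrite mxE; case: eqP => [el|_]; last by rewrite big1.
  rewrite (M_eq _ _ (esym el)); have [lQ|lQ] := boolP (U_(l)%MM \in msupp (Q j)).
    rewrite (bigD1_seq U_(l)%MM) ?msupp_uniq //= eqxx mulr1 big1 ?addr0 // => m ml.
    by rewrite eq_sym (negPf ml) mulr0.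
  rewrite (memN_msupp_eq0 lQ) big_seq big1 // => m mQ.
  by case: eqP => [lm|_]; [rewrite lm mQ in lQ|rewrite mulr0].
(* The relation [lin] multiplied by a row of the inverse of C. *)
have linq l x y : (forall l', (e l' < e l)%N -> peval (tnth q l') x = peval (tnth q l') y) ->
    peval (tnth q l) x - peval (tnth q l) y =
    \sum_j u l j * peval (p j) x - \sum_j u l j * peval (p j) y.
  move=> low; rewrite -[RHS]sumrB.
  under [RHS]eq_bigr => j _.
    rewrite -mulrBr (_ : u l j * _ = \sum_l' u l j * C j l' * (peval (tnth q l') x - peval (tnth q l') y)); last first.
      rewrite /u; case: eqP => [dj|_]; last by rewrite mul0r big1 // => l' _; rewrite !mul0r.
      rewrite lin => [|l']; last by rewrite dj; exact: low.
      by rewrite mulr_sumr; apply: eq_bigr => l' _; rewrite mulrA.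
    over.
  rewrite exchange_big /= (bigD1 l) //= -mulr_suml uC eqxx mul1r big1 ?addr0 // => l' l'l.
  by rewrite -mulr_suml uC eq_sym (negPf l'l) mul0r.
(* Induction on the degree: agreement of the p j below D passes to the basic invariants below D. *)
have lowq D x y : (forall j, (d j < D)%N -> peval (p j) x = peval (p j) y) ->
    forall l, (e l < D)%N -> peval (tnth q l) x = peval (tnth q l) y.
  move=> low l; have [k] := ubnP (e l); elim: k l => // k IH l elk elD.
  apply/eqP; rewrite -subr_eq0 linq => [|l' l'l]; last first.
    by apply: IH; [move: l'l elk; lia|exact: ltn_trans elD].
  rewrite subr_eq0; apply/eqP; apply: eq_bigr => j _; rewrite /u.
  by case: eqP => [dj|_]; [rewrite low // dj|rewrite !mul0r].
move=> l; exists (u l); split.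
- apply: contrapT => /forallNP h; have := uC l l; rewrite eqxx big1 => [/eqP|j _].
    by rewrite eq_sym oner_eq0.
  by have /negP/negPn/eqP -> := h j; rewrite mul0r.
- by move=> j; rewrite /u; case: (d j =P e l) => // _; rewrite eqxx.
- move=> x y low lu; apply/eqP; rewrite -subr_eq0 linq ?lu ?subrr // => l'.
  exact: lowq.
Qed.

End BasicInvariants.

Lemma degree_mono (R : realType) (N : nat) (G : set 'M[R]_N) (q : N.-tuple {mpoly R[N]}) (i j : 'I_N) :
  basic_invariants G q -> (i <= j)%N -> (degree q i <= degree q j)%N.
Proof.
by move=> [_ _ _ q_sorted] ij; rewrite /degree -!subn1 leq_sub2r // q_sorted.
Qed.

(** * Flats and realizations *)

Section Flats.
Variables (R : realType) (N : nat) (G : set 'M[R]_N).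

Lemma mem_mirror (b v : 'cV[R]_N) : b != 0 ->
  (v \in fixedSpace (linfun (mulmx (reflmx b)))) = (dot b v == 0).
Proof.
move=> b0; apply/fixedSpaceP/eqP; rewrite lfunE /= => h.
  by have := dot_reflmx v b0; rewrite h => h'; lra.
by rewrite reflmxE h mulr0 mul0r scale0r subr0.
Qed.

Lemma dim_cap_ker (m : nat) (K : 'M[R]_(m, N)) (U : {vspace 'cV[R]_N}) :
  (\dim U <= \dim (U :&: lker (linfun (mulmx K))) + m)%N.
Proof.
rewrite -{1}(limg_ker_dim (linfun (mulmx K)) U) leq_add2l.
have : (\dim (linfun (mulmx K : 'cV[R]_N -> 'cV[R]_m) @: U) <= \dim {:'cV[R]_m})%N.
  by apply: dimvS; exact: subvf.
by rewrite dimvf /dim /= muln1.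
Qed.

(** A flat of dimension exactly k is required. Intersecting with one more mirror lowers the
    dimension by at most one, so a partial intersection has dimension k. *)
Lemma flat_stratum_chain (k : nat) (x : 'cV[R]_N) (s : seq {vspace 'cV[R]_N}) :
  (k <= N)%N -> (forall H, H \in s -> arrangement G H /\ x \in H) ->
  (\dim (\bigcap_(H <- s) H) <= k)%N -> flat_stratum G k x.
Proof.
move=> kN; elim: s => [_|H s IH Hs].
  rewrite big_nil dimvf /dim /= muln1 => Nk; exists fullv; split; last exact: memvf.
    by exists [::] => //; rewrite big_nil.
  by rewrite dimvf /dim /= muln1; apply/eqP; rewrite eqn_leq Nk kN.
rewrite big_cons; set U := (\bigcap_(H <- s) H)%VS => dk.
have [Uk|kU] := leqP (\dim U) k.
  by apply: IH Uk => H' H's; apply: Hs; rewrite in_cons H's orbT.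
have [[g [_ [b b0 gb]] HE] _] := Hs H (mem_head _ _).
have capE : (H :&: U = U :&: lker (linfun (mulmx b^T)))%VS.
  rewrite capvC; congr (_ :&: _)%VS; apply/vspaceP => v.
  rewrite HE gb mem_mirror // memv_ker lfunE /= -dotE.
  apply/eqP/eqP => [h|->]; last by rewrite mxE.
  by apply/matrixP => i j; rewrite !ord1 h mxE.
exists (H :&: U)%VS; split.
- by exists (H :: s); [move=> H' /Hs[]|rewrite big_cons].
- apply/eqP; rewrite eqn_leq dk /= -(leq_add2r 1) addn1 (leq_trans kU) //.
  by rewrite capE dim_cap_ker.
- rewrite memv_cap (proj2 (Hs H (mem_head _ _))) /=.
  rewrite /U; elim: (s) (fun H' h => proj2 (Hs H' (mem_behead h))) => [|H' s' IHs] hs.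
    by rewrite big_nil memvf.
  rewrite big_cons memv_cap hs ?mem_head //=; apply: IHs => H'' h; apply: hs.
  by rewrite in_cons h orbT.
Qed.

(** The m equations K v = 0, added to those of the mirrors through x, leave only 0; hence these
    mirrors meet in dimension at most m <= k. *)
Lemma flat_stratum_mirrors (I : finType) (a : I -> 'cV[R]_N) (k m : nat)
    (K : 'M[R]_(m, N)) (x : 'cV[R]_N) :
  (forall i, a i != 0) -> (forall i, G (reflmx (a i))) -> (m <= k <= N)%N ->
  (forall v, (forall i, dot (a i) x = 0 -> dot (a i) v = 0) -> K *m v = 0 -> v = 0) ->
  flat_stratum G k x.
Proof.
move=> a0 aG /andP[mk kN] sep.
pose mir i : {vspace 'cV[R]_N} := fixedSpace (linfun (mulmx (reflmx (a i)))).
pose s := [seq mir i | i <- enum I & dot (a i) x == 0].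
apply: (@flat_stratum_chain k x s) => //.
  move=> H /mapP[i]; rewrite mem_filter => /andP[ix _] ->; split.
    by exists (reflmx (a i)) => //; split=> //; exists (a i).
  by rewrite mem_mirror.
apply: leq_trans (dim_cap_ker K _) (leq_trans _ mk).
rewrite (_ : (_ :&: _)%VS = 0%VS) ?dimv0 ?add0n //; apply/eqP.
rewrite -subv0; apply/subvP => v; rewrite memv_cap memv_ker lfunE /= memv0 => /andP[vs /eqP Kv].
apply/eqP; apply: sep Kv => i ix; apply/eqP; rewrite -mem_mirror //.
have : (\bigcap_(H <- s) H <= mir i)%VS.
  have : mir i \in s by apply: map_f; rewrite mem_filter ix eqxx mem_enum.
  elim: (s) => // H s' IHs; rewrite in_cons big_cons => /orP[/eqP ->|/IHs h].
    exact: capvSl.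
  by apply: subv_trans h; exact: capvSr.
by move/subvP; apply.
Qed.

End Flats.

(** * Transport from the model along the isometry [E] *)

Section Realization.
Variables (R : realType) (n N : nat) (W : set 'M[R]_n) (U : set 'cV[R]_n).
Variables (G : set 'M[R]_N) (E : 'M[R]_(n, N)).
Hypothesis EE : E^T *m E = 1%:M.
Hypothesis rangeE : range (mulmx E : 'cV[R]_N -> 'cV[R]_n) = U.
Hypothesis GE : G = [set E^T *m h *m E | h in W].
Hypothesis G_refl : reflection_group G.
Variables (I : finType) (a : I -> 'cV[R]_n).
Hypothesis aW : forall i, W (reflmx (a i)).
Hypothesis aU : forall i, U (a i).
Hypothesis a_indep : pairwise_independent a.

Lemma mulEtK y : U y -> E *m (E^T *m y) = y.
Proof. by rewrite -rangeE => -[x _ <-]; rewrite (mulmxA E^T) EE mul1mx. Qed.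

Lemma range_mem x : U (E *m x).
Proof. by rewrite -rangeE; exists x. Qed.

Lemma dot_Et b y : U b -> U y -> dot (E^T *m b) (E^T *m y) = dot b y.
Proof. by move=> Ub Uy; rewrite -dot_mulmx mulEtK. Qed.

Lemma reflmx_Et b : U b -> reflmx (E^T *m b) = E^T *m reflmx b *m E.
Proof.
move=> Ub; rewrite /reflmx !dotE dot_Et // mulmxBr mulmxBl mulmx1 EE; congr (_ - _).
by rewrite -scalemxAr -scalemxAl trmx_mul trmxK !mulmxA.
Qed.

Let b i := E^T *m a i.

Lemma Et_indep : pairwise_independent b.
Proof.
split=> [i|i j ij s t h].
  apply: contra_neq (a_indep.1 i) => h.
  by rewrite -(mulEtK (aU i)) -/(b i) h mulmx0.
apply: (a_indep.2 i j ij s t); move/(congr1 (mulmx E)): h.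
by rewrite mulmxDr -!scalemxAr !mulEtK // mulmx0.
Qed.

Lemma Et_refl i : G (reflmx (b i)).
Proof. by rewrite reflmx_Et // GE; exists (reflmx (a i)). Qed.

Lemma realized_flat (k m : nat) (K : 'M[R]_(m, n)) y :
  (m <= k <= N)%N -> U y ->
  (forall v, U v -> (forall i, dot (a i) y = 0 -> dot (a i) v = 0) -> K *m v = 0 -> v = 0) ->
  flat_stratum G k (E^T *m y).
Proof.
move=> mkN Uy sep; apply: (@flat_stratum_mirrors _ _ _ _ b k m (K *m E)) => //.
- exact: Et_indep.1.
- exact: Et_refl.
- move=> v hv Kv; have : E *m v = 0.
    apply: sep; [exact: range_mem| |by rewrite mulmxA].
    by move=> i ai; rewrite dot_mulmx; apply: hv; rewrite dot_Et.
  by move/(congr1 (mulmx E^T)); rewrite mulmxA EE mul1mx mulmx0.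
Qed.

Variables (P : 'I_N -> {mpoly R[n]}) (d : 'I_N -> nat) (y1 : 'cV[R]_n).
Hypothesis P_homog : forall j, P j \is (d j).-homog.
Hypothesis WU : forall h y, W h -> U y -> U (h *m y).
Hypothesis P_inv : forall j h y, W h -> U y -> peval (P j) (h *m y) = peval (P j) y.
Hypothesis y1U : U y1.
Hypothesis P_y1 : \det (jac P y1 *m E) != 0.
Hypothesis d_count : (\sum_j d j <= #|I| + N)%N.

Let coords := [tuple linear_form ((row i E)^T) | i < n].
Let p j := P j \mPo coords.

Let coordsE x : values coords x = E *m x.
Proof.
apply/colP => i; rewrite mxE tnth_mktuple peval_linear_form mxE.
by apply: eq_bigr => j _; rewrite !mxE.
Qed.

Let pE j x : peval (p j) x = peval (P j) (E *m x).
Proof. by rewrite peval_comp_mpoly coordsE. Qed.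

Lemma realized_homog j : p j \is (d j).-homog.
Proof.
rewrite /p (mpolyE (P j)) raddf_sum /= big_seq; apply: rpred_sum => m mP.
rewrite comp_mpolyZ; apply: dhomogZ.
have <- : weight (fun=> 1%N) m = d j.
  by rewrite -(dhomog_mf (P_homog j) mP) /= mdegE; apply: eq_bigr => i _; rewrite muln1.
apply: comp_mpolyX_homog => i; rewrite tnth_mktuple /linear_form.
by apply: rpred_sum => l _; apply: dhomogZ; rewrite dhomogX /= mdeg1.
Qed.

Lemma realized_inv j : invariant_poly G (p j).
Proof.
move=> g Gg x; have [_ Go _] := G_refl.
have gu : g \in unitmx by have [] := mulmx1_unit (Go _ Gg).
suff h y : peval (p j) (g *m y) = peval (p j) y.
  by rewrite -{2}(mulKVmx gu x) h.
move: Gg; rewrite GE => -[w Ww <-]; rewrite !pE -!mulmxA mulEtK ?P_inv //.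
  exact: range_mem.
by apply: WU => //; exact: range_mem.
Qed.

Lemma realized_jac : \det (jac p (E^T *m y1)) != 0.
Proof.
rewrite jac_comp_mpoly coordsE mulEtK //; suff -> : jac (tnth coords) (E^T *m y1) = E by [].
by apply/matrixP => i j; rewrite mxE tnth_mktuple grad_linear_form !mxE.
Qed.

Variable q : N.-tuple {mpoly R[N]}.
Hypothesis q_basic : basic_invariants G q.

(** Stated for points of U, so that fibres can be studied in the coordinates of the model. *)
Lemma realized_structure :
  (exists s : 'S_N, forall j, degree q (s j) = d j) /\
  forall l, exists u : 'I_N -> R, [/\ exists j, u j != 0,
    forall j, u j != 0 -> d j = degree q l
  & forall x y, U x -> U y ->
      (forall j, (d j < degree q l)%N -> peval (P j) x = peval (P j) y) ->
      \sum_j u j * peval (P j) x = \sum_j u j * peval (P j) y ->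
      peval (tnth q l) (E^T *m x) = peval (tnth q l) (E^T *m y)].
Proof.
have [s h] := basic_invariants_structure q_basic realized_homog realized_inv
  realized_jac Et_indep Et_refl d_count.
split=> // l; have [u [u0 ud hu]] := h l; exists u; split=> // x y Ux Uy low eqxy.
apply: hu => [j dj|]; first by rewrite !pE !mulEtK // low.
by under eq_bigr do rewrite pE mulEtK //; under [RHS]eq_bigr do rewrite pE mulEtK //.
Qed.

(** With strictly increasing d, the permutation matching the two lists of degrees is increasing,
    hence the identity. So the l-th basic invariant depends only on the P j with j <= l. *)
Lemma realized_fibre (k : nat) x y :
  (forall i j : 'I_N, (i < j)%N -> (d i < d j)%N) -> U x -> U y ->
  (forall j : 'I_N, (j < k)%N -> peval (P j) x = peval (P j) y) ->
  forall l : 'I_N, (l < k)%N -> peval (tnth q l) (E^T *m x) = peval (tnth q l) (E^T *m y).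
Proof.
move=> d_lt Ux Uy Pxy l lk; have [[s hs] /(_ l)[u [_ ud hu]]] := realized_structure.
have s_lt (i j : 'I_N) : (i < j)%N -> (s i < s j)%N.
  move=> /d_lt; rewrite -!hs => h; rewrite ltnNge; apply/negP => /(degree_mono q_basic).
  by rewrite leqNgt h.
(* An increasing self-map satisfies j <= s j, and since s permutes the indices the sums agree, which
   forces equality. *)
have s_ge (j : 'I_N) : (j <= s j)%N.
  case: j => m; elim: m => // m IH mN; have mN' := ltn_trans (ltnSn m) mN.
  by apply: leq_ltn_trans (IH mN') _; exact: s_lt.
have s_id (j : 'I_N) : s j = j.
  apply/val_inj/esym => /=; apply: (@leq_sum_eq _ (fun j => s j : nat) (fun j => j : nat)) => //.
  by rewrite [leqRHS](reindex_inj (@perm_inj _ s)).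
have dl : degree q l = d l by rewrite -hs s_id.
have d_inj (j : 'I_N) : (d j <= d l)%N -> (j <= l)%N.
  by move=> dj; rewrite leqNgt; apply/negP => /d_lt; rewrite ltnNge dj.
apply: hu => // [j|]; first by rewrite dl => /ltnW /d_inj jl; apply: Pxy; exact: leq_ltn_trans lk.
apply: eq_bigr => j _; have [->|/ud] := eqVneq (u j) 0; first by rewrite !mul0r.
by rewrite dl => /eq_leq /d_inj jl; rewrite Pxy //; exact: leq_ltn_trans lk.
Qed.

End Realization.

Lemma sparse_locus (R : realType) (N : nat) (q : N.-tuple {mpoly R[N]}) (k : nat)
    (fs : seq {mpoly R[N]}) (x y : 'cV[R]_N) : (k <= N)%N ->
  (forall f, f \in fs -> in_first_subalgebra q k f) ->
  (forall l : 'I_N, (l < k)%N -> peval (tnth q l) x = peval (tnth q l) y) ->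
  zero_locus fs y -> zero_locus fs x.
Proof.
move=> kN fsq qxy ys f ffs; have [Q fQ] := fsq f ffs; have := ys f ffs; rewrite fQ.
rewrite !peval_comp_mpoly => <-; congr (peval Q _); apply/colP => i; rewrite !mxE tnth_mktuple.
have iN : (i < N)%N by apply: leq_trans kN.
by have := qxy (Ordinal iN) (ltn_ord i); rewrite (tnth_nth 0).
Qed.

Lemma flat_stratum_full (R : realType) (N : nat) (G : set 'M[R]_N) (x : 'cV[R]_N) :
  flat_stratum G N x.
Proof.
by apply: (@flat_stratum_chain _ _ _ _ _ [::]) => //; rewrite big_nil dimvf /dim /= muln1.
Qed.

(** * Types A and B *)

Definition psum (R : realType) (n k : nat) : {mpoly R[n]} := \sum_i 'X_i ^+ k.

Lemma peval_psum (R : realType) (n k : nat) (x : 'cV[R]_n) :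
  peval (psum R n k) x = \sum_i x i 0 ^+ k.
Proof. by rewrite peval_sum; apply: eq_bigr => i _; rewrite pevalXn pevalXU. Qed.

Lemma grad_psum (R : realType) (n k : nat) (x : 'cV[R]_n) i :
  grad (psum R n k) x i 0 = k%:R * x i 0 ^+ k.-1.
Proof.
rewrite grad_sum summxE (bigD1 i) //= big1 => [|j ji].
  by rewrite gradXn gradXU pevalXU !mxE !eqxx mulr1 addr0.
by rewrite gradXn gradXU !mxE [i == j]eq_sym (negPf ji) mulr0.
Qed.

Lemma psum_homog (R : realType) (n k : nat) : psum R n k \is k.-homog.
Proof.
apply: rpred_sum => i _; suff: 'X_i ^+ k \is [in R[n], (1 * k).-homog] by rewrite mul1n.
by apply: dhomogMn; rewrite dhomogX /= mdeg1.
Qed.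

Lemma psum2 (R : realType) (n : nat) (x : 'cV[R]_n) : peval (psum R n 2) x = dot x x.
Proof. by rewrite peval_psum; apply: eq_bigr => i _; rewrite expr2. Qed.

(** This is the relation between gradients read as a polynomial in one coordinate. Its leading term
    comes from the minimised invariant, so it is nonzero whatever the multipliers F are. *)
Lemma poly_lead_neq0 (R : realType) (K : nat) (c : R) (s : seq nat) (F : nat -> R) (w : nat -> nat) :
  c != 0 -> (forall j, j \in s -> (w j < K)%N) ->
  let Q := c *: 'X^K - \sum_(j <- s) F j *: 'X^(w j) in Q != 0 /\ (size Q <= K.+1)%N.
Proof.
move=> c0 ws Q.
have s_size : (size (\sum_(j <- s) F j *: 'X^(w j))%R <= K)%N.
  rewrite big_seq; apply: (leq_trans (size_sum _ _ _)); apply/bigmax_leqP_seq => j js _.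
  by apply: (leq_trans (size_scale_leq _ _)); rewrite size_polyXn ws.
split.
  apply: contraNneq c0 => /(congr1 (fun Q : {poly R} => Q`_K)).
  by rewrite coef0 coefB coefZ coefXn eqxx mulr1 (nth_default _ s_size) subr0 => ->.
rewrite (leq_trans (size_polyD _ _)) // geq_max size_polyN (leq_trans s_size) // andbT.
by rewrite (leq_trans (size_scale_leq _ _)) // size_polyXn.
Qed.

(** Each value taken on S is represented by the least index having it, and there are no more values
    than roots of Q. *)
Lemma root_representatives (R : realType) (n K : nat) (Q : {poly R}) (y : 'I_n -> R) (S : pred 'I_n) :
  Q != 0 -> (size Q <= K.+1)%N -> (forall i, S i -> Q.[y i] = 0) ->
  exists I : {set 'I_n}, (#|I| <= K)%N /\ forall i, S i -> exists2 j, j \in I & y i = y j.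
Proof.
move=> Q0 QK root_y.
exists (finset (fun i => S i && [forall j, (S j && (y j == y i)) ==> (i <= j)%N])); split.
  rewrite -ltnS (leq_trans _ QK) // cardE -(size_map y); apply: max_poly_roots Q0 _ _.
    apply/allP => _ /mapP[i iS ->]; move: iS; rewrite mem_enum inE => /andP[Si _].
    by rewrite rootE root_y.
  rewrite map_inj_in_uniq ?enum_uniq // => i j; rewrite !mem_enum !inE.
  move=> /andP[Si /forallP/(_ j)/implyP hi] /andP[Sj /forallP/(_ i)/implyP hj] yij.
  by apply/val_inj/eqP; rewrite eqn_leq hi ?hj // ?Si ?Sj yij eqxx.
move=> i Si; have Pi : S i && (y i == y i) by rewrite Si eqxx.
case: (@arg_minnP _ i (fun j => S j && (y j == y i)) (@nat_of_ord n) Pi) => j /andP[Sj /eqP yj] jmin.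
exists j => //; rewrite inE Sj; apply/forallP => l; apply/implyP => /andP[Sl /eqP yl].
by apply: jmin; rewrite Sl yl yj eqxx.
Qed.

(** Over the reals a sum of squares is an intersection of zero sets and a product a union. So the
    closed condition that at most K indices carry all the values Y i with i in S and c i nonzero is
    the vanishing of one polynomial, as the penalty method requires. *)
Definition representative_poly (R : realType) (n K : nat) (S : pred 'I_n)
    (c Y : 'I_n -> {mpoly R[n]}) : {mpoly R[n]} :=
  \prod_(J : {set 'I_n} | (#|J| <= K)%N)
    \sum_(i | S i) (c i * \prod_(j in J) (Y i - Y j)) ^+ 2.

Lemma representative_polyP (R : realType) (n K : nat) (S : pred 'I_n)
    (c Y : 'I_n -> {mpoly R[n]}) (x : 'cV[R]_n) :
  peval (representative_poly K S c Y) x = 0 <->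
  exists J : {set 'I_n}, (#|J| <= K)%N /\
    forall i, S i -> peval (c i) x = 0 \/ exists2 j, j \in J & peval (Y i) x = peval (Y j) x.
Proof.
have termE (J : {set 'I_n}) i : peval ((c i * \prod_(j in J) (Y i - Y j)) ^+ 2) x =
    (peval (c i) x * \prod_(j in J) (peval (Y i) x - peval (Y j) x)) ^+ 2.
  rewrite pevalXn pevalM peval_prod; congr ((_ * _) ^+ 2).
  by apply: eq_bigr => j _; rewrite pevalB.
split=> [/eqP|[J [JK hJ]]].
  rewrite peval_prod => /prodf_eq0[J JK]; rewrite peval_sum psumr_eq0 => [/allP hJ|i _].
    exists J; split=> // i Si; have := hJ i (mem_index_enum i).
    rewrite Si /= termE sqrf_eq0 mulf_eq0 => /orP[/eqP|/prodf_eq0[j jJ]]; first by left.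
    by rewrite subr_eq0 => /eqP; right; exists j.
  by rewrite termE sqr_ge0.
apply/eqP; rewrite peval_prod; apply/prodf_eq0; exists J => //.
rewrite peval_sum big1 // => i Si; rewrite termE; case: (hJ i Si) => [->|[j jJ ->]].
  by rewrite mul0r expr0n.
by rewrite (bigD1 j) //= subrr mul0r mulr0 expr0n.
Qed.

(** The power sum minimised is the next one, of degree K + 1: its derivative has degree K, while
    those of the constraints have lower degree. *)
Lemma symmetric_fibre_point (R : realType) (n K : nat) (y : 'cV[R]_n) : (0 < K)%N ->
  exists2 x : 'cV[R]_n, forall j, (0 < j <= K)%N -> peval (psum R n j) x = peval (psum R n j) y
    & exists J : {set 'I_n}, (#|J| <= K)%N /\ forall i, exists2 j, j \in J & x i 0 = x j 0.
Proof.
move=> K0; pose Phi : {mpoly R[n]} := representative_poly K xpredT (fun=> 1%:MP) (fun i => 'X_i).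
have PhiE x : peval Phi x = 0 <->
    exists J : {set 'I_n}, (#|J| <= K)%N /\ forall i, exists2 j, j \in J & x i 0 = x j 0.
  rewrite representative_polyP; split=> -[J [JK hJ]]; exists J; split=> // i.
    case: (hJ i isT) => [/eqP|[j jJ]]; first by rewrite pevalC oner_eq0.
    by rewrite !pevalXU => ij; exists j.
  by move=> _; right; have [j jJ ij] := hJ i; exists j; rewrite ?pevalXU.
have [||x c crit _|x /PhiE xJ gx] := @penalty_point R n (psum R n K.+1) Phi (psum R n 2)
    [seq psum R n j | j <- iota 1 K] y.
(* The squared norm is the minimised power sum if K = 1 and one of the constraints otherwise. *)
- case: K K0 {Phi PhiE} => [|[|K]] // _; first by rewrite mem_head.
  by rewrite in_cons /= !in_cons eqxx !orbT.
- by move=> x; rewrite psum2.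
- apply/PhiE.
  pose Q : {poly R} := K.+1%:R *: 'X^K - \sum_(j <- iota 1 K) (c (psum R n j) * j%:R) *: 'X^(j.-1).
  have [||Q0 QK] := @poly_lead_neq0 R K K.+1%:R (iota 1 K) (fun j => c (psum R n j) * j%:R) predn.
  + by rewrite pnatr_eq0.
  + by move=> j; rewrite mem_iota; lia.
  have [i _|J [JK hJ]] := @root_representatives R n K Q (fun i => x i 0) xpredT Q0 QK.
    rewrite /Q hornerD hornerN hornerZ hornerXn horner_sum; apply/eqP; rewrite subr_eq0; apply/eqP.
    have := congr1 (fun v : 'cV[R]_n => v i 0) crit; rewrite grad_psum /= => ->.
    rewrite summxE big_map; apply: eq_bigr => j _.
    by rewrite mxE grad_psum hornerZ hornerXn mulrA.
  by exists J; split=> // i; exact: hJ.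
- exists x => // j jK; apply: gx; apply: map_f; rewrite mem_iota; lia.
Qed.

(** Type B takes Z empty. Type D puts two coordinates in Z, which keeps the product of the
    coordinates equal to 0 along the fibre. *)
Lemma signed_fibre_point (R : realType) (n K : nat) (Z : seq 'I_n) (y : 'cV[R]_n) :
  (0 < K)%N -> (forall z, z \in Z -> y z 0 = 0) ->
  exists x : 'cV[R]_n, [/\ forall j, (j < K)%N ->
      peval (psum R n j.*2.+2) x = peval (psum R n j.*2.+2) y,
    forall z, z \in Z -> x z 0 = 0
    & exists J : {set 'I_n}, (#|J| <= K)%N /\
        forall i, x i 0 = 0 \/ exists2 j, j \in J & x i 0 ^+ 2 = x j 0 ^+ 2].
Proof.
move=> K0 yZ.
(* The condition is imposed off Z only: the approximating points need not satisfy x z = 0, and the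
   gradient of X_z spoils the relation at the coordinate z. *)
pose Phi : {mpoly R[n]} :=
  representative_poly K (fun i => i \notin Z) (fun i => 'X_i) (fun i => 'X_i ^+ 2).
have PhiE x : peval Phi x = 0 <->
    exists J : {set 'I_n}, (#|J| <= K)%N /\ forall i, i \notin Z ->
      x i 0 = 0 \/ exists2 j, j \in J & x i 0 ^+ 2 = x j 0 ^+ 2.
  rewrite representative_polyP; split=> -[J [JK hJ]]; exists J; split=> // i /hJ.
    by rewrite !pevalXn !pevalXU => -[|[j jJ]]; [left|rewrite pevalXn pevalXU; right; exists j].
  by rewrite !pevalXU => -[|[j jJ ij]]; [left|right; exists j => //; rewrite !pevalXn !pevalXU].
have [||x c crit _|x /PhiE [J [JK hJ]] gx] := @penalty_point R n (psum R n K.*2.+2) Phi (psum R n 2)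
    ([seq psum R n j.*2.+2 | j <- iota 0 K] ++ [seq 'X_z | z <- Z]) y.
- by case: K K0 {Phi PhiE} => // K _; rewrite in_cons /= in_cons eqxx orbT.
- by move=> x; rewrite psum2.
- apply/PhiE.
  pose F j := c (psum R n j.*2.+2) * j.*2.+2%:R.
  pose Q : {poly R} := K.*2.+2%:R *: 'X^K - \sum_(j <- iota 0 K) F j *: 'X^j.
  have [||Q0 QK] := @poly_lead_neq0 R K K.*2.+2%:R (iota 0 K) F id.
  + by rewrite pnatr_eq0.
  + by move=> j; rewrite mem_iota; lia.
  have [i /andP[iZ xi]|J [JK hJ]] := @root_representatives R n K Q (fun i => x i 0 ^+ 2)
      (fun i => (i \notin Z) && (x i 0 != 0)) Q0 QK.
    (* The gradient relation is odd in x i; divided by x i it becomes Q evaluated at the square of x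
       i. *)
    apply: (mulfI xi); rewrite mulr0 /Q hornerD hornerN hornerZ hornerXn horner_sum mulrBr.
    apply/eqP; rewrite subr_eq0; apply/eqP.
    have := congr1 (fun v : 'cV[R]_n => v i 0) crit; rewrite grad_psum /= => h.
    rewrite mulrCA -exprM mul2n -exprS h summxE big_cat /= !big_map [X in _ + X]big1_seq.
      rewrite addr0 mulr_sumr; apply: eq_bigr => j _; rewrite mxE grad_psum /F.
      by rewrite hornerZ hornerXn /= -exprM mul2n exprS; ring.
    move=> z /= zZ; rewrite gradXU !mxE; case: eqP => [iz|_]; last by rewrite mulr0.
    by rewrite -iz (negPf iZ) in zZ.
  exists J; split=> // i iZ; have [->|xi] := eqVneq (x i 0) 0; first by left.
  by right; apply: hJ; rewrite iZ.
- have xZ z : z \in Z -> x z 0 = 0.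
    move=> zZ; rewrite -(yZ z zZ) -[LHS]pevalXU -[RHS]pevalXU; apply: gx.
    by rewrite mem_cat; apply/orP; right; apply: map_f.
  exists x; split=> // [j jK|].
    apply: gx; rewrite mem_cat; apply/orP; left.
    by apply: (map_f (fun j => psum R n j.*2.+2)); rewrite mem_iota.
  exists J; split=> // i; have [/xZ ->|/hJ //] := boolP (i \in Z); by left.
Qed.

Lemma mulmx_ext (R : realType) (m n : nat) (A B : 'M[R]_(m, n)) :
  (forall x : 'cV[R]_n, A *m x = B *m x) -> A = B.
Proof.
move=> h; apply/matrixP => i j; have /colP/(_ i) := h (delta_mx j 0).
by rewrite -!colE !mxE.
Qed.

Lemma pairwise_independent_comp (R : realType) (n : nat) (I J : finType)
    (a : J -> 'cV[R]_n) (f : I -> J) :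
  injective f -> pairwise_independent a -> pairwise_independent (a \o f).
Proof.
move=> f_inj [a0 ai]; split=> [i|i j ij]; first exact: a0.
by apply: ai; rewrite inj_eq.
Qed.

Lemma pairwise_independent_sep (R : realType) (n : nat) (I : finType) (a : I -> 'cV[R]_n) :
  (forall i, a i != 0) ->
  (forall i j, i != j -> exists2 z, dot (a j) z = 0 & dot (a i) z != 0) ->
  pairwise_independent a.
Proof.
move=> a0 sep; split=> // i j ij s t h; have [z jz iz] := sep i j ij.
have : dot (s *: a i + t *: a j) z = 0 by rewrite h dotC dot0r.
by rewrite dotDl !dotZl jz mulr0 addr0 => /eqP; rewrite mulf_eq0 (negPf iz) orbF => /eqP.
Qed.

(** * Roots of the classical groups *)

Definition below (n : nat) (j : 'I_n) (i : 'I_j) : 'I_n := widen_ord (ltnW (ltn_ord j)) i.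

Lemma below_neq (n : nat) (j : 'I_n) (i : 'I_j) : below i != j.
Proof. by rewrite -val_eqE /= ltn_eqF. Qed.

Definition pair_root (R : realType) (n : nat) (i j : 'I_n) (b : bool) : 'cV[R]_n :=
  delta_mx j 0 + (-1) ^+ b *: delta_mx i 0.

(** Positive roots are sorted by their larger index j, so that counting them gives a sum over j, to
    be compared with the sum of the degrees. Types D and A reindex subfamilies and inherit
    independence by injectivity. *)
Definition root_B (R : realType) (n : nat) (t : {j : 'I_n & option ('I_j * bool)}) : 'cV[R]_n :=
  let: existT j o := t in
  if o is Some (i, b) then pair_root R (below i) j b else delta_mx j 0.

Definition root_D (R : realType) (n : nat) (t : {j : 'I_n & ('I_j * bool)%type}) : 'cV[R]_n :=
  root_B R (existT (fun j : 'I_n => option ('I_j * bool)) (tag t) (Some (tagged t))).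

Definition root_A (R : realType) (n : nat) (t : {j : 'I_n & 'I_j}) : 'cV[R]_n :=
  root_D R (existT (fun j : 'I_n => ('I_j * bool)%type) (tag t) (tagged t, true)).

Section ClassicalRoots.
Variables (R : realType) (n : nat).
Implicit Types (x y : 'cV[R]_n) (i j : 'I_n) (b : bool).

Lemma dot_pair_root i j b x : dot (pair_root R i j b) x = x j 0 + (-1) ^+ b * x i 0.
Proof. by rewrite dotDl dotZl !dot_delta. Qed.

Lemma root_B_indep : pairwise_independent (@root_B R n).
Proof.
apply: pairwise_independent_sep => [[j o]|[j1 o1] [j2 o2] t12].
  apply/eqP => h; have := dot0r (root_B R (existT _ j o)); rewrite -{1}h.
  case: o {h} => [[i b]|] /=; last by rewrite dot_delta mxE !eqxx => /eqP; rewrite oner_eq0.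
  rewrite dot_pair_root !mxE !eqxx (negPf (below_neq i)) eq_sym (negPf (below_neq i)) /=.
  rewrite mulr0 addr0 mulr1 add0r -expr2 sqrr_sign => /eqP.
  by rewrite -[X in X == _](natrD _ 1 1) pnatr_eq0.
(* The separating point has coordinates l + 1, except for the coordinate j2, chosen to lie on the
   mirror of the second root. As |c2| <= j2, the coordinate of larger index still dominates in every
   root with j1 != j2. *)
pose c2 : R := if o2 is Some (i, b) then - ((-1) ^+ b * i.+1%:R) else 0.
exists (\col_l if l == j2 then c2 else l.+1%:R).
  rewrite /c2; case: o2 {t12 c2} => [[i b]|] /=; last by rewrite dot_delta mxE eqxx.
  by rewrite dot_pair_root !mxE eqxx (negPf (below_neq i)) addNr.
have c2b : - j2%:R <= c2 <= j2%:R.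
  rewrite /c2; case: o2 {t12 c2} => [[i b]|]; last by rewrite oppr_le0 !ler0n.
  have : i.+1%:R <= j2%:R :> R by rewrite ler_nat.
  have : 0 <= i.+1%:R :> R by rewrite ler0n.
  by case: b; rewrite ?expr0 ?expr1 => h1 h2; lra.
have [j12|j12] := eqVneq j1 j2; last first.
  case: o1 t12 => [[i b]|] _ /=; last by rewrite dot_delta mxE (negPf j12) pnatr_eq0.
  have sgn : (-1) ^+ b = 1 :> R \/ (-1) ^+ b = -1 :> R by case: b; [right|left].
  rewrite dot_pair_root !mxE (negPf j12) -val_eqE /=.
  have : i.+1%:R <= j1%:R :> R by rewrite ler_nat.
  rewrite -[j1.+1]addn1 -[i.+1]addn1 !natrD; have := ler0n R i => h1 h2.
  have hj : i == j2 :> nat -> j2%:R = i%:R :> R by move=> /eqP <-.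
  have /andP[h3 h4] := c2b.
  by case: ifP => [/hj hj2|_]; case: sgn => ->; apply/eqP; lra.
subst j2; case: o1 t12 => [[i1 b1]|] /=.
  rewrite dot_pair_root !mxE eqxx (negPf (below_neq i1)) /=.
  rewrite /c2; case: o2 {c2 c2b} => [[i2 b2]|] t12; last first.
    by rewrite add0r mulf_eq0 signr_eq0 pnatr_eq0.
  apply: contraNneq t12 => h; suff -> : (i1, b1) = (i2, b2) by [].
  have h1 := ler0n R i1; have h2 := ler0n R i2; move: h.
  rewrite -[(i1 : nat).+1]addn1 -[(i2 : nat).+1]addn1 !natrD.
  case: b1 b2 => [] []; rewrite ?expr0 ?expr1 => h; [|exfalso; lra|exfalso; lra|]; congr (_, _);
    by apply/val_inj/eqP; rewrite -(eqr_nat R); apply/eqP; lra.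
rewrite dot_delta mxE eqxx /c2; case: o2 {c2 c2b} => [[i2 b2]|] h; last by rewrite eqxx in h.
by rewrite oppr_eq0 mulf_eq0 signr_eq0 pnatr_eq0.
Qed.

Lemma root_D_indep : pairwise_independent (@root_D R n).
Proof.
apply: (pairwise_independent_comp (a := @root_B R n)) root_B_indep.
move=> [j1 t1] [j2 t2] /= h; have j12 : j1 = j2 by exact: (congr1 tag h).
by subst j2; move/eqP: h; rewrite -tag_eqE /tag_eq /= eqxx tagged_asE => /eqP [->].
Qed.

Lemma root_A_indep : pairwise_independent (@root_A R n).
Proof.
apply: (pairwise_independent_comp (a := @root_D R n)) root_D_indep.
move=> [j1 t1] [j2 t2] /= h; have j12 : j1 = j2 by exact: (congr1 tag h).
by subst j2; move/eqP: h; rewrite -tag_eqE /tag_eq /= eqxx tagged_asE => /eqP [->].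
Qed.

Lemma card_tagged_sum (T : 'I_n -> finType) : #|{: {j : 'I_n & T j}}| = (\sum_j #|T j|)%N.
Proof. by rewrite card_tagged sumnE big_map big_enum. Qed.

Lemma signed_perm_mxE (e : {ffun 'I_n -> bool}) (s : 'S_n) x i :
  (signed_perm_mx R e s *m x) i 0 = (-1) ^+ e i * x (s i) 0.
Proof. by rewrite /signed_perm_mx -mulmxA mul_diag_mx mxE -row_permE !mxE. Qed.

Lemma reflmx_delta j : reflmx (delta_mx j 0 : 'cV[R]_n) = signed_perm_mx R [ffun i => i == j] 1.
Proof.
apply: mulmx_ext => x; apply/colP => i; rewrite signed_perm_mxE reflmxE !dot_delta !mxE ffunE perm1 !eqxx.
by case: eqP => [->|_] /=; rewrite ?expr0 ?expr1; field.
Qed.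

Lemma reflmx_pair_root i j b : i != j ->
  reflmx (pair_root R i j b) =
  signed_perm_mx R [ffun l => ~~ b && ((l == i) || (l == j))] (tperm i j).
Proof.
move=> ij; apply: mulmx_ext => x; apply/colP => l; rewrite signed_perm_mxE reflmxE ffunE.
have -> : dot (pair_root R i j b) (pair_root R i j b) = 2.
  rewrite dot_pair_root !mxE !eqxx (negPf ij) [j == i]eq_sym (negPf ij) /=.
  by rewrite mulr0 addr0 mulr1 add0r -expr2 sqrr_sign.
rewrite dot_pair_root !mxE !eqxx /= !andbT.
have [->|li] := eqVneq l i.
  by rewrite tpermL (negPf ij); case: b; rewrite ?expr0 ?expr1 /=; field.
have [->|lj] := eqVneq l j.
  by rewrite tpermR; case: b; rewrite ?expr0 ?expr1 /=; field.
by rewrite tpermD 1?eq_sym // !andbF expr0 /=; field.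
Qed.

(** The family [root_D] lists each pair once; the two orders of the indices give the same vector up
    to sign. *)
Lemma pair_rootP (P : 'cV[R]_n -> Prop) :
  (forall t, P (root_D R t)) -> forall i j b, i != j -> P (pair_root R i j b) \/ P (pair_root R j i b).
Proof.
move=> h i j b; rewrite neq_ltn => /orP[ij|ji].
  left; have := h (existT _ j (Ordinal ij, b)); rewrite /root_D /=.
  by rewrite (_ : below _ = i) //; apply/val_inj.
right; have := h (existT _ i (Ordinal ji, b)); rewrite /root_D /=.
by rewrite (_ : below _ = j) //; apply/val_inj.
Qed.

Lemma root_D_constraint x v :
  (forall t, dot (root_D R t) x = 0 -> dot (root_D R t) v = 0) ->
  forall i j b, i != j -> x i 0 = (-1) ^+ b * x j 0 -> v i 0 = (-1) ^+ b * v j 0.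
Proof.
move=> h i j b ij xij.
have signK c : (-1) ^+ b * ((-1) ^+ b * c) = c :> R by rewrite mulrA -expr2 sqrr_sign mul1r.
have sN c : (-1) ^+ (~~ b) * c = - ((-1) ^+ b * c) :> R by rewrite signrN mulNr.
case: (@pair_rootP (fun a => dot a x = 0 -> dot a v = 0) h i j (~~ b) ij); rewrite !dot_pair_root !sN.
  rewrite xij signK subrr => /(_ erefl) /eqP; rewrite subr_eq0 => /eqP ->.
  by rewrite signK.
by rewrite xij subrr => /(_ erefl) /eqP; rewrite subr_eq0 => /eqP.
Qed.

Lemma root_A_constraint x v :
  (forall t, dot (root_A R t) x = 0 -> dot (root_A R t) v = 0) ->
  forall i j, x i 0 = x j 0 -> v i 0 = v j 0.
Proof.
move=> h i j xij; have [->//|] := eqVneq i j; rewrite neq_ltn => /orP[ij|ji].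
  have := h (existT _ j (Ordinal ij)); rewrite /root_A /root_D /= (_ : below _ = i); last exact/val_inj.
  by rewrite !dot_pair_root xij expr1 !mulN1r subrr => /(_ erefl) /eqP; rewrite subr_eq0 => /eqP.
have := h (existT _ i (Ordinal ji)); rewrite /root_A /root_D /= (_ : below _ = j); last exact/val_inj.
by rewrite !dot_pair_root xij expr1 !mulN1r subrr => /(_ erefl) /eqP; rewrite subr_eq0 => /eqP.
Qed.

Lemma root_B_constraint x v :
  (forall t, dot (root_B R t) x = 0 -> dot (root_B R t) v = 0) ->
  (forall i, x i 0 = 0 -> v i 0 = 0) /\
  forall i j, x i 0 ^+ 2 = x j 0 ^+ 2 -> v j 0 = 0 -> v i 0 = 0.
Proof.
move=> h; split=> [i xi|i j].
  by have := h (existT _ i None); rewrite /= !dot_delta; apply.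
have [-> //|ij /eqP] := eqVneq i j; rewrite eqf_sqr => xij vj.
have hD t : dot (root_D R t) x = 0 -> dot (root_D R t) v = 0 by exact: h.
have [b xb] : exists b : bool, x i 0 = (-1) ^+ b * x j 0.
  by case/orP: xij => /eqP ->; [exists false|exists true]; rewrite ?expr0 ?expr1; ring.
by rewrite (root_D_constraint hD ij xb) vj mulr0.
Qed.

Lemma peval_psum_signed (e : {ffun 'I_n -> bool}) (s : 'S_n) k x :
  ~~ odd k \/ (forall i, ~~ e i) ->
  peval (psum R n k) (signed_perm_mx R e s *m x) = peval (psum R n k) x.
Proof.
move=> h; rewrite !peval_psum [RHS](reindex_inj (@perm_inj _ s)); apply: eq_bigr => i _.
rewrite signed_perm_mxE exprMn; case: h => [ek|/(_ i)/negPf ->].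
  by rewrite -exprM -signr_odd oddM (negPf ek) andbF expr0 mul1r.
by rewrite expr0 expr1n mul1r.
Qed.

Lemma perm_mxE (s : 'S_n) x i : (perm_mx s *m x) i 0 = x (s i) 0.
Proof. by rewrite -row_permE !mxE. Qed.

End ClassicalRoots.

Lemma poly_many_roots (R : realType) (n : nat) (Q : {poly R}) (y : 'I_n -> R) :
  (size Q <= n)%N -> injective y -> (forall i, Q.[y i] = 0) -> Q = 0.
Proof.
move=> Qn y_inj Qy; apply: contraTeq Qn => Q0; rewrite -ltnNge.
have := @max_poly_roots _ Q (map y (enum 'I_n)) Q0.
rewrite size_map size_enum_ord; apply.
  by apply/allP => _ /mapP[i _ ->]; rewrite rootE Qy.
by rewrite map_inj_uniq ?enum_uniq.
Qed.

(** * Dimension and flats of a realization *)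

Section RealizationTools.
Variables (R : realType) (n N : nat) (U : set 'cV[R]_n) (E : 'M[R]_(n, N)).
Hypothesis EE : E^T *m E = 1%:M.
Hypothesis rangeE : range (mulmx E : 'cV[R]_N -> 'cV[R]_n) = U.

(** The trace of the orthogonal projection onto U is the dimension of U, so N can be read off an
    explicit form of the projection. *)
Lemma trace_projection : \tr (E *m E^T) = N%:R.
Proof. by rewrite mxtrace_mulC EE mxtrace1. Qed.

Lemma ker_Et (w u : 'cV[R]_n) : E^T *m w = 0 -> U u -> dot u w = 0.
Proof.
by move=> Ew Uu; rewrite -(mulEtK EE rangeE Uu) dotC dot_mulmx Ew dotC dot0r.
Qed.

Lemma jac_mul_nonsingular (P : 'I_N -> {mpoly R[n]}) (y : 'cV[R]_n) :
  (forall c : 'I_N -> R, E^T *m (\sum_j c j *: grad (P j) y) = 0 -> forall j, c j = 0) ->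
  \det (jac P y *m E) != 0.
Proof.
move=> h; apply/negP => /det0P[c /eqP c0 hc]; apply: c0; apply/rowP => j; rewrite mxE.
apply: (h (fun j => c 0 j)); move/(congr1 trmx): hc; rewrite mulmxA trmx_mul trmx0 => hc; rewrite -[RHS]hc.
congr (_ *m _); apply/colP => i; rewrite summxE !mxE.
by apply: eq_bigr => l _; rewrite !mxE.
Qed.

(** The criterion for a flat, with K selecting the coordinates in J: it suffices that on the mirrors
    through y a vector is determined by these coordinates. *)
Lemma realized_flat_coords (W : set 'M[R]_n) (G : set 'M[R]_N) (I : finType) (a : I -> 'cV[R]_n)
    (k : nat) (J : {set 'I_n}) (y : 'cV[R]_n) :
  G = [set E^T *m h *m E | h in W] -> (forall i, W (reflmx (a i))) -> (forall i, U (a i)) ->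
  pairwise_independent a -> (#|J| <= k)%N -> (k <= N)%N -> U y ->
  (forall v, U v -> (forall i, dot (a i) y = 0 -> dot (a i) v = 0) ->
     (forall j, j \in J -> v j 0 = 0) -> v = 0) ->
  flat_stratum G k (E^T *m y).
Proof.
move=> GE aW aU ai Jk kN Uy sep.
pose K : 'M[R]_(#|J|, n) := \matrix_(l < #|J|) delta_mx 0 (enum_val l).
apply: (realized_flat EE rangeE GE aW aU ai (K := K)); rewrite ?Jk //.
move=> v Uv hv Kv; apply: sep => // j jJ; move/colP/(_ (enum_rank_in jJ j)): Kv.
rewrite !mxE => <-; rewrite (bigD1 j) //= big1 => [|i ij].
  by rewrite !mxE enum_rankK_in // !eqxx mul1r addr0.
by rewrite !mxE enum_rankK_in // (negPf ij) mul0r.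
Qed.

End RealizationTools.

Lemma square_realization (R : realType) (n N : nat) (E : 'M[R]_(n, N)) :
  E^T *m E = 1%:M -> range (mulmx E : 'cV[R]_N -> 'cV[R]_n) = setT -> N = n.
Proof.
move=> EE rE; have EtE : E *m E^T = 1%:M.
  by apply: mulmx_ext => x; rewrite -mulmxA (mulEtK EE rE) // mul1mx.
by have := trace_projection EE; rewrite EtE mxtrace1 => /eqP; rewrite eqr_nat => /eqP.
Qed.

Lemma sum_zero_realization (R : realType) (n N : nat) (E : 'M[R]_(n.+1, N)) :
  E^T *m E = 1%:M -> range (mulmx E : 'cV[R]_N -> 'cV[R]_n.+1) = @sum_zero R n.+1 -> N = n.
Proof.
move=> EE rE; pose o : 'cV[R]_n.+1 := const_mx 1.
have n0 : n.+1%:R != 0 :> R by rewrite pnatr_eq0.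
have dot_o y : dot o y = \sum_i y i 0 by apply: eq_bigr => i _; rewrite mxE mul1r.
have Eo : E^T *m o = 0.
  apply/eqP; rewrite -dot_eq0 -dot_mulmx; apply/eqP.
  have : sum_zero (E *m (E^T *m o)) by rewrite -rE; exists (E^T *m o).
  by rewrite /sum_zero /= -dot_o dotC.
(* The projection along the all-ones vector [o], which is orthogonal to U; its trace is n. *)
have EtE : E *m E^T = 1%:M - n.+1%:R^-1 *: (o *m o^T).
  apply: mulmx_ext => x; rewrite mulmxBl mul1mx -scalemxAl -mulmxA.
  have -> : o *m o^T *m x = dot o x *: o.
    by rewrite -mulmxA (mx11_scalar (o^T *m x)) dotE mul_mx_scalar.
  rewrite scalerA; set c := _ * _; rewrite -{1}(subrK (c *: o) x) mulmxDr -scalemxAr Eo scaler0 addr0.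
  apply: (mulEtK EE rE); rewrite /sum_zero /= -dot_o dotBr dotZr /c.
  rewrite [dot o o]dot_o (eq_bigr (fun=> 1)) => [|i _]; last by rewrite mxE.
  by rewrite sumr_const card_ord mulrAC mulVf // mul1r subrr.
have := trace_projection EE; rewrite EtE (raddfB mxtrace) /= mxtraceZ mxtrace1.
rewrite mxtrace_mulC trace_mx11 dotE dot_o (eq_bigr (fun=> 1)) => [|i _]; last by rewrite mxE.
by rewrite sumr_const card_ord mulVf // -addn1 natrD addrK => /eqP; rewrite eqr_nat => /eqP.
Qed.

(** [eps] selects the essential model, where the first power sum vanishes and the invariants start
    with the second; this is the shift by [eps] in all indices. *)
Lemma type_A_meets (R : realType) (r N : nat) (eps : bool) (E : 'M[R]_(r.+1, N)) (G : set 'M[R]_N)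
    (k : nat) (X : set 'cV[R]_N) :
  let U := if eps then @sum_zero R r.+1 else setT in
  E^T *m E = 1%:M -> range (mulmx E : 'cV[R]_N -> 'cV[R]_r.+1) = U ->
  G = [set E^T *m h *m E | h in @symmetric_model R r.+1] ->
  reflection_group G -> X !=set0 -> (0 < k)%N -> (k <= N)%N -> sparse G k X ->
  X `&` flat_stratum G k !=set0.
Proof.
move=> U EE rE GE Grefl [x0 Xx0] k0 kN [q [qb [fs fsq XE]]].
have Nr : (N + eps = r.+1)%N.
  move: rE; rewrite /U; case: (eps) => rE; first by rewrite (sum_zero_realization EE rE) addn1.
  by rewrite addn0; exact: (square_realization EE rE).
have aW t : @symmetric_model R r.+1 (reflmx (root_A R t)).
  case: t => j i; rewrite /root_A /root_D /= reflmx_pair_root ?below_neq //.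
  exists (tperm (below i) j); apply: mulmx_ext => x; apply/colP => l.
  by rewrite signed_perm_mxE perm_mxE ffunE expr0 mul1r.
have sum0 x : sum_zero x -> U x by rewrite /U; case: (eps).
have pairU i j : U (pair_root R i j true).
  apply: sum0; rewrite /sum_zero /=.
  rewrite (eq_bigr (fun l => dot (delta_mx l 0) (pair_root R i j true))) => [|l _]; last first.
    by rewrite dot_delta.
  rewrite (eq_bigr (fun l => dot (pair_root R i j true) (delta_mx l 0))) => [|l _]; last by rewrite dotC.
  rewrite -dot_sumr dot_pair_root !summxE.
  rewrite [X in X + _](bigD1 j) //= [X in _ + _ + _ * X](bigD1 i) //= !big1 => [|l lj|l lj].
  - by rewrite !mxE !eqxx expr1; ring.
  - by rewrite mxE [i == l]eq_sym (negPf lj).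
  - by rewrite mxE [j == l]eq_sym (negPf lj).
have aU t : U (root_A R t) by case: t => j i; exact: pairU.
(* The kernel of the transpose of E is the orthogonal complement of U: constant vectors in the
   essential model, 0 otherwise. *)
have kerE (w : 'cV[R]_r.+1) : E^T *m w = 0 -> exists2 c, (eps = false -> c = 0) & forall i, w i 0 = c.
  move=> Ew; have wU u : U u -> dot u w = 0 by exact: (ker_Et EE rE Ew).
  exists (w 0 0); first by move=> e0; rewrite -dot_delta wU // /U e0.
  move=> i; apply/eqP; rewrite -subr_eq0; apply/eqP.
  by have := wU _ (pairU 0 i); rewrite dot_pair_root expr1 mulN1r.
pose P (j : 'I_N) := psum R r.+1 (j.+1 + eps).
pose d (j : 'I_N) := (j.+1 + eps)%N.
(* A point with distinct coordinates, centred by [c1] when their sum has to vanish. *)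
pose c1 : R := if eps then (\sum_(i < r.+1) i%:R) / r.+1%:R else 0.
pose y1 : 'cV[R]_r.+1 := \col_i (i%:R - c1).
have y1_inj : injective (fun i => y1 i 0).
  by move=> i j; rewrite !mxE => /addIr /eqP; rewrite eqr_nat => /eqP /val_inj.
have y1U : U y1.
  rewrite /U /y1 /c1; case: (eps) => //; rewrite /sum_zero /=; under eq_bigr do rewrite mxE.
  rewrite sumrB sumr_const card_ord -[X in _ - X]mulr_natr divfK ?subrr //.
  by rewrite pnatr_eq0.
have WU h y : @symmetric_model R r.+1 h -> U y -> U (h *m y).
  move=> [s ->]; rewrite /U; case: (eps) => //; rewrite /sum_zero /= => y0.
  by rewrite -[RHS]y0 [RHS](reindex_inj (@perm_inj _ s)); apply: eq_bigr => i _; rewrite perm_mxE.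
have P_inv j h y : @symmetric_model R r.+1 h -> U y -> peval (P j) (h *m y) = peval (P j) y.
  move=> [s ->] _; rewrite !peval_psum [RHS](reindex_inj (@perm_inj _ s)).
  by apply: eq_bigr => i _; rewrite perm_mxE.
have P_y1 : \det (jac P y1 *m E) != 0.
  apply: jac_mul_nonsingular => c /kerE[c0 c0e wc] j.
  (* A Vandermonde argument: Q has degree at most r and vanishes at the r + 1 coordinates. The
     constant c0 absorbs the kernel of the transpose of E, and in the essential model it cannot
     interfere because the exponents are positive. *)
  pose Q : {poly R} := \sum_(l < N) (c l * (l.+1 + eps)%:R) *: 'X^(l + eps) - c0%:P.
  have Q0 : Q = 0.
    apply: (poly_many_roots (y := fun i => y1 i 0)) => // [|i].
      rewrite (leq_trans (size_polyD _ _)) // geq_max size_polyN.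
      rewrite (leq_trans (size_polyC_leq1 _)) // andbT.
      apply: (leq_trans (size_sum _ _ _)); apply/bigmax_leqP => l _.
      by rewrite (leq_trans (size_scale_leq _ _)) // size_polyXn -Nr ltn_add2r.
    rewrite hornerD hornerN hornerC horner_sum -(wc i) summxE -sumrB big1 // => l _.
    by rewrite hornerZ hornerXn [X in _ - X]mxE grad_psum addSn mulrA subrr.
  have := congr1 (fun Q : {poly R} => Q`_(j + eps)) Q0.
  rewrite coef0 coefB coef_sum coefC (bigD1 j) //= big1 => [|l lj]; last first.
    by rewrite coefZ coefXn eqn_add2r eq_sym val_eqE (negPf lj) mulr0.
  rewrite coefZ coefXn eqxx mulr1 addr0.
  have -> : (if (j + eps)%N == 0%N then c0 else 0) = 0.
    by case: (eps) c0e => [_|-> //]; rewrite ?addn1 // if_same.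
  by rewrite subr0 => /eqP; rewrite mulf_eq0 pnatr_eq0 addSn orbF => /eqP.
have P_homog j : P j \is (d j).-homog by exact: psum_homog.
have d_count : (\sum_j d j <= #|{: {j : 'I_r.+1 & 'I_j}}| + N)%N.
  rewrite card_tagged_sum (eq_bigr (fun j : 'I_r.+1 => j : nat)) => [|j _]; last exact: card_ord.
  rewrite (eq_bigr (fun j : 'I_N => j + eps + 1)%N) => [|j _]; last by rewrite /d addn1.
  rewrite big_split /= sum_nat_const card_ord muln1 leq_add2r.
  move: Nr; case: (eps) => /=; rewrite ?addn1 ?addn0 => Nr.
    by move: Nr => -[<-]; rewrite big_ord_recl /= add0n; apply: leq_sum => j _; rewrite addn1.
  by rewrite Nr; apply: leq_sum => j _; rewrite addn0.
have d_lt (i j : 'I_N) : (i < j)%N -> (d i < d j)%N by rewrite /d ltn_add2r ltnS.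
(* In the essential model the first power sum is fixed too, which puts y back in U. This costs one
   more representative, which the equation of U removes below. *)
have [|y yfib [J [JK hJ]]] := @symmetric_fibre_point R r.+1 (k + eps) (E *m x0).
  by rewrite addn_gt0 k0.
have Uy : U y.
  move: rE yfib; rewrite /U; case: (eps) => // rE yfib; have := yfib 1%N.
  rewrite addn1 /= => /(_ isT); rewrite !peval_psum => yE.
  have : sum_zero (E *m x0) by rewrite -rE; exists x0.
  by rewrite /sum_zero /=; exact: etrans yE.
exists (E^T *m y); split.
  rewrite XE; apply: (sparse_locus kN fsq (y := x0)); last by rewrite -XE.
  have -> : x0 = E^T *m (E *m x0) by rewrite mulmxA EE mul1mx.
  move=> l lk; apply: (realized_fibre EE rE GE Grefl aW aU (root_A_indep R r.+1) P_homog WU P_inv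
    y1U P_y1 d_count qb d_lt Uy _ _ lk); first exact: (range_mem rE).
  by move=> j jk; apply: yfib; rewrite leq_add2r jk.
have same v : (forall t, dot (root_A R t) y = 0 -> dot (root_A R t) v = 0) ->
    forall i, exists2 j, j \in J & v i 0 = v j 0.
  by move=> hv i; have [j jJ yij] := hJ i; exists j => //; exact: (root_A_constraint hv).
have Usum v : eps -> U v -> \sum_i v i 0 = 0 by rewrite /U => ->.
have [he|he] := boolP eps; rewrite ?he ?(negPf he) in JK.
  have [j0 j0J _] := hJ 0.
  apply: (realized_flat_coords (J := J :\ j0) EE rE GE aW aU (root_A_indep R r.+1)) => //.
    by move: JK; rewrite (cardsD1 j0) j0J addn1 add1n ltnS.
  move=> v Uv hv vJ; apply/eqP; rewrite -dot_eq0; apply/eqP.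
  (* Once the representatives other than j0 vanish, every coordinate of v is 0 or equal to v j0, so
     its square is v j0 times itself. *)
  rewrite (_ : dot v v = v j0 0 * \sum_i v i 0); first by rewrite Usum ?mulr0.
  rewrite mulr_sumr; apply: eq_bigr => i _; have [j jJ ->] := same v hv i.
  have [->//|jj0] := eqVneq j j0.
  by rewrite vJ ?mulr0 // in_setD1 jj0 jJ.
rewrite addn0 in JK.
apply: (realized_flat_coords (J := J) EE rE GE aW aU (root_A_indep R r.+1)) => // v _ hv vJ.
by apply/colP => i; have [j jJ ->] := same v hv i; rewrite vJ // mxE.
Qed.

Lemma type_B_meets (R : realType) (n N : nat) (E : 'M[R]_(n, N)) (G : set 'M[R]_N)
    (k : nat) (X : set 'cV[R]_N) :
  E^T *m E = 1%:M -> range (mulmx E : 'cV[R]_N -> 'cV[R]_n) = setT ->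
  G = [set E^T *m h *m E | h in @B_model R n] ->
  reflection_group G -> X !=set0 -> (0 < k)%N -> (k <= N)%N -> sparse G k X ->
  X `&` flat_stratum G k !=set0.
Proof.
move=> EE rE; move: (square_realization EE rE) => Nn; subst N.
move=> GE Grefl [x0 Xx0] k0 kN [q [qb [fs fsq XE]]].
have aW t : @B_model R n (reflmx (root_B R t)).
  case: t => j [[i b]|] /=; last by rewrite reflmx_delta; exists [ffun i => i == j], 1%g.
  by rewrite reflmx_pair_root ?below_neq //; eexists; eexists.
have aU t : [set: 'cV[R]_n] (root_B R t) by [].
pose P (j : 'I_n) := psum R n j.*2.+2.
pose d (j : 'I_n) := j.*2.+2.
pose y1 : 'cV[R]_n := \col_i i.+1%:R.
have y1U : [set: 'cV[R]_n] y1 by [].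
have WU h y : @B_model R n h -> [set: 'cV[R]_n] y -> [set: 'cV[R]_n] (h *m y) by [].
have P_inv j h y : @B_model R n h -> [set: 'cV[R]_n] y -> peval (P j) (h *m y) = peval (P j) y.
  by move=> [e [s ->]] _; rewrite peval_psum_signed //; left; rewrite /= odd_double.
have P_y1 : \det (jac P y1 *m E) != 0.
  apply: jac_mul_nonsingular => c Ew j.
  have w0 i : \sum_(l < n) c l * l.*2.+2%:R * y1 i 0 ^+ l.*2.+1 = 0.
    have := ker_Et EE rE Ew (I : setT (delta_mx i 0)); rewrite dot_delta summxE => h0; rewrite -[RHS]h0.
    by apply: eq_bigr => l _; rewrite [RHS]mxE grad_psum mulrA.
  (* The gradient equations are odd in the coordinate. Divided by the nonzero coordinate of y1 they
     say that Q, of size at most n, vanishes at n distinct squares. *)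
  pose Q : {poly R} := \sum_(l < n) (c l * l.*2.+2%:R) *: 'X^l.
  have Q0 : Q = 0.
    apply: (poly_many_roots (y := fun i => y1 i 0 ^+ 2)) => [|i j'|i].
    - apply: (leq_trans (size_sum _ _ _)); apply/bigmax_leqP => l _.
      by rewrite (leq_trans (size_scale_leq _ _)) // size_polyXn.
    - move/eqP; rewrite !mxE eqrXn2 // => /eqP /eqP; rewrite eqr_nat => /eqP [] /val_inj //.
    - have y1i : y1 i 0 != 0 by rewrite mxE pnatr_eq0.
      apply: (mulfI y1i); rewrite mulr0 -[RHS](w0 i) horner_sum mulr_sumr.
      by apply: eq_bigr => l _; rewrite hornerZ hornerXn -exprM mul2n exprS; ring.
  have := congr1 (fun Q : {poly R} => Q`_j) Q0.
  rewrite coef0 coef_sum (bigD1 j) //= big1 => [|l lj]; last first.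
    by rewrite coefZ coefXn eq_sym val_eqE (negPf lj) mulr0.
  by rewrite coefZ coefXn eqxx mulr1 addr0 => /eqP; rewrite mulf_eq0 pnatr_eq0 orbF => /eqP.
have P_homog j : P j \is (d j).-homog by exact: psum_homog.
have d_count : (\sum_j d j <= #|{: {j : 'I_n & option ('I_j * bool)}}| + n)%N.
  rewrite card_tagged_sum -[X in (_ + X)%N](card_ord n) -sum1_card -big_split /=.
  apply: leq_sum => j _; rewrite card_option card_prod card_ord card_bool /d; lia.
have d_lt (i j : 'I_n) : (i < j)%N -> (d i < d j)%N by rewrite /d !ltnS ltn_double.
have [y [yfib _ [J [JK hJ]]]] := @signed_fibre_point R n k [::] (E *m x0) k0 ltac:(by []).
have Uy : [set: 'cV[R]_n] y by [].
exists (E^T *m y); split.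
  rewrite XE; apply: (sparse_locus kN fsq (y := x0)); last by rewrite -XE.
  have -> : x0 = E^T *m (E *m x0) by rewrite mulmxA EE mul1mx.
  move=> l lk; apply: (realized_fibre EE rE GE Grefl aW aU (root_B_indep R n) P_homog WU P_inv
    y1U P_y1 d_count qb d_lt Uy _ _ lk) => // j jk.
  exact: yfib.
apply: (realized_flat_coords (J := J) EE rE GE aW aU (root_B_indep R n)) => // v _ hv vJ.
have [hv0 hvv] := root_B_constraint hv; apply/colP => i; rewrite [RHS]mxE.
by have [/hv0 //|[j jJ yij]] := hJ i; apply: (hvv i j) => //; exact: vJ.
Qed.

(** * Type I_2 *)

Lemma representable_zero (R : realType) (n m : nat) (A : 'M[R]_(m, n)) (v : 'cV[R]_n) :
  A *m v = 0 -> (A^C)%MS *m v = 0 -> v = 0.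
Proof.
move=> Av Acv; have := addsmx_compl_full A; rewrite -sub1mx => /sub_addsmxP[[B C] /= h].
by rewrite -[v]mul1mx h mulmxDl -(mulmxA B) -(mulmxA C) Av Acv !mulmx0 addr0.
Qed.

(** K is a basis of a complement of the row space of the chosen roots: it supplies exactly the
    equations that they lack. *)
Lemma realized_flat_rank (R : realType) (n : nat) (E : 'M[R]_n) (W : set 'M[R]_n) (G : set 'M[R]_n)
    (I : finType) (a : I -> 'cV[R]_n) (k m : nat) (t : 'I_m -> I) (y : 'cV[R]_n) :
  E^T *m E = 1%:M -> range (mulmx E : 'cV[R]_n -> 'cV[R]_n) = setT ->
  G = [set E^T *m h *m E | h in W] -> (forall i, W (reflmx (a i))) ->
  pairwise_independent a -> (forall i, dot (a (t i)) y = 0) ->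
  (n <= k + \rank (\matrix_(i < m) (a (t i))^T))%N -> (k <= n)%N ->
  flat_stratum G k (E^T *m y).
Proof.
move=> EE rE GE aW ai ty nk kn; set A := \matrix_(i < m) (a (t i))^T in nk.
have aU i : [set: 'cV[R]_n] (a i) by [].
apply: (realized_flat EE rE GE aW aU ai (K := row_base (A^C)%MS)) => //.
  by rewrite mxrank_compl kn andbT leq_subLR addnC.
move=> v _ hv Kv; apply: (@representable_zero _ _ _ A).
  apply/colP => i; have := hv _ (ty i); rewrite -dotE => h; rewrite mxE [RHS]mxE -[RHS]h !mxE.
  by apply: eq_bigr => l _; rewrite !mxE.
have : ((A^C)%MS <= row_base (A^C)%MS)%MS by rewrite eq_row_base.
by move=> /submxP[D ->]; rewrite -mulmxA Kv mulmx0.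
Qed.

Lemma realized_flat_mirror (R : realType) (n : nat) (E : 'M[R]_n.+1) (W : set 'M[R]_n.+1)
    (G : set 'M[R]_n.+1) (I : finType) (a : I -> 'cV[R]_n.+1) (i : I) (y : 'cV[R]_n.+1) :
  E^T *m E = 1%:M -> range (mulmx E : 'cV[R]_n.+1 -> 'cV[R]_n.+1) = setT ->
  G = [set E^T *m h *m E | h in W] -> (forall i, W (reflmx (a i))) ->
  pairwise_independent a -> dot (a i) y = 0 -> flat_stratum G n (E^T *m y).
Proof.
move=> EE rE GE aW ai iy.
apply: (realized_flat_rank (t := fun _ : 'I_1 => i) EE rE GE aW ai) => //.
rewrite (_ : (\matrix_(_ < 1) (a i)^T) = (a i)^T); last by apply/matrixP => l j; rewrite (ord1 l) !mxE.
rewrite rank_rV (_ : (a i)^T != 0) ?addn1 //.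
by apply: contra_neq (ai.1 i) => /(congr1 trmx); rewrite trmxK trmx0.
Qed.

Lemma independent_gradients (R : realType) (n : nat) (P : 'I_n -> {mpoly R[n]}) x (c : 'I_n -> R) :
  \det (jac P x) != 0 -> \sum_j c j *: grad (P j) x = 0 -> forall j, c j = 0.
Proof.
move=> J0 h j; have Ju : jac P x \in unitmx by rewrite unitmxE unitfE.
have : (\row_j c j) *m jac P x = 0.
  apply/rowP => i; have := congr1 (fun v : 'cV[R]_n => v i 0) h.
  rewrite summxE [RHS]mxE !mxE => h'; rewrite -[RHS]h'.
  by apply: eq_bigr => l _; rewrite !mxE.
move/(congr1 (mulmxr (invmx (jac P x)))); rewrite /= mulmxK // mul0mx.
by move=> /rowP/(_ j); rewrite !mxE.
Qed.

Lemma jac_neq0_off_mirrors (R : realType) (n : nat) (I : finType) (a : I -> 'cV[R]_n)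
    (P : 'I_n -> {mpoly R[n]}) (d : 'I_n -> nat) (y1 x : 'cV[R]_n) :
  pairwise_independent a -> (forall j, P j \is (d j).-homog) ->
  (forall j i y, peval (P j) (reflmx (a i) *m y) = peval (P j) y) ->
  \det (jac P y1) != 0 -> (\sum_j d j <= #|I| + n)%N ->
  (forall i, dot (a i) x != 0) -> \det (jac P x) != 0.
Proof.
move=> ai P_homog P_inv Py1 d_count; apply: (jac_neq0 _ ai _ Py1 d_count) => [j|i z iz].
  rewrite msizeE; apply/bigmax_leqP_seq => m mP _.
  by rewrite ltnS (dhomog_mf (P_homog j) mP).
by apply: (jac_singular (ai.1 i)) => j; apply: grad_reflmx => //; apply ai.
Qed.

Lemma ord2P (j : 'I_2) : j = 0 \/ j = 1.
Proof. by case: j => [[|[|//]]] jn; [left|right]; exact/val_inj. Qed.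

Lemma sum_ord2 (V : zmodType) (F : 'I_2 -> V) : \sum_j F j = F 0 + F 1.
Proof. by rewrite !big_ord_recl big_ord0 addr0; congr (_ + F _); exact/val_inj. Qed.

(** The degrees may coincide, as for I_2(2) and D_2, or come in the wrong order, as for I_2(1). So
    all that is used of the first basic invariant is that it is determined by some nonzero
    combination h of P 0 and P 1. *)
Lemma rank2_meets (R : realType) (N : nat) (E : 'M[R]_(2, N)) (W : set 'M[R]_2) (G : set 'M[R]_N)
    (I : finType) (a : I -> 'cV[R]_2) (P : 'I_2 -> {mpoly R[2]}) (d : 'I_2 -> nat) (y1 : 'cV[R]_2)
    (k : nat) (X : set 'cV[R]_N) :
  E^T *m E = 1%:M -> range (mulmx E : 'cV[R]_N -> 'cV[R]_2) = setT ->
  G = [set E^T *m h *m E | h in W] -> reflection_group G ->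
  (forall i, W (reflmx (a i))) -> pairwise_independent a ->
  (forall j, P j \is (d j).-homog) -> (forall j h y, W h -> peval (P j) (h *m y) = peval (P j) y) ->
  \det (jac P y1) != 0 -> (\sum_j d j <= #|I| + 2)%N -> P 0 = psum R 2 2 ->
  X !=set0 -> (0 < k)%N -> (k <= N)%N -> sparse G k X ->
  X `&` flat_stratum G k !=set0.
Proof.
move=> EE rE; move: (square_realization EE rE) => N2; subst N.
move=> GE Grefl aW ai P_homog P_inv Py1 d_count P0 [x0 Xx0] k0 k2 [q [qb [fs fsq XE]]].
have [k2'|k1] := eqVneq k 2%N; first by exists x0; split; rewrite // k2'; exact: flat_stratum_full.
have {k0 k2 k1} k1 : k = 1%N by move: k0 k2 k1; case: (k) => [|[|[|]]].
subst k.
have aU i : [set: 'cV[R]_2] (a i) by [].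
have Py1E : \det (jac P y1 *m E) != 0.
  by rewrite det_mulmx mulf_neq0 //; have [_] := mulmx1_unit EE; rewrite unitmxE unitfE.
have WU h y : W h -> [set: 'cV[R]_2] y -> [set: 'cV[R]_2] (h *m y) by [].
have P_inv' j h y : W h -> [set: 'cV[R]_2] y -> peval (P j) (h *m y) = peval (P j) y by move=> ? _; exact: P_inv.
have y1U : [set: 'cV[R]_2] y1 by [].
have [[s hs] /(_ 0)[u [[j0 uj0] _ hu]]] := realized_structure EE rE GE Grefl aW aU ai P_homog WU P_inv' y1U
  Py1E d_count qb.
(* The first basic invariant has the least degree, so no P j of lower degree has to be matched. *)
have nlow j : ~ (d j < degree q 0%R)%N.
  have z : ((0%R : 'I_2) <= s j)%N by [].
  by rewrite -hs ltnNge (degree_mono qb z).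
pose h := \sum_j u j *: P j.
have hE x : peval h x = \sum_j u j * peval (P j) x.
  by rewrite peval_sum; apply: eq_bigr => j _; rewrite pevalZ.
have off x : (forall i, dot (a i) x != 0) -> \det (jac P x) != 0.
  by apply: (jac_neq0_off_mirrors ai P_homog) Py1 d_count => j i y; exact: P_inv.
pose Phi := \prod_i linear_form (a i).
have PhiP x : peval Phi x = 0 -> exists i, dot (a i) x = 0.
  move=> /eqP; rewrite peval_prod => /prodf_eq0[i _]; rewrite peval_linear_form => /eqP.
  by exists i.
have Phi0 x : (\det (jac P x) != 0 -> False) -> peval Phi x = 0.
  move=> nJ; apply/eqP; rewrite peval_prod; apply/prodf_eq0; apply: contrapT => hi.
  apply: nJ; apply: off => i; apply/negP => iz; apply: hi.
  by exists i => //; rewrite peval_linear_form.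
have [x /PhiP[i ix] xh] : exists2 x, peval Phi x = 0 & peval h x = peval h (E *m x0).
  (* If h is a multiple of P 0, then P 1 is minimised on its fibre; otherwise P 0 is minimised on
     the fibre of h. Either way the squared norm P 0 takes part, and at a critical point the
     gradients of P 0 and P 1 are dependent. *)
  have [u1|u1] := eqVneq (u 1) 0.
    have u0 : u 0 != 0.
      by move: uj0; have [->|->] := ord2P j0; rewrite ?u1 ?eqxx.
    have [||x c crit _|x xPhi gx] := @penalty_point R 2 (P 1) Phi (psum R 2 2) [:: P 0] (E *m x0).
    - by rewrite P0 !in_cons eqxx orbT.
    - by move=> x; rewrite psum2.
    - apply: Phi0 => J0; rewrite big_seq1 in crit.
      have := @independent_gradients R 2 P x (fun j => if j == 0 then - c (P 0) else 1) J0.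
      rewrite sum_ord2 /= scale1r scaleNr.
      by rewrite crit addNr => /(_ erefl 1) /eqP; rewrite oner_eq0.
    exists x => //; rewrite !hE !sum_ord2.
    by rewrite u1 !mul0r (gx (P 0)) ?mem_head.
  have [||x c crit _|x xPhi gx] := @penalty_point R 2 (P 0) Phi (psum R 2 2) [:: h] (E *m x0).
  - by rewrite P0 in_cons eqxx.
  - by move=> x; rewrite psum2.
  - apply: Phi0 => J0; rewrite big_seq1 in crit.
    have := @independent_gradients R 2 P x (fun j => (if j == 0 then 1 else 0) - c h * u j) J0.
    rewrite (_ : \sum_j _ = 0) => [/(_ erefl) hc|].
      have := hc 1; rewrite /= sub0r => /eqP; rewrite oppr_eq0 mulf_eq0 (negPf u1) orbF => /eqP ch.
      by have := hc 0; rewrite ch mul0r subr0 => /eqP; rewrite oner_eq0.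
    apply/eqP; rewrite (eq_bigr (fun j => (if j == 0 then 1 else 0) *: grad (P j) x - c h *: (u j *: grad (P j) x))); last first.
      by move=> j _; rewrite scalerBl scalerA.
    rewrite sumrB -scaler_sumr subr_eq0; apply/eqP.
    rewrite (bigD1 0) //= big1 => [|j /negPf ->]; last by rewrite scale0r.
    rewrite scale1r addr0 crit; congr (_ *: _); rewrite grad_sum; apply: eq_bigr => j _.
    by rewrite gradZ.
  by exists x => //; apply: gx; rewrite mem_head.
exists (E^T *m x); split; last exact: (realized_flat_mirror EE rE GE aW ai ix).
rewrite XE; apply: (sparse_locus _ fsq (y := x0)) => //; last by rewrite -XE.
have -> : x0 = E^T *m (E *m x0) by rewrite mulmxA EE mul1mx.
move=> l l1; have -> : l = 0 by move: l1; have [->|->] := ord2P l.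
apply: hu => // [j /nlow //|]; by rewrite -!hE.
Qed.

(** The real and imaginary parts of (X_0 + i X_1)^m. *)
Fixpoint complex_power (R : realType) (m : nat) : {mpoly R[2]} * {mpoly R[2]} :=
  if m is m'.+1 then
    let: (A, B) := complex_power R m' in ('X_0 * A - 'X_1 * B, 'X_0 * B + 'X_1 * A)
  else (1%:MP, 0).

Section ComplexPower.
Variable R : realType.
Implicit Types (x y : 'cV[R]_2) (m : nat).

Let re m := (complex_power R m).1.
Let im m := (complex_power R m).2.

Definition pair2 (s t : R) : 'cV[R]_2 := \col_i (if i == 0 then s else t).

Lemma col2P x y : x 0 0 = y 0 0 -> x 1 0 = y 1 0 -> x = y.
Proof. by move=> h0 h1; apply/colP => i; have [->|->] := ord2P i. Qed.

Lemma re_S m : re m.+1 = 'X_0 * re m - 'X_1 * im m.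
Proof. by rewrite /re /im /=; case: (complex_power R m). Qed.

Lemma im_S m : im m.+1 = 'X_0 * im m + 'X_1 * re m.
Proof. by rewrite /re /im /=; case: (complex_power R m). Qed.

Lemma complex_power_homog m : re m \is m.-homog /\ im m \is m.-homog.
Proof.
elim: m => [|m [hr hi]].
  by rewrite /re /im /= dhomog0; split=> //; rewrite mpolyC1 dhomog1.
have X_homog (i : 'I_2) : ('X_i : {mpoly R[2]}) \is [in R[2], 1.-homog] by rewrite dhomogX /= mdeg1.
rewrite re_S im_S -[m.+1]add1n; split; first apply: rpredB; try apply: rpredD; exact: dhomogM.
Qed.

(** The rule (wx)^m = w^m x^m for complex numbers. *)
Lemma complex_powerM m (c s : R) x :
  let z := pair2 (c * x 0 0 - s * x 1 0) (s * x 0 0 + c * x 1 0) in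
  let w := pair2 c s in
  peval (re m) z = peval (re m) w * peval (re m) x - peval (im m) w * peval (im m) x /\
  peval (im m) z = peval (re m) w * peval (im m) x + peval (im m) w * peval (re m) x.
Proof.
move=> z w; elim: m => [|m [hr hi]].
  by rewrite /re /im /= !pevalC ?peval0; split; ring.
rewrite !re_S !im_S !pevalB !pevalD !pevalM hr hi !pevalXU /z /w !mxE /=; split; ring.
Qed.

Lemma complex_power_cos m t :
  peval (re m) (pair2 (cos t) (sin t)) = cos (m%:R * t) /\
  peval (im m) (pair2 (cos t) (sin t)) = sin (m%:R * t).
Proof.
elim: m => [|m [hr hi]]; first by rewrite /re /im /= !pevalC ?peval0 mul0r cos0 sin0.
rewrite re_S im_S pevalB pevalD !pevalM hr hi !pevalXU !mxE /=.
rewrite -[m.+1]addn1 natrD mulrDl mul1r cosD sinD; split; ring.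
Qed.

Lemma complex_power_flip m x :
  peval (re m) (pair2 (x 0 0) (- x 1 0)) = peval (re m) x /\
  peval (im m) (pair2 (x 0 0) (- x 1 0)) = - peval (im m) x.
Proof.
elim: m => [|m [hr hi]]; first by rewrite /re /im /= !pevalC ?peval0 oppr0.
rewrite re_S im_S !pevalB !pevalD !pevalM hr hi !pevalXU !mxE /=; split; ring.
Qed.

(** The derivative m z^(m-1) of z^m with the Cauchy-Riemann equations; for m = 0 the truncated
    exponent is harmless because of the factor 0. *)
Lemma grad_complex_power m x :
  grad (re m) x = m%:R *: pair2 (peval (re m.-1) x) (- peval (im m.-1) x) /\
  grad (im m) x = m%:R *: pair2 (peval (im m.-1) x) (peval (re m.-1) x).
Proof.
elim: m => [|m [hr hi]].
  by rewrite /re /im /= -mpolyC0 !gradC !scale0r.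
rewrite re_S im_S !gradD gradN !gradM !gradXU hr hi !pevalXU -!pred_Sn.
case: m {hr hi} => [|m] /=.
  by rewrite /re /im /= !pevalC ?peval0; split; apply: col2P; rewrite !mxE /=; ring.
rewrite re_S im_S !pevalB !pevalD !pevalM !pevalXU.
by split; apply: col2P; rewrite !mxE /= -[m.+2]addn1 -[m.+1]addn1 !natrD; ring.
Qed.

End ComplexPower.

Section Dihedral.
Variables (R : realType) (m : nat).
Hypothesis m_gt0 : (0 < m)%N.

Let angle (j : 'I_m) : R := pi * j%:R / m%:R.

Definition root_I2 (j : 'I_m) : 'cV[R]_2 := pair2 (- sin (angle j)) (cos (angle j)).

Lemma dot2 (x y : 'cV[R]_2) : dot x y = x 0 0 * y 0 0 + x 1 0 * y 1 0.
Proof. exact: sum_ord2. Qed.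

Lemma rotationE t (x : 'cV[R]_2) :
  rotation_mx t *m x = pair2 (cos t * x 0 0 - sin t * x 1 0) (sin t * x 0 0 + cos t * x 1 0).
Proof. by apply: col2P; rewrite mxE sum_ord2 !mxE /=; ring. Qed.

Lemma flipE (x : 'cV[R]_2) : flip_mx R *m x = pair2 (x 0 0) (- x 1 0).
Proof. by rewrite /flip_mx mul_diag_mx; apply: col2P; rewrite !mxE /=; ring. Qed.

Lemma root_I2_indep : pairwise_independent root_I2.
Proof.
have cs t : cos t * cos t + sin t * sin t = 1 :> R by rewrite -!expr2 cos2Dsin2.
apply: pairwise_independent_sep => [j|i j ij].
  by rewrite -dot_eq0 dot2 !mxE /= mulrNN addrC cs oner_eq0.
(* This point spans the mirror of j. Its product with root i is the sine of a difference of angles,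
   which is nonzero and lies strictly between - pi and pi. *)
exists (pair2 (cos (angle j)) (sin (angle j))); rewrite dot2 !mxE /=; first by ring.
have -> : - sin (angle i) * cos (angle j) + cos (angle i) * sin (angle j) = sin (angle j - angle i).
  by rewrite sinB; ring.
have m0 : 0 < m%:R :> R by rewrite ltr0n.
have sin_neq (k l : 'I_m) : (k < l)%N -> sin (angle l - angle k) != 0.
  move=> kl; rewrite gt_eqF // sin_gt0_pi //; rewrite /angle -mulrBl -mulrBr.
  have k0 : 0 <= k%:R :> R by rewrite ler0n.
  have klR : k%:R < l%:R :> R by rewrite ltr_nat.
  have lmR : l%:R < m%:R :> R by rewrite ltr_nat.
  rewrite divr_gt0 ?mulr_gt0 ?pi_gt0 ?subr_gt0 //= ltr_pdivrMr // ltr_pM2l ?pi_gt0 //.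
  by lra.
move: ij; rewrite neq_ltn => /orP[ij|ji]; first exact: sin_neq.
by rewrite -opprB sinN oppr_eq0; exact: sin_neq.
Qed.

Lemma root_I2_refl j : @dihedral_model R m (reflmx (root_I2 j)).
Proof.
(* The reflection in the line at angle theta is the flip followed by the rotation by 2 theta. *)
exists j, true; apply: mulmx_ext => x; rewrite -mulmxA flipE rotationE reflmxE !dot2 !mxE /=.
have cs : cos (angle j) * cos (angle j) + sin (angle j) * sin (angle j) = 1 by rewrite -!expr2 cos2Dsin2.
have -> : 2 * pi * j%:R / m%:R = angle j + angle j by rewrite /angle; field; rewrite pnatr_eq0 -lt0n.
rewrite cosD sinD mulrNN addrC [sin _ * sin _ + _]addrC cs divr1.
apply: col2P; rewrite !mxE /=; move: cs; set c := cos _; set s := sin _ => cs.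
- apply/eqP; rewrite -subr_eq0; apply/eqP; transitivity ((1 - (c * c + s * s)) * x 0 0); first by ring.
  by rewrite cs subrr mul0r.
- apply/eqP; rewrite -subr_eq0; apply/eqP; transitivity ((1 - (c * c + s * s)) * x 1 0); first by ring.
  by rewrite cs subrr mul0r.
Qed.

Lemma sin_cos_2pi_nat (j : nat) : cos (2 * pi * j%:R) = 1 :> R /\ sin (2 * pi * j%:R) = 0 :> R.
Proof.
elim: j => [|j [hc hs]]; first by rewrite mulr0 cos0 sin0.
rewrite -[j.+1%:R]natr1 mulrDr mulr1 cosD sinD hc hs [2 * pi]mulrC mulr_natr cos2pi sin2pi.
by split; ring.
Qed.

End Dihedral.

Lemma type_I2_meets (R : realType) (m N : nat) (E : 'M[R]_(2, N)) (G : set 'M[R]_N)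
    (k : nat) (X : set 'cV[R]_N) : (0 < m)%N ->
  E^T *m E = 1%:M -> range (mulmx E : 'cV[R]_N -> 'cV[R]_2) = setT ->
  G = [set E^T *m h *m E | h in @dihedral_model R m] ->
  reflection_group G -> X !=set0 -> (0 < k)%N -> (k <= N)%N -> sparse G k X ->
  X `&` flat_stratum G k !=set0.
Proof.
move=> m0 EE rE GE Grefl.
have m0R : m%:R != 0 :> R by rewrite pnatr_eq0 -lt0n.
pose P (j : 'I_2) := if j == 0 then psum R 2 2 else (complex_power R m).1.
pose d (j : 'I_2) := if j == 0 then 2%N else m.
(* At z = (cos t, sin t) the power z^m equals i. The Jacobian of the squared norm and Re z^m is - 2m
   Im z^m, hence nonzero there. *)
pose t : R := pi / 2 / m%:R.
apply: (@rank2_meets _ _ E (@dihedral_model R m) G _ (root_I2 R (m := m)) P d (pair2 (cos t) (sin t))) => //.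
- exact: root_I2_refl.
- exact: root_I2_indep.
- by move=> j; rewrite /P /d; case: eqP => _; [exact: psum_homog|exact: (complex_power_homog R m).1].
- move=> j h y [l [b ->]]; set th := 2 * pi * l%:R / m%:R.
  have [c1 s0] : cos (m%:R * th) = 1 /\ sin (m%:R * th) = 0.
    by rewrite /th mulrC divfK //; exact: sin_cos_2pi_nat.
  have inv_rot z : peval (P j) (rotation_mx th *m z) = peval (P j) z.
    rewrite rotationE /P; case: eqP => _.
      rewrite !psum2 !dot2 !mxE /=; have := cos2Dsin2 th; set c := cos th; set s := sin th => cs.
      transitivity ((c ^+ 2 + s ^+ 2) * (z 0 0 * z 0 0 + z 1 0 * z 1 0)); first by ring.
      by rewrite cs mul1r.
    have [-> _] := complex_powerM m (cos th) (sin th) z; have [-> ->] := complex_power_cos m th.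
    by rewrite c1 s0 mul1r mul0r subr0.
  rewrite -mulmxA inv_rot; case: b; last by rewrite mul1mx.
  rewrite flipE /P; case: eqP => _; first by rewrite !psum2 !dot2 !mxE /=; ring.
  by have [-> _] := complex_power_flip m y.
- apply: jac_nonsingular => c; rewrite sum_ord2 /P /= => /colP h.
  have := h 0; have := h 1; rewrite !mxE -!gradE !grad_psum (grad_complex_power m _).1 !mxE /= expr1.
  have [_ im_t] := complex_power_cos m t; move: im_t.
  rewrite (_ : m%:R * t = pi / 2); last by rewrite mulrC divfK.
  rewrite sin_pihalf -(prednK m0) im_S pevalD !pevalM !pevalXU !mxE /= (prednK m0).
  set B := peval _ _; set A := peval _ _; have := cos2Dsin2 t; set cc := cos t; set ss := sin t.
  move=> cs im1 h1 h0.
  have mc1 : m%:R * c 1 = 0.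
    transitivity (ss * (c 0 * (2 * cc) + c 1 * (m%:R * A)) - cc * (c 0 * (2 * ss) + c 1 * (m%:R * - B))).
      by rewrite -[LHS]mulr1 -im1; ring.
    by rewrite h0 h1 !mulr0 subr0.
  have c10 : c 1 = 0 by apply: (mulfI m0R); rewrite mulr0.
  have c00 : c 0 = 0.
    rewrite c10 !mul0r !addr0 in h0 h1.
    have : 2 * c 0 * (cc ^+ 2 + ss ^+ 2) = 0.
      transitivity (cc * (c 0 * (2 * cc)) + ss * (c 0 * (2 * ss))); first by ring.
      by rewrite h0 h1 !mulr0 addr0.
    by rewrite cs mulr1 => h2; lra.
  by move=> j; have [->|->] := ord2P j.
- by rewrite card_ord big_ord_recl big_ord_recl big_ord0 addn0 /d /= addnC.
Qed.

(** * Type D *)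

Definition prod_vars (R : realType) (n : nat) : {mpoly R[n]} := \prod_i 'X_i.

Section ProdVars.
Variables (R : realType) (n : nat).
Implicit Types (x : 'cV[R]_n).

Lemma peval_prod_vars x : peval (prod_vars R n) x = \prod_i x i 0.
Proof. by rewrite peval_prod; apply: eq_bigr => i _; rewrite pevalXU. Qed.

Lemma grad_prod_vars x i : grad (prod_vars R n) x i 0 = \prod_(l | l != i) x l 0.
Proof.
rewrite gradE /prod_vars (bigD1 i) //= mderivM mderivXU eqxx mpolyC1 mul1r pevalD pevalM.
rewrite (_ : (\prod_(l < n | l != i) 'X_l)^`M(i) = 0 :> {mpoly R[n]}).
  rewrite peval0 mulr0 addr0 peval_prod; apply: eq_bigr => l _; exact: pevalXU.
apply: (big_ind (fun f : {mpoly R[n]} => f^`M(i) = 0)) => [|f g hf hg|l li].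
- by rewrite -mpolyC1 mderivC.
- by rewrite mderivM hf hg mul0r mulr0 addr0.
- by rewrite mderivXU (negPf li) mpolyC0.
Qed.

Lemma prod_vars_homog : prod_vars R n \is n.-homog.
Proof.
rewrite /prod_vars -big_enum /= -[X in X.-homog](size_enum_ord n).
elim: (enum _) => [|i s IH]; first by rewrite big_nil dhomog1.
rewrite big_cons -[size _]add1n; apply: dhomogM => //.
by rewrite dhomogX /= mdeg1.
Qed.

Lemma peval_prod_vars_signed (e : {ffun 'I_n -> bool}) (s : 'S_n) x :
  ~~ odd (\sum_i e i) ->
  peval (prod_vars R n) (signed_perm_mx R e s *m x) = peval (prod_vars R n) x.
Proof.
move=> ev; rewrite !peval_prod_vars [RHS](reindex_inj (@perm_inj _ s)).
under eq_bigr do rewrite signed_perm_mxE.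
by rewrite big_split /= prodrXr -signr_odd (negPf ev) expr0 mul1r.
Qed.

(** The hypothesis says that the gradient of the product of the coordinates vanishes: some
    coordinate is 0, and so is the product of the others. *)
Lemma two_zeros x : (0 < n)%N -> (forall i, \prod_(l | l != i) x l 0 = 0) ->
  exists a b, [/\ a != b, x a 0 = 0 & x b 0 = 0].
Proof.
move=> n0 h.
have /eqP/prodf_eq0[a _ /eqP xa] := h (Ordinal n0).
have /eqP/prodf_eq0[b ba /eqP xb] := h a.
by exists a, b; rewrite eq_sym.
Qed.

(** Multiplied by x i, the product of the other coordinates becomes the full product, the same for
    all i. So all the squares, including those that are 0, are roots of one polynomial of degree at
    most k; type D has no mirrors x i = 0, so zeros cannot be set apart as in type B. *)
Lemma prod_vars_relation (k : nat) (A : R) (B : nat -> R) x :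
  (forall i, A * (\prod_(l | l != i) x l 0) + \sum_(j <- iota 0 k) B j * x i 0 ^+ j.*2.+1 = 0) ->
  (exists2 j, (j < k)%N & B j != 0) ->
  exists J : {set 'I_n}, (#|J| <= k)%N /\ forall i, exists2 j, j \in J & x i 0 ^+ 2 = x j 0 ^+ 2.
Proof.
move=> rel [j0 j0k Bj0].
pose Q : {poly R} := (A * peval (prod_vars R n) x)%:P + \sum_(j <- iota 0 k) B j *: 'X^(j.+1).
have Q0 : Q != 0.
  apply: contraNneq Bj0 => /(congr1 (fun Q : {poly R} => Q`_j0.+1)).
  rewrite coef0 coefD coefC add0r coef_sum (bigD1_seq j0) ?mem_iota ?iota_uniq //= big1 => [|j jj0].
    by rewrite coefZ coefXn eqxx mulr1 addr0 => ->.
  by rewrite coefZ coefXn eqSS eq_sym (negPf jj0) mulr0.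
have QK : (size Q <= k.+1)%N.
  rewrite (leq_trans (size_polyD _ _)) // geq_max (leq_trans (size_polyC_leq1 _)) //=.
  rewrite big_seq; apply: (leq_trans (size_sum _ _ _)); apply/bigmax_leqP_seq => j jk _.
  rewrite (leq_trans (size_scale_leq _ _)) // size_polyXn !ltnS.
  by move: jk; rewrite mem_iota.
have [i _|J [JK hJ]] := @root_representatives R n k Q (fun i => x i 0 ^+ 2) xpredT Q0 QK.
  rewrite /Q hornerD hornerC horner_sum peval_prod_vars (bigD1 i) //=.
  transitivity (x i 0 * (A * (\prod_(l | l != i) x l 0) + \sum_(j <- iota 0 k) B j * x i 0 ^+ j.*2.+1)).
    rewrite mulrDr mulr_sumr mulrCA; congr (_ + _); apply: eq_bigr => j _.
    by rewrite hornerZ hornerXn -exprM mul2n doubleS exprS mulrCA.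
  by rewrite rel mulr0.
by exists J; split=> // i; exact: hJ.
Qed.

End ProdVars.

(** The numbers al and be allow for the case where the power sum of degree 2k and the product have
    the same degree n. Either one set of k representatives serves all coordinates, or two
    coordinates vanish, and then every vanishing coordinate is controlled by the mirrors, as in type
    B. *)
Lemma even_signed_fibre_point (R : realType) (n k : nat) (al be : R) (y : 'cV[R]_n) :
  (2 < n)%N -> (0 < k)%N -> (al != 0) || (be != 0) -> (k = 1%N -> be = 0) ->
  exists x : 'cV[R]_n, [/\
    forall j, (j < k.-1)%N -> peval (psum R n j.*2.+2) x = peval (psum R n j.*2.+2) y,
    al * peval (psum R n k.*2) x + be * peval (prod_vars R n) x =
      al * peval (psum R n k.*2) y + be * peval (prod_vars R n) y
    & exists J : {set 'I_n}, (#|J| <= k)%N /\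
       ((forall i, exists2 j, j \in J & x i 0 ^+ 2 = x j 0 ^+ 2) \/
        (exists a b, [/\ a != b, x a 0 = 0 & x b 0 = 0]) /\
        forall i, x i 0 = 0 \/ exists2 j, j \in J & x i 0 ^+ 2 = x j 0 ^+ 2)].
Proof.
move=> n3 k0 ab be0.
have n0 : (0 < n)%N by apply: ltn_trans n3.
(* Only the norm is fixed here; a point with all coordinates equal has one representative. *)
have [k1|k1] := eqVneq k 1%N.
  rewrite k1 (be0 k1); pose c := Num.sqrt (dot y y / n%:R).
  exists (const_mx c); split=> //.
    rewrite !mul0r !addr0; congr (_ * _); rewrite !psum2 /dot.
    rewrite (eq_bigr (fun=> c ^+ 2)) => [|i _]; last by rewrite !mxE expr2.
    rewrite sumr_const card_ord -mulr_natr sqr_sqrtr ?divfK // ?divr_ge0 ?dot_ge0 //.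
    by rewrite pnatr_eq0 -lt0n.
  exists [set Ordinal n0]%SET; rewrite cards1; split=> //; left=> i.
  by exists (Ordinal n0); rewrite ?inE // !mxE.
pose h : {mpoly R[n]} := al *: psum R n k.*2 + be *: prod_vars R n.
have hE x : peval h x = al * peval (psum R n k.*2) x + be * peval (prod_vars R n) x.
  by rewrite pevalD !pevalZ.
pose g := [seq psum R n j.*2.+2 | j <- iota 0 k.-1] ++ [:: h].
have kp : k = k.-1.+1 by rewrite prednK.
have kd : (k.*2.-1 = k.-1.*2.+1)%N by rewrite {1}kp doubleS.
have inE_g x z : (forall f, f \in g -> peval f x = peval f z) ->
    (forall j, (j < k.-1)%N -> peval (psum R n j.*2.+2) x = peval (psum R n j.*2.+2) z) /\
    peval h x = peval h z.
  move=> hg; split=> [j jk|]; last by apply: hg; rewrite mem_cat mem_head orbT.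
  by apply: hg; rewrite mem_cat; apply/orP; left; apply: (map_f (fun j => psum R n j.*2.+2)); rewrite mem_iota.
(* If the fibre contains a point with two zero coordinates, these are held at 0: the product stays 0
   and only power sums remain to be fixed, as in type B. *)
have [[z [a [b [abn za zb]]] zg]|noz] := pselect (exists2 z : 'cV[R]_n, exists a b, [/\ a != b, z a 0 = 0 & z b 0 = 0]
    & forall f, f \in g -> peval f z = peval f y).
  have [|x [xp xZ [J [JK hJ]]]] := @signed_fibre_point R n k [:: a; b] z k0.
    by move=> c; rewrite !inE => /orP[] /eqP ->.
  have [zp zh] := inE_g _ _ zg.
  have xa : x a 0 = 0 by apply: xZ; rewrite mem_head.
  have xb : x b 0 = 0 by apply: xZ; rewrite !inE eqxx orbT.
  exists x; split.
  - by move=> j jk; rewrite xp ?zp // kp (leq_trans jk).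
  - rewrite -!hE -zh !hE !peval_prod_vars.
    rewrite (bigD1 a) //= [in RHS](bigD1 a) //= xa za !mul0r !mulr0 !addr0; congr (_ * _).
    by have := xp k.-1; rewrite -doubleS -kp; apply; rewrite kp.
  - by exists J; split=> //; right; split=> //; exists a, b.
(* Together f and h span both the power sum of degree 2k and the product, whichever of al and be is
   nonzero. *)
pose f := if al == 0 then psum R n k.*2 else - prod_vars R n.
pose Phi : {mpoly R[n]} := representative_poly k xpredT (fun=> 1%:MP) (fun i => 'X_i ^+ 2).
have PhiE x : peval Phi x = 0 <->
    exists J : {set 'I_n}, (#|J| <= k)%N /\ forall i, exists2 j, j \in J & x i 0 ^+ 2 = x j 0 ^+ 2.
  rewrite representative_polyP; split=> -[J [JK hJ]]; exists J; split=> // i.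
    case: (hJ i isT) => [/eqP|[j jJ]]; first by rewrite pevalC oner_eq0.
    by rewrite !pevalXn !pevalXU => ij; exists j.
  by move=> _; right; have [j jJ ij] := hJ i; exists j; rewrite ?pevalXn ?pevalXU.
have [||x c crit cfib|x /PhiE [J [JK hJ]] gx] := @penalty_point R n f Phi (psum R n 2) g y.
- rewrite in_cons mem_cat; apply/orP; right; apply/orP; left.
  by apply: (map_f (fun j => psum R n j.*2.+2) (x := 0%N)); rewrite mem_iota; move: k1; rewrite kp; case: (k.-1).
- by move=> x; rewrite psum2.
- apply/PhiE.
  have critE i : grad f x i 0 = \sum_(j <- iota 0 k.-1) c (psum R n j.*2.+2) * (j.*2.+2%:R * x i 0 ^+ j.*2.+1)
      + c h * (al * (k.*2%:R * x i 0 ^+ k.-1.*2.+1) + be * (\prod_(l | l != i) x l 0)).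
    have := congr1 (fun v : 'cV[R]_n => v i 0) crit => ->.
    rewrite summxE big_cat big_map big_seq1 /=; congr (_ + _).
      by apply: eq_bigr => j _; rewrite mxE grad_psum.
    rewrite mxE gradD !gradZ mxE ![(_ *: grad _ _) i 0]mxE grad_psum grad_prod_vars.
    by rewrite kd.
  pose B j := if (j < k.-1)%N then c (psum R n j.*2.+2) * j.*2.+2%:R
    else c h * al * k.*2%:R - (if al == 0 then k.*2%:R else 0).
  pose A := c h * be + (if al == 0 then 0 else 1).
  have rel i : A * (\prod_(l | l != i) x l 0) + \sum_(j <- iota 0 k) B j * x i 0 ^+ j.*2.+1 = 0.
    have -> : iota 0 k = iota 0 k.-1 ++ [:: k.-1] by rewrite [in LHS]kp -addn1 iotaD.
    rewrite big_cat big_seq1 /= {2}/B ltnn (eq_big_seq (fun j => c (psum R n j.*2.+2) * (j.*2.+2%:R * x i 0 ^+ j.*2.+1))); last first.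
      by move=> j; rewrite mem_iota /= add0n /B => ->; rewrite mulrA.
    have := critE i; rewrite /f /A.
    set S := \sum_(j <- _) _; case: eqP => _.
      rewrite grad_psum kd; set p := \prod_(l | _) _; set X := _ ^+ k.-1.*2.+1 => hp.
      transitivity (S + c h * (al * (k.*2%:R * X) + be * p) - k.*2%:R * X); first by ring.
      by rewrite -hp subrr.
    rewrite gradN mxE grad_prod_vars; set p := \prod_(l | _) _ => hp.
    transitivity (p + (S + c h * (al * (k.*2%:R * x i 0 ^+ k.-1.*2.+1) + be * p))); first by ring.
    by rewrite -hp subrr.
  have [B0|/forallNP noB] := pselect (exists j, (j < k)%N && (B j != 0)).
    by apply: prod_vars_relation rel _; have [j /andP[]] := B0; exists j.
  (* If all the B j vanish, then al is nonzero, since for al = 0 the last one is - 2k. So every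
     multiplier vanishes, x is on the fibre by [cfib], and the product has zero gradient at x; this
     gives two zero coordinates, a case already excluded. *)
  have B0 j : (j < k)%N -> B j = 0.
    by move=> jk; have := noB j; rewrite jk => /negP/negPn/eqP.
  have k2 : k.*2%:R != 0 :> R by rewrite pnatr_eq0 double_eq0 -lt0n.
  have kk : (k.-1 < k)%N by rewrite [in X in (_ < X)%N]kp.
  have := B0 _ kk; rewrite /B ltnn; case: eqP => [->|/eqP al0].
    by rewrite mulr0 mul0r sub0r => /eqP; rewrite oppr_eq0 (negPf k2).
  rewrite subr0 => /eqP; rewrite !mulf_eq0 (negPf al0) (negPf k2) !orbF => /eqP ch.
  have cg f' : f' \in g -> c f' = 0.
    rewrite mem_cat mem_seq1 => /orP[/mapP[j]|/eqP -> //]; rewrite mem_iota add0n => /= jk ->.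
    have := B0 j (leq_trans jk (ltnW kk)); rewrite /B jk => /eqP.
    by rewrite mulf_eq0 pnatr_eq0 orbF => /eqP.
  case: noz; exists x; last exact: cfib.
  apply: two_zeros => // i; have := critE i; rewrite /f (negPf al0) ch mul0r addr0 big1_seq.
    by rewrite gradN mxE grad_prod_vars => /eqP; rewrite oppr_eq0 => /eqP.
  move=> j /= jk; rewrite cg ?mul0r // mem_cat; apply/orP; left.
  exact: (map_f (fun j => psum R n j.*2.+2)).
have [xp xh] := inE_g _ _ gx.
by exists x; split=> //; [rewrite -!hE|exists J; split=> //; left].
Qed.

Section TypeD.
Variables (R : realType) (n : nat).

(** The product has the last index although its degree n may lie in the middle of the list 2, 4,
    ..., 2n - 2, so the degrees are not sorted. *)
Definition invariant_D (j : 'I_n) : {mpoly R[n]} :=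
  if j.+1 == n then prod_vars R n else psum R n j.*2.+2.

Definition degree_D (j : 'I_n) : nat := if j.+1 == n then n else j.*2.+2.

Lemma invariant_D_homog j : invariant_D j \is (degree_D j).-homog.
Proof.
by rewrite /invariant_D /degree_D; case: eqP => _; [exact: prod_vars_homog|exact: psum_homog].
Qed.

Lemma invariant_D_inv j h y : @D_model R n h ->
  peval (invariant_D j) (h *m y) = peval (invariant_D j) y.
Proof.
move=> [e [s [ev ->]]]; rewrite /invariant_D; case: eqP => _.
  exact: peval_prod_vars_signed.
by rewrite peval_psum_signed //; left; rewrite /= odd_double.
Qed.

Lemma root_D_refl t : @D_model R n (reflmx (root_D R t)).
Proof.
case: t => j [i b]; rewrite /root_D /= reflmx_pair_root ?below_neq //.
eexists; eexists; split; last by [].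
under eq_bigr do rewrite ffunE.
case: b => /=; first by rewrite big1.
rewrite (bigD1 (below i)) //= (bigD1 j) /=; last by rewrite eq_sym below_neq.
rewrite !eqxx orbT big1 // => l /andP[li lj].
by rewrite (negPf li) (negPf lj).
Qed.

(** Multiplying the i-th component of the gradient relation by y1 i turns the product into a
    constant: the polynomial Q has size at most n and vanishes at n distinct squares. *)
Lemma jac_invariant_D : (0 < n)%N ->
  \det (jac invariant_D (\col_i i.+1%:R : 'cV[R]_n)) != 0.
Proof.
move=> n0; set y1 : 'cV[R]_n := \col_i _; apply: jac_nonsingular => c h.
have last_lt : (n.-1 < n)%N by rewrite prednK.
pose jl := Ordinal last_lt.
have jlE (j : 'I_n) : (j.+1 == n) = (j == jl).
  by rewrite -val_eqE /= -[RHS]eqSS prednK.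
have y10 i : y1 i 0 != 0 by rewrite mxE pnatr_eq0.
pose e1 := \prod_i y1 i 0.
have e10 : e1 != 0 by apply/prodf_neq0 => i _.
pose Q : {poly R} := \sum_(j | j != jl) (c j * j.*2.+2%:R) *: 'X^(j.+1) + (c jl * e1)%:P.
have Q0 : Q = 0.
  apply: (poly_many_roots (y := fun i => y1 i 0 ^+ 2)) => [|i j'|i].
  - rewrite (leq_trans (size_polyD _ _)) // geq_max (leq_trans (size_polyC_leq1 _)) // andbT.
    apply: (leq_trans (size_sum _ _ _)); apply/bigmax_leqP => j jl'.
    rewrite (leq_trans (size_scale_leq _ _)) // size_polyXn.
    by rewrite ltn_neqAle jlE jl' ltn_ord.
  - by move/eqP; rewrite !mxE eqrXn2 // eqr_nat => /eqP [] /val_inj.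
  - have h' : y1 i 0 * (\sum_j c j *: grad (invariant_D j) y1) i 0 = 0 by rewrite h [X in _ * X]mxE mulr0.
    rewrite summxE in h'; rewrite -[RHS]h' hornerD hornerC horner_sum [X in _ = _ * X](bigD1 jl) //=.
    rewrite [X in _ = _ * X]addrC mulrDr mulr_sumr.
    congr (_ + _).
      apply: eq_bigr => j jj; rewrite [X in _ = _ * X]mxE /invariant_D jlE (negPf jj) grad_psum.
      by rewrite hornerZ hornerXn -exprM mul2n doubleS exprS /=; ring.
    rewrite [X in _ = _ * X]mxE /invariant_D jlE eqxx grad_prod_vars /e1 [in LHS](bigD1 i) //=; ring.
have cQ j : j != jl -> c j = 0.
  move=> jj; have := congr1 (fun Q : {poly R} => Q`_j.+1) Q0.
  rewrite coef0 coefD coefC addr0 coef_sum (bigD1 j) //= big1 => [|l /andP[_ lj]].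
    by rewrite coefZ coefXn eqxx mulr1 addr0 => /eqP; rewrite mulf_eq0 pnatr_eq0 orbF => /eqP.
  by rewrite coefZ coefXn eqSS eq_sym val_eqE (negPf lj) mulr0.
move=> j; have [->|/cQ //] := eqVneq j jl.
have := congr1 (fun Q : {poly R} => Q`_0) Q0.
rewrite coef0 coefD coefC coef_sum big1 => [|l _]; last by rewrite coefZ coefXn mulr0.
by rewrite add0r => /eqP; rewrite mulf_eq0 (negPf e10) orbF => /eqP.
Qed.

End TypeD.

Lemma degree_D_count (n : nat) : (0 < n)%N ->
  (\sum_(j < n) degree_D j <= #|{: {j : 'I_n & ('I_j * bool)%type}}| + n)%N.
Proof.
case: n => // m _; rewrite card_tagged_sum.
rewrite [X in (_ <= X + _)%N](eq_bigr (fun j : 'I_m.+1 => j.*2)) => [|j _]; last by rewrite card_prod card_ord card_bool muln2.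
rewrite [X in (_ <= X + _)%N]big_ord_recl /= add0n big_ord_recr /=.
by rewrite /degree_D /= eqxx leq_add2r; apply: leq_sum => j _; rewrite eqSS ltn_eqF //= doubleS.
Qed.

Lemma card_ord_lt (n m : nat) : (m <= n)%N -> #|[pred l : 'I_n | (l < m)%N]| = m.
Proof. by move=> mn; rewrite -sum1_card /= -(big_ord_widen n (fun=> 1%N) mn) sum1_card card_ord. Qed.

(** The degree n of the product falls somewhere among the even degrees. Counting the P j by degree,
    against the degree D of the k-th basic invariant, tells which of them fix the first k basic
    invariants. *)
Lemma type_D_meets (R : realType) (n N : nat) (E : 'M[R]_(n, N)) (G : set 'M[R]_N)
    (k : nat) (X : set 'cV[R]_N) : (1 < n)%N ->
  E^T *m E = 1%:M -> range (mulmx E : 'cV[R]_N -> 'cV[R]_n) = setT ->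
  G = [set E^T *m h *m E | h in @D_model R n] ->
  reflection_group G -> X !=set0 -> (0 < k)%N -> (k <= N)%N -> sparse G k X ->
  X `&` flat_stratum G k !=set0.
Proof.
move=> n1 EE rE GE Grefl; have n0 : (0 < n)%N by apply: ltnW.
have [n2|n2] := eqVneq n 2%N.
  subst n; apply: (rank2_meets EE rE GE Grefl (@root_D_refl R 2) (@root_D_indep R 2)
    (@invariant_D_homog R 2) _ (@jac_invariant_D R 2 n0) (@degree_D_count 2 n0)) => //.
  by move=> j h y; exact: invariant_D_inv.
have n3 : (2 < n)%N by rewrite ltn_neqAle eq_sym n2.
move: (square_realization EE rE) => Nn; subst N.
move=> [x0 Xx0] k0; rewrite leq_eqVlt => /orP[/eqP -> _|kn [q [qb [fs fsq XE]]]].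
  by exists x0; split => //; exact: flat_stratum_full.
have aU t : [set: 'cV[R]_n] (root_D R t) by [].
have WU h y : @D_model R n h -> [set: 'cV[R]_n] y -> [set: 'cV[R]_n] (h *m y) by [].
have P_inv j h y : @D_model R n h -> [set: 'cV[R]_n] y ->
    peval (invariant_D R j) (h *m y) = peval (invariant_D R j) y.
  by move=> Wh _; exact: invariant_D_inv.
have y1U : [set: 'cV[R]_n] (\col_i i.+1%:R) by [].
have Py1 : \det (jac (@invariant_D R n) (\col_i i.+1%:R) *m E) != 0.
  rewrite det_mulmx mulf_neq0 ?jac_invariant_D //.
  by have [_] := mulmx1_unit EE; rewrite unitmxE unitfE.
have [[s hs] hq] := realized_structure EE rE GE Grefl (@root_D_refl R n) aU (@root_D_indep R n)
  (@invariant_D_homog R n) WU P_inv y1U Py1 (degree_D_count n0) qb.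
have kp : (k.-1 < n)%N by apply: leq_ltn_trans kn; exact: leq_pred.
have last_lt : (n.-1 < n)%N by rewrite prednK.
pose jl : 'I_n := Ordinal last_lt; pose ka : 'I_n := Ordinal kp.
have jlE (j : 'I_n) : (j.+1 == n) = (j == jl).
  by rewrite -val_eqE /= -[RHS]eqSS prednK.
have kajl : ka != jl by rewrite -jlE /= prednK // ltn_eqF.
pose d := @degree_D n; pose D := degree q ka.
have dE (j : 'I_n) : j != jl -> d j = j.*2.+2 by move=> jj; rewrite /d /degree_D jlE (negPf jj).
have dl : d jl = n by rewrite /d /degree_D jlE eqxx.
(* The permutation s preserves degrees, and only the indices before l0 can have a basic invariant of
   degree below that of l0. *)
have lowDB (B : pred 'I_n) (l0 : 'I_n) : (forall j, B j -> (d j < degree q l0)%N) -> (#|B| <= l0)%N.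
  move=> hB; rewrite -[X in (_ <= X)%N](card_ord_lt (ltnW (ltn_ord l0))).
  rewrite -(card_imset B (@perm_inj _ s)); apply: subset_leq_card; apply/fintype.subsetP => l /imsetP[j jB ->].
  by rewrite inE ltnNge; apply/negP => /(degree_mono qb); rewrite leqNgt hs hB.
have lowD (m : nat) (l0 : 'I_n) : (m <= n)%N -> (forall j : 'I_n, (j < m)%N -> (d j < degree q l0)%N) -> (m <= l0)%N.
  by move=> mn h; rewrite -[X in (X <= _)%N](card_ord_lt mn); apply: lowDB.
have degD (l : 'I_n) : (l < k)%N -> (degree q l <= D)%N.
  by move=> lk; apply: (degree_mono qb); rewrite /= -ltnS prednK.
(* A power sum of index at least k with degree at most D would leave k power sums of degree below D,
   too many for the k-th basic invariant. *)
have below_D (j : 'I_n) : (d j <= D)%N -> [|| (j < k.-1)%N, j == ka | j == jl].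
  move=> jD; apply/negPn/negP; rewrite !negb_or -leqNgt => /and3P[kj jk jj].
  have {}kj : (k.-1 < j)%N by rewrite ltn_neqAle kj andbT eq_sym.
  suff : (j <= ka)%N by rewrite leqNgt kj.
  apply: lowD => [|l lj]; first exact: ltnW.
  have ll : l != jl by rewrite -jlE ltn_eqF // (leq_ltn_trans lj).
  apply: leq_trans jD; rewrite !dE //; lia.
have Pval (j : 'I_n) : j != jl -> invariant_D R j = psum R n j.*2.+2.
  by move=> jj; rewrite /invariant_D jlE (negPf jj).
have Pl : invariant_D R jl = prod_vars R n by rewrite /invariant_D jlE eqxx.
have kk : (k.-1.*2.+2 = k.*2)%N by rewrite -doubleS prednK.
have [al [be [ab be0 fibre]]] : exists al be : R, [/\ (al != 0) || (be != 0), k = 1%N -> be = 0 &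
    forall x y : 'cV[R]_n,
      (forall j, (j < k.-1)%N -> peval (psum R n j.*2.+2) x = peval (psum R n j.*2.+2) y) ->
      al * peval (psum R n k.*2) x + be * peval (prod_vars R n) x =
        al * peval (psum R n k.*2) y + be * peval (prod_vars R n) y ->
      forall l : 'I_n, (l < k)%N -> peval (tnth q l) (E^T *m x) = peval (tnth q l) (E^T *m y)].
  have small_agree x y : (forall j, (j < k.-1)%N -> peval (psum R n j.*2.+2) x = peval (psum R n j.*2.+2) y) ->
      forall j : 'I_n, (j < k.-1)%N -> peval (invariant_D R j) x = peval (invariant_D R j) y.
    move=> h j jk; rewrite Pval ?h //.
    by rewrite -jlE ltn_eqF // (leq_ltn_trans jk).
  have conclude x y : (forall j, (d j <= D)%N -> peval (invariant_D R j) x = peval (invariant_D R j) y) ->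
      forall l : 'I_n, (l < k)%N -> peval (tnth q l) (E^T *m x) = peval (tnth q l) (E^T *m y).
    move=> h l lk; have [u [_ ud hu]] := hq l; apply: hu => // [j /ltnW jl'|].
      by apply: h; apply: leq_trans (degD l lk).
    apply: eq_bigr => j _; have [->|/ud dj] := eqVneq (u j) 0; first by rewrite !mul0r.
    by rewrite h // /d dj degD.
  (* If the product has degree above D, it suffices to fix the first k power sums; if instead the
     k-th power sum has degree above D, the product replaces it. Otherwise counting forces both to
     have degree D, and al and be are their coefficients in the k-th basic invariant. *)
  have [lD|lD] := boolP (d jl <= D)%N; last first.
    exists 1, 0; split=> //; first by rewrite oner_eq0.
    move=> x y hp; rewrite !mul1r !mul0r !addr0 => hk; apply: conclude => j jD.
    case/or3P: (below_D j jD) => [/small_agree|/eqP ->|/eqP jj]; first exact.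
      by rewrite Pval //= kk.
    by rewrite -jj jD in lD.
  have [kD|kD] := boolP (d ka <= D)%N; last first.
    exists 0, 1; split; first by rewrite oner_eq0 orbT.
      move=> k1; move: kD; rewrite dE //= k1 /=; have := lD; rewrite dl; move: n3; lia.
    move=> x y hp; rewrite !mul1r !mul0r !add0r => hk; apply: conclude => j jD.
    case/or3P: (below_D j jD) => [/small_agree|/eqP jj|/eqP ->]; first exact.
      by rewrite -jj jD in kD.
    by rewrite Pl.
  have dka : d ka = D.
    apply/eqP; rewrite eqn_leq kD leqNgt; apply/negP => h.
    suff : (k <= ka)%N by rewrite leqNgt ltn_predL k0.
    apply: lowD => [|l lk]; [exact: ltnW|apply: leq_ltn_trans h].
    have ll : l != jl by rewrite -jlE ltn_eqF // (leq_ltn_trans lk).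
    by rewrite !dE //= !ltnS leq_double -ltnS prednK.
  have small_lt (j : 'I_n) : (j < k.-1)%N -> (d j < D)%N.
    move=> jk; have ll : j != jl by rewrite -jlE ltn_eqF // (leq_ltn_trans jk).
    by rewrite -dka !dE //= !ltnS ltn_double.
  have djl : d jl = D.
    apply/eqP; rewrite eqn_leq lD leqNgt; apply/negP => h.
    have : (#|[predU1 jl & [pred l : 'I_n | (l < k.-1)%N]]| <= ka)%N.
      by apply: lowDB => l; rewrite inE => /orP[/eqP -> //|/small_lt].
    rewrite cardU1 (card_ord_lt (ltnW kp)) inE /= -leqNgt.
    have -> : (k.-1 <= n.-1)%N by rewrite -ltnS (prednK n0).
    by rewrite add1n ltnn.
  have [u [[j0 uj0] ud hu]] := hq ka.
  have u_supp j : u j != 0 -> (j == ka) || (j == jl).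
    move=> /ud dj; have {}dj : d j = D by exact: dj.
    have := below_D j; rewrite dj leqnn => /(_ isT) /or3P[/small_lt|->|->]; rewrite ?orbT //.
    by rewrite dj ltnn.
  exists (u ka), (u jl); split.
  - by case/orP: (u_supp j0 uj0) => /eqP <-; rewrite uj0 ?orbT.
  - by move=> k1; have := dka; rewrite -djl dl dE //= k1 /= => n2'; rewrite -n2' in n3.
  - move=> x y hp hk l lk.
    have sums z : \sum_j u j * peval (invariant_D R j) z =
        u ka * peval (psum R n k.*2) z + u jl * peval (prod_vars R n) z.
      rewrite (bigD1 ka) //= (bigD1 jl) 1?eq_sym //= big1 ?addr0 => [|j /andP[jk jj]].
        by rewrite Pl Pval //= kk.
      have [->|/u_supp] := eqVneq (u j) 0; first by rewrite mul0r.
      by rewrite (negPf jk) (negPf jj).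
    have agree j : (d j < D)%N -> peval (invariant_D R j) x = peval (invariant_D R j) y.
      move=> jD; case/or3P: (below_D j (ltnW jD)) => [/small_agree|/eqP jj|/eqP jj]; first exact.
        by rewrite jj dka ltnn in jD.
      by rewrite jj djl ltnn in jD.
    have [lka|lka] := eqVneq l ka; first by rewrite lka; apply: hu; rewrite ?sums.
    have {}lk : (l < k.-1)%N by rewrite ltn_neqAle -ltnS prednK // lk andbT.
    have lD' : (degree q l < D)%N.
      rewrite ltnNge; apply/negP => Dl.
      suff : (k.-1 <= l)%N by rewrite leqNgt lk.
      by apply: lowD => [|j jk]; [exact: ltnW|apply: leq_trans Dl; exact: small_lt].
    have [v [_ vd hv]] := hq l; apply: hv => // [j jl'|]; first by apply: agree; apply: ltn_trans lD'.
    apply: eq_bigr => j _; have [->|/vd dj] := eqVneq (v j) 0; first by rewrite !mul0r.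
    by rewrite agree // /d dj.
have [y [yp yh [J [JK hJ]]]] := even_signed_fibre_point (E *m x0) n3 k0 ab be0.
exists (E^T *m y); split.
  rewrite XE; apply: (sparse_locus (ltnW kn) fsq (y := x0)); last by rewrite -XE.
  have -> : x0 = E^T *m (E *m x0) by rewrite mulmxA EE mul1mx.
  exact: fibre.
apply: (realized_flat_coords (J := J) EE rE GE (@root_D_refl R n) aU (@root_D_indep R n)) => //.
  exact: ltnW.
move=> v _ hv vJ; have cons := root_D_constraint hv.
have vrep i j : j \in J -> y i 0 ^+ 2 = y j 0 ^+ 2 -> v i 0 = 0.
  move=> jJ /eqP; have [-> _|ij] := eqVneq i j; first exact: vJ.
  rewrite eqf_sqr => yij; have [b yb] : exists b : bool, y i 0 = (-1) ^+ b * y j 0.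
    by case/orP: yij => /eqP ->; [exists false|exists true]; rewrite ?expr0 ?expr1; ring.
  by rewrite (cons i j b) // vJ // mulr0.
apply/colP => i; rewrite [RHS]mxE.
case: hJ => [hJ|[[a [b [ab' ya yb]]] hJ]]; first by have [j jJ] := hJ i; exact: vrep.
(* Two zero coordinates put y on both mirrors x a = x b and x a = - x b; any further zero coordinate
   is then tied to that of a. *)
have va : v a 0 = 0.
  have h0 := cons a b false ab'; have h1 := cons a b true ab'.
  rewrite ya yb !mulr0 in h0 h1; have := h0 erefl; have := h1 erefl.
  by rewrite expr0 expr1 => -> h2; lra.
case: (hJ i) => [yi|[j jJ]]; last exact: vrep.
have [-> //|ia] := eqVneq i a.
by rewrite (cons i a false) // ?yi ?ya ?va mulr0.
Qed.

(** * Groups generated by simple roots *)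

Section Vec.
Variable R : realType.

Lemma dot_vec3 (a b c d e f : R) :
  dot (vec 3 [:: a; b; c]) (vec 3 [:: d; e; f]) = a * d + b * e + c * f.
Proof. by rewrite /dot !big_ord_recl big_ord0 !mxE /= addr0 addrA. Qed.

Lemma dot_vec4 (a b c d a' b' c' d' : R) :
  dot (vec 4 [:: a; b; c; d]) (vec 4 [:: a'; b'; c'; d']) = a * a' + b * b' + c * c' + d * d'.
Proof. by rewrite /dot !big_ord_recl big_ord0 !mxE /= addr0 !addrA. Qed.

Lemma vecN (n : nat) (s : seq R) : - vec n s = vec n (map -%R s).
Proof.
apply/colP => i; rewrite !mxE; have [h|h] := ltnP i (size s); first by rewrite (nth_map 0).
by rewrite !nth_default ?size_map ?oppr0.
Qed.

Lemma vec3P (x : 'cV[R]_3) : exists a b c, x = vec 3 [:: a; b; c].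
Proof.
exists (x 0 0), (x 1 0), (x 2 0); apply/colP => -[[|[|[|//]]] h]; rewrite mxE /=;
  congr (x _ 0); exact/val_inj.
Qed.

Lemma vec4P (x : 'cV[R]_4) : exists a b c d, x = vec 4 [:: a; b; c; d].
Proof.
exists (x 0 0), (x 1 0), (x 2 0), (x 3 0); apply/colP => -[[|[|[|[|//]]]] h]; rewrite mxE /=;
  congr (x _ 0); exact/val_inj.
Qed.

(** Giving the coefficient t of the root in the reflection leaves only polynomial identities to
    check, without division. *)
Lemma reflmx_vec3 (t a b c d e f g h i : R) : 0 < d * d + e * e + f * f ->
  t * (d * d + e * e + f * f) = 2 * (d * a + e * b + f * c) ->
  g = a - t * d -> h = b - t * e -> i = c - t * f ->
  reflmx (vec 3 [:: d; e; f]) *m vec 3 [:: a; b; c] = vec 3 [:: g; h; i].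
Proof.
move=> S0 tS -> -> ->; rewrite reflmxE !dot_vec3 -tS mulfK ?gt_eqF //.
by apply/colP => -[[|[|[|//]]] ?]; rewrite !mxE.
Qed.

Lemma reflmx_vec4 (t a b c d a' b' c' d' x y z w : R) : 0 < a' * a' + b' * b' + c' * c' + d' * d' ->
  t * (a' * a' + b' * b' + c' * c' + d' * d') = 2 * (a' * a + b' * b + c' * c + d' * d) ->
  x = a - t * a' -> y = b - t * b' -> z = c - t * c' -> w = d - t * d' ->
  reflmx (vec 4 [:: a'; b'; c'; d']) *m vec 4 [:: a; b; c; d] = vec 4 [:: x; y; z; w].
Proof.
move=> S0 tS -> -> -> ->; rewrite reflmxE !dot_vec4 -tS mulfK ?gt_eqF //.
by apply/colP => -[[|[|[|[|//]]]] ?]; rewrite !mxE.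
Qed.

End Vec.

Section RootGroup.
Variables (R : realType) (n : nat).
Implicit Types (s a x y : 'cV[R]_n).

Lemma tr_reflmx s : (reflmx s)^T = reflmx s.
Proof. by rewrite /reflmx linearB /= linearZ /= trmx_mul trmxK trmx1. Qed.

Lemma dot_reflmx_sym s x y : dot x (reflmx s *m y) = dot (reflmx s *m x) y.
Proof. by rewrite dot_mulmx tr_reflmx. Qed.

Lemma reflmx_conj s a : s != 0 ->
  reflmx (reflmx s *m a) = reflmx s *m reflmx a *m reflmx s.
Proof.
move=> s0; apply: mulmx_ext => x; rewrite -!mulmxA [LHS]reflmxE [reflmx a *m _]reflmxE.
rewrite mulmxBr reflmxK // -scalemxAr -dot_reflmx_sym.
by rewrite -[dot (reflmx s *m a) _]dot_reflmx_sym reflmxK.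
Qed.

Lemma root_group_step (l : seq 'cV[R]_n) s a : s \in l -> s != 0 ->
  root_group l (reflmx a) -> root_group l (reflmx (reflmx s *m a)).
Proof.
move=> sl s0 la; rewrite reflmx_conj //; apply: gen_mul; first apply: gen_mul => //;
  by apply: gen_base; exists s.
Qed.

Lemma root_group_base (l : seq 'cV[R]_n) s : s \in l -> root_group l (reflmx s).
Proof. by move=> sl; apply: gen_base; exists s. Qed.

Lemma generated_invariant (S : set 'M[R]_n) (F : 'cV[R]_n -> R) :
  (forall g, S g -> forall y, F (g *m y) = F y) ->
  forall g, Defs.generated S g -> forall y, F (g *m y) = F y.
Proof.
move=> FS g; elim=> {g} [g Sg y|y|g h _ Fg _ Fh y|g _ Fg y].
- exact: FS.
- by rewrite mul1mx.
- by rewrite -mulmxA Fg Fh.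
(* [invmx] is the identity on matrices that are not invertible. *)
- have [gu|gn] := boolP (g \in unitmx); first by rewrite -{2}(mulKVmx gu y) Fg.
  by rewrite invmx_out.
Qed.

(** The ratio of dot a x to dot a v depends only on the line spanned by a. A list along which it
    increases strictly has no two proportional entries, so only neighbours have to be compared. *)
Lemma pairwise_independent_sorted (l : seq 'cV[R]_n) x v :
  all (fun a => 0 < dot a v) l ->
  sorted (fun a b => dot a x * dot b v < dot b x * dot a v) l ->
  pairwise_independent (fun i : 'I_(size l) => l`_i).
Proof.
move=> pos srt; pose rho a := dot a x / dot a v.
have av (i : 'I_(size l)) : 0 < dot l`_i v by move/(all_nthP 0): pos; apply.
have rho_sorted : sorted <%R (map rho l).
  rewrite sorted_map; move: srt; apply: (sub_in_sorted (P := fun a => 0 < dot a v)) => //.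
  move=> a b a0 b0; rewrite /relpre /rho /= => h; rewrite ltr_pdivrMr // mulrAC ltr_pdivlMr //.
have rho_uniq := lt_sorted_uniq rho_sorted.
apply: pairwise_independent_sep => [i|i j ij].
  by apply: contraTneq (av i) => ->; rewrite dotC dot0r ltxx.
exists (x - rho l`_j *: v); rewrite dotBr dotZr.
  by rewrite /rho divfK ?subrr // gt_eqF.
rewrite -[dot l`_i x](divfK (lt0r_neq0 (av i))) -mulrBl; apply: mulf_neq0; last exact: lt0r_neq0.
rewrite subr_eq0 -/(rho _); apply: contra ij => /eqP h; apply/eqP/val_inj/eqP.
have := @nth_uniq _ 0 (map rho l) i j; rewrite !size_map => <- //.
by rewrite (nth_map 0) // (nth_map 0) // h.
Qed.

End RootGroup.

(** The powers are even, so the vectors need only be permuted up to sign for the sum to be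
    invariant. *)
Definition vsum (R : realType) (n : nat) (vs : seq 'cV[R]_n) (k : nat) : {mpoly R[n]} :=
  \sum_(v <- vs) linear_form v ^+ k.*2.

Section VSum.
Variables (R : realType) (n : nat) (vs : seq 'cV[R]_n).
Implicit Types (x y w : 'cV[R]_n) (k : nat).

Lemma peval_vsum k x : peval (vsum vs k) x = \sum_(v <- vs) dot v x ^+ k.*2.
Proof. by rewrite peval_sum; apply: eq_bigr => v _; rewrite pevalXn peval_linear_form. Qed.

Lemma dot_grad_vsum k x w :
  dot w (grad (vsum vs k) x) = k.*2%:R * \sum_(v <- vs) dot v x ^+ k.*2.-1 * dot w v.
Proof.
rewrite grad_sum mulr_sumr (big_morph (dot w) (dotDr w) (dot0r w)); apply: eq_bigr => v _.
by rewrite gradXn grad_linear_form peval_linear_form dotZr mulrA.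
Qed.

Lemma vsum_homog k : vsum vs k \is (k.*2).-homog.
Proof.
apply: rpred_sum => v _; suff: linear_form v ^+ k.*2 \is [in R[n], (1 * k.*2).-homog] by rewrite mul1n.
apply: dhomogMn; apply: rpred_sum => i _; apply: dhomogZ.
by rewrite dhomogX /= mdeg1.
Qed.

Lemma dotN_even k x w : dot (- w) x ^+ k.*2 = dot w x ^+ k.*2.
Proof. by rewrite dotC dotNr dotC -mul2n !exprM sqrrN. Qed.

Lemma peval_vsum_reflmx k (s : 'cV[R]_n) x :
  \sum_(v <- vs) dot (reflmx s *m v) x ^+ k.*2 = \sum_(v <- vs) dot v x ^+ k.*2 ->
  peval (vsum vs k) (reflmx s *m x) = peval (vsum vs k) x.
Proof.
by rewrite !peval_vsum => <-; apply: eq_bigr => v _; rewrite dot_reflmx_sym.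
Qed.

End VSum.

(* When f is the last invariant, its gradient depends on the others only on mirrors. *)
Lemma corank_one_point (R : realType) (n : nat) (I : finType) (a : I -> 'cV[R]_n.+1)
    (P : 'I_n.+1 -> {mpoly R[n.+1]}) (i0 : 'I_n.+1) (y : 'cV[R]_n.+1) :
  (forall x, (forall i, dot (a i) x != 0) -> \det (jac P x) != 0) ->
  (forall x, dot x x <= peval (P i0) x) ->
  exists x i, dot (a i) x = 0 /\ forall j : 'I_n.+1, j != ord_max -> peval (P j) x = peval (P j) y.
Proof.
move=> J0 P0; pose Phi := \prod_i linear_form (a i).
pose g := [seq P j | j <- enum 'I_n.+1 & j != ord_max].
have [||x c crit _|x Phix gx] := @penalty_point R n.+1 (P ord_max) Phi (P i0) g y.
- rewrite in_cons; have [->|i0n] := eqVneq i0 ord_max; first by rewrite eqxx.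
  by apply/orP; right; apply: map_f; rewrite mem_filter i0n mem_enum.
- exact: P0.
- apply/eqP; rewrite peval_prod; apply/prodf_eq0; apply: contrapT => off.
  have Jx : \det (jac P x) != 0.
    apply: J0 => i; apply/negP => ix; apply: off; exists i => //.
    by rewrite peval_linear_form.
  (* The gradient of the minimised invariant has coefficient 1, which independence would force to be
     0. *)
  have := independent_gradients (c := fun j => if j == ord_max then 1 else - c (P j)) Jx.
  rewrite (bigD1 ord_max) //= eqxx scale1r => h.
  have /h/(_ ord_max) : grad (P ord_max) x + \sum_(j < n.+1 | j != ord_max)
      (if j == ord_max then 1 else - c (P j)) *: grad (P j) x = 0.
    rewrite crit big_map big_filter big_enum_cond /= -big_split /= big1 // => j jn.
    by rewrite (negPf jn) scaleNr subrr.
  by rewrite eqxx => /eqP; rewrite oner_eq0.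
move/eqP: Phix; rewrite peval_prod => /prodf_eq0[i _]; rewrite peval_linear_form => /eqP ix.
exists x, i; split=> // j jn; apply: gx; apply: map_f.
by rewrite mem_filter jn mem_enum.
Qed.

Lemma nth_conj (T : nmodType) (P : T -> Prop) (l : seq T) :
  foldr (fun a Q => P a /\ Q) True l -> forall i : 'I_(size l), P l`_i.
Proof.
elim: l => [_ []|a l IH] //= [Pa Pl] [[|i] //= h].
by have h' : (i < size l)%N by []; exact: (IH Pl (Ordinal h')).
Qed.

Lemma ord3P (j : 'I_3) : j = 0 \/ j = 1 \/ j = 2.
Proof.
by case: j => [[|[|[|//]]] jn]; [left|right; left|right; right]; exact/val_inj.
Qed.

Lemma sum_ord3 (V : zmodType) (F : 'I_3 -> V) : \sum_j F j = F 0 + F 1 + F 2.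
Proof. by rewrite !big_ord_recl big_ord0 addr0 addrA; congr (_ + F _ + F _); exact/val_inj. Qed.

Lemma ord4P (j : 'I_4) : j = 0 \/ j = 1 \/ j = 2 \/ j = 3.
Proof.
by case: j => [[|[|[|[|//]]]] jn]; [left|right; left|right; right; left|right; right; right];
  exact/val_inj.
Qed.

Lemma sum_ord4 (V : zmodType) (F : 'I_4 -> V) : \sum_j F j = F 0 + F 1 + F 2 + F 3.
Proof.
by rewrite !big_ord_recl big_ord0 addr0 !addrA; congr (_ + F _ + F _ + F _); exact/val_inj.
Qed.

(** * Type H_3 *)

Section H3.
Variables (R : realType) (phi : R).
Local Notation v3 a b c := (@vec R 3 [:: a; b; c]).
Local Notation al1 := (v3 1 0 0).
Local Notation al2 := (v3 (- (phi / 2)) (- (1 / 2) + phi / 2) (1 / 2)).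
Local Notation al3 := (v3 0 0 (- 1)).
Hypotheses (phi_sq : phi * phi = phi + 1) (phi_lo : 1618 / 1000 < phi) (phi_hi : phi < 1619 / 1000).

(** The simple roots with 1 / phi replaced by phi - 1, so that all entries are linear in phi. *)
Definition H3_simple : seq 'cV[R]_3 :=
  [:: v3 1 0 0;
      v3 (- (phi / 2)) (- (1 / 2) + phi / 2) (1 / 2);
      v3 0 0 (- 1)].

(* The axes through opposite vertices of the icosahedron. *)
Definition H3_axes : seq 'cV[R]_3 :=
  [:: v3 phi 1 0;
      v3 phi (- 1) 0;
      v3 0 phi 1;
      v3 0 phi (- 1);
      v3 1 0 phi;
      v3 (- 1) 0 phi].

(** One root for each of the 15 mirrors, where 15 + 3 = 2 + 6 + 10. All are on the positive side of
    (1, 10, -1), and they are listed by increasing ratio of the products with (-6, 0, -6) and (1,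
    10, -1). *)
Definition H3_mirrors : seq 'cV[R]_3 :=
  [:: v3 1 0 0;
      v3 (phi / 2) (- (1 / 2) + phi / 2) (1 / 2);
      v3 (- (1 / 2) + phi / 2) (1 / 2) (phi / 2);
      v3 (1 / 2 - phi / 2) (1 / 2) (phi / 2);
      v3 (1 / 2) (phi / 2) (- (1 / 2) + phi / 2);
      v3 (phi / 2) (- (1 / 2) + phi / 2) (- (1 / 2));
      v3 (1 / 2) (phi / 2) (1 / 2 - phi / 2);
      v3 0 1 0;
      v3 (- (1 / 2)) (phi / 2) (- (1 / 2) + phi / 2);
      v3 (- (1 / 2) + phi / 2) (1 / 2) (- (phi / 2));
      v3 (- (1 / 2)) (phi / 2) (1 / 2 - phi / 2);
      v3 (- (phi / 2)) (- (1 / 2) + phi / 2) (1 / 2);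
      v3 (1 / 2 - phi / 2) (1 / 2) (- (phi / 2));
      v3 (- (phi / 2)) (- (1 / 2) + phi / 2) (- (1 / 2));
      v3 0 0 (- 1)].

Let phi3 : phi * (phi * phi) = 2 * phi + 1.
Proof. by rewrite phi_sq mulrDr phi_sq mulr1; ring. Qed.

(** Every listed root is reached from a simple one by simple reflections that stay in the list. The
    explicit argument of [reflmx_vec3] is the coefficient of the reflection. *)
Lemma H3_mirrors_ind (P : 'cV[R]_3 -> Prop) :
  (forall s, s \in H3_simple -> P s) ->
  (forall s a, s \in H3_simple -> P a -> P (reflmx s *m a)) ->
  forall i : 'I_(size H3_mirrors), P (H3_mirrors`_i).
Proof.
(* The relations [h3] and [h2] make the powers of phi linear in phi for [lra]. *)
move=> base step; have h3 := phi3; have h2 := phi_sq.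
have s0 : v3 1 0 0 \in H3_simple by rewrite !inE eqxx ?orbT.
have s1 : v3 (- (phi / 2)) (- (1 / 2) + phi / 2) (1 / 2) \in H3_simple by rewrite !inE eqxx ?orbT.
have s2 : v3 0 0 (- 1) \in H3_simple by rewrite !inE eqxx ?orbT.
have r0 := base _ s0; have r1 := base _ s1; have r2 := base _ s2.
have r3 : P (v3 (1 / 2 - phi / 2) (1 / 2) (phi / 2)).
  have <- : reflmx al2 *m v3 1 0 0 = v3 (1 / 2 - phi / 2) (1 / 2) (phi / 2)
    by clear -phi_sq phi_lo phi_hi h2 h3; apply: (@reflmx_vec3 R (- phi)); lra.
  exact: step s1 r0.
have r4 : P (v3 (phi / 2) (- (1 / 2) + phi / 2) (1 / 2)).
  have <- : reflmx al1 *m v3 (- (phi / 2)) (- (1 / 2) + phi / 2) (1 / 2) = v3 (phi / 2) (- (1 / 2) + phi / 2) (1 / 2)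
    by clear -phi_sq phi_lo phi_hi h2 h3; apply: (@reflmx_vec3 R (- phi)); lra.
  exact: step s0 r1.
have r5 : P (v3 (- (phi / 2)) (- (1 / 2) + phi / 2) (- (1 / 2))).
  have <- : reflmx al3 *m v3 (- (phi / 2)) (- (1 / 2) + phi / 2) (1 / 2) = v3 (- (phi / 2)) (- (1 / 2) + phi / 2) (- (1 / 2))
    by clear -phi_sq phi_lo phi_hi h2 h3; apply: (@reflmx_vec3 R (- 1)); lra.
  exact: step s2 r1.
have r6 : P (v3 (- (1 / 2) + phi / 2) (1 / 2) (phi / 2)).
  have <- : reflmx al1 *m v3 (1 / 2 - phi / 2) (1 / 2) (phi / 2) = v3 (- (1 / 2) + phi / 2) (1 / 2) (phi / 2)
    by clear -phi_sq phi_lo phi_hi h2 h3; apply: (@reflmx_vec3 R (1 - phi)); lra.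
  exact: step s0 r3.
have r7 : P (v3 (1 / 2 - phi / 2) (1 / 2) (- (phi / 2))).
  have <- : reflmx al3 *m v3 (1 / 2 - phi / 2) (1 / 2) (phi / 2) = v3 (1 / 2 - phi / 2) (1 / 2) (- (phi / 2))
    by clear -phi_sq phi_lo phi_hi h2 h3; apply: (@reflmx_vec3 R (- phi)); lra.
  exact: step s2 r3.
have r8 : P (v3 (phi / 2) (- (1 / 2) + phi / 2) (- (1 / 2))).
  have <- : reflmx al3 *m v3 (phi / 2) (- (1 / 2) + phi / 2) (1 / 2) = v3 (phi / 2) (- (1 / 2) + phi / 2) (- (1 / 2))
    by clear -phi_sq phi_lo phi_hi h2 h3; apply: (@reflmx_vec3 R (- 1)); lra.
  exact: step s2 r4.
have r9 : P (v3 (- (1 / 2) + phi / 2) (1 / 2) (- (phi / 2))).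
  have <- : reflmx al3 *m v3 (- (1 / 2) + phi / 2) (1 / 2) (phi / 2) = v3 (- (1 / 2) + phi / 2) (1 / 2) (- (phi / 2))
    by clear -phi_sq phi_lo phi_hi h2 h3; apply: (@reflmx_vec3 R (- phi)); lra.
  exact: step s2 r6.
have r10 : P (v3 (- (1 / 2)) (phi / 2) (- (1 / 2) + phi / 2)).
  have <- : reflmx al2 *m v3 (phi / 2) (- (1 / 2) + phi / 2) (- (1 / 2)) = v3 (- (1 / 2)) (phi / 2) (- (1 / 2) + phi / 2)
    by clear -phi_sq phi_lo phi_hi h2 h3; apply: (@reflmx_vec3 R (- phi)); lra.
  exact: step s1 r8.
have r11 : P (v3 (- (1 / 2)) (phi / 2) (1 / 2 - phi / 2)).
  have <- : reflmx al2 *m v3 (- (1 / 2) + phi / 2) (1 / 2) (- (phi / 2)) = v3 (- (1 / 2)) (phi / 2) (1 / 2 - phi / 2)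
    by clear -phi_sq phi_lo phi_hi h2 h3; apply: (@reflmx_vec3 R (- 1)); lra.
  exact: step s1 r9.
have r12 : P (v3 (1 / 2) (phi / 2) (- (1 / 2) + phi / 2)).
  have <- : reflmx al1 *m v3 (- (1 / 2)) (phi / 2) (- (1 / 2) + phi / 2) = v3 (1 / 2) (phi / 2) (- (1 / 2) + phi / 2)
    by clear -phi_sq phi_lo phi_hi h2 h3; apply: (@reflmx_vec3 R (- 1)); lra.
  exact: step s0 r10.
have r13 : P (v3 (1 / 2) (phi / 2) (1 / 2 - phi / 2)).
  have <- : reflmx al1 *m v3 (- (1 / 2)) (phi / 2) (1 / 2 - phi / 2) = v3 (1 / 2) (phi / 2) (1 / 2 - phi / 2)
    by clear -phi_sq phi_lo phi_hi h2 h3; apply: (@reflmx_vec3 R (- 1)); lra.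
  exact: step s0 r11.
have r14 : P (v3 0 1 0).
  have <- : reflmx al2 *m v3 (1 / 2) (phi / 2) (1 / 2 - phi / 2) = v3 0 1 0
    by clear -phi_sq phi_lo phi_hi h2 h3; apply: (@reflmx_vec3 R (1 - phi)); lra.
  exact: step s1 r13.
apply: nth_conj; rewrite /=; do ![split=> //].
Qed.

Lemma H3_mirrors_indep : pairwise_independent (fun i : 'I_(size H3_mirrors) => H3_mirrors`_i).
Proof.
have h2 := phi_sq; have h4 := phi_lo; have h5 := phi_hi.
apply: (@pairwise_independent_sorted _ _ _ (v3 (- 6) 0 (- 6)) (v3 1 10 (- 1))).
  by rewrite /= !dot_vec3; do ![apply/andP; split=> //]; lra.
by rewrite /= !dot_vec3; do ![apply/andP; split=> //]; lra.
Qed.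

(** The simple reflections permute the six axes up to sign, and f is even. *)
Lemma H3_simple_axes (f : 'cV[R]_3 -> R) s : (forall v, f (- v) = f v) -> s \in H3_simple ->
  \sum_(v <- H3_axes) f (reflmx s *m v) = \sum_(v <- H3_axes) f v.
Proof.
move=> fN; have h3 := phi3; have h2 := phi_sq; rewrite !inE => /or3P[] /eqP -> ; rewrite !big_cons !big_nil.
- have -> : reflmx al1 *m v3 phi 1 0 = - (v3 phi (- 1) 0) by rewrite vecN; apply: (@reflmx_vec3 R (2 * phi)); lra.
  have -> : reflmx al1 *m v3 phi (- 1) 0 = - (v3 phi 1 0) by rewrite vecN; apply: (@reflmx_vec3 R (2 * phi)); lra.
  have -> : reflmx al1 *m v3 0 phi 1 = v3 0 phi 1 by apply: (@reflmx_vec3 R 0); lra.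
  have -> : reflmx al1 *m v3 0 phi (- 1) = v3 0 phi (- 1) by apply: (@reflmx_vec3 R 0); lra.
  have -> : reflmx al1 *m v3 1 0 phi = v3 (- 1) 0 phi by apply: (@reflmx_vec3 R 2); lra.
  have -> : reflmx al1 *m v3 (- 1) 0 phi = v3 1 0 phi by apply: (@reflmx_vec3 R (- 2)); lra.
  rewrite ?fN; ring.
- have -> : reflmx al2 *m v3 phi 1 0 = v3 0 phi 1 by apply: (@reflmx_vec3 R (- 2)); lra.
  have -> : reflmx al2 *m v3 phi (- 1) 0 = v3 (- 1) 0 phi by apply: (@reflmx_vec3 R (- (2 * phi))); lra.
  have -> : reflmx al2 *m v3 0 phi 1 = v3 phi 1 0 by apply: (@reflmx_vec3 R 2); lra.
  have -> : reflmx al2 *m v3 0 phi (- 1) = v3 0 phi (- 1) by apply: (@reflmx_vec3 R 0); lra.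
  have -> : reflmx al2 *m v3 1 0 phi = v3 1 0 phi by apply: (@reflmx_vec3 R 0); lra.
  have -> : reflmx al2 *m v3 (- 1) 0 phi = v3 phi (- 1) 0 by apply: (@reflmx_vec3 R (2 * phi)); lra.
  rewrite ?fN; ring.
- have -> : reflmx al3 *m v3 phi 1 0 = v3 phi 1 0 by apply: (@reflmx_vec3 R 0); lra.
  have -> : reflmx al3 *m v3 phi (- 1) 0 = v3 phi (- 1) 0 by apply: (@reflmx_vec3 R 0); lra.
  have -> : reflmx al3 *m v3 0 phi 1 = v3 0 phi (- 1) by apply: (@reflmx_vec3 R (- 2)); lra.
  have -> : reflmx al3 *m v3 0 phi (- 1) = v3 0 phi 1 by apply: (@reflmx_vec3 R 2); lra.
  have -> : reflmx al3 *m v3 1 0 phi = - (v3 (- 1) 0 phi) by rewrite vecN; apply: (@reflmx_vec3 R (- (2 * phi))); lra.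
  have -> : reflmx al3 *m v3 (- 1) 0 phi = - (v3 1 0 phi) by rewrite vecN; apply: (@reflmx_vec3 R (- (2 * phi))); lra.
  rewrite ?fN; ring.
Qed.

(** The degrees are 2, 6 and 10. *)
Definition H3_invariant (j : 'I_3) : {mpoly R[3]} := vsum H3_axes (nth 0%N [:: 1; 3; 5] j).

Lemma H3_jac : \det (jac H3_invariant (v3 1 phi 1)) != 0.
Proof.
apply: jac_nonsingular => c h; have h2 := phi_sq.
(* Powers of phi are linear in phi with Fibonacci coefficients. *)
have p2 : phi ^+ 2 = phi + 1 by rewrite expr2.
have p3 : phi ^+ 3 = 2 * phi + 1 by rewrite exprS p2; lra.
have p4 : phi ^+ 4 = 3 * phi + 2 by rewrite exprS p3; lra.
have p5 : phi ^+ 5 = 5 * phi + 3 by rewrite exprS p4; lra.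
have p6 : phi ^+ 6 = 8 * phi + 5 by rewrite exprS p5; lra.
have p7 : phi ^+ 7 = 13 * phi + 8 by rewrite exprS p6; lra.
have p8 : phi ^+ 8 = 21 * phi + 13 by rewrite exprS p7; lra.
have p9 : phi ^+ 9 = 34 * phi + 21 by rewrite exprS p8; lra.
have p10 : phi ^+ 10 = 55 * phi + 34 by rewrite exprS p9; lra.
pose y1 : 'cV[R]_3 := v3 1 phi 1.
have grad_e (w : 'cV[R]_3) : c 0 * (2 * \sum_(v <- H3_axes) dot v y1 ^+ 1 * dot w v) +
    c 1 * (6 * \sum_(v <- H3_axes) dot v y1 ^+ 5 * dot w v) +
    c 2 * (10 * \sum_(v <- H3_axes) dot v y1 ^+ 9 * dot w v) = 0.
  have dl : \sum_j c j * dot w (grad (H3_invariant j) y1) = 0.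
    rewrite -[RHS](dot0r w) -h dot_sumr; apply: eq_bigr => j _.
    by rewrite dotZr.
  rewrite sum_ord3 in dl; rewrite -[RHS]dl.
  congr (_ * _ + _ * _ + _ * _); apply/esym.
  - exact: (dot_grad_vsum H3_axes 1 y1 w).
  - exact: (dot_grad_vsum H3_axes 3 y1 w).
  - exact: (dot_grad_vsum H3_axes 5 y1 w).
have d0 : dot (v3 phi 1 0) y1 = 2 * phi by rewrite dot_vec3; lra.
have d1 : dot (v3 phi (- 1) 0) y1 = 0 by rewrite dot_vec3; lra.
have d2 : dot (v3 0 phi 1) y1 = 2 + phi by rewrite dot_vec3; lra.
have d3 : dot (v3 0 phi (- 1)) y1 = phi by rewrite dot_vec3; lra.
have d4 : dot (v3 1 0 phi) y1 = 1 + phi by rewrite dot_vec3; lra.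
have d5 : dot (v3 (- 1) 0 phi) y1 = - 1 + phi by rewrite dot_vec3; lra.
have g10 : \sum_(v <- H3_axes) dot v y1 ^+ 1 * dot (v3 1 0 0) v = 4 + 2 * phi.
  by rewrite /H3_axes !big_cons big_nil d0 d1 d2 d3 d4 d5 !dot_vec3; lra.
have g11 : \sum_(v <- H3_axes) dot v y1 ^+ 1 * dot (v3 0 1 0) v = 2 + 6 * phi.
  by rewrite /H3_axes !big_cons big_nil d0 d1 d2 d3 d4 d5 !dot_vec3; lra.
have g12 : \sum_(v <- H3_axes) dot v y1 ^+ 1 * dot (v3 0 0 1) v = 4 + 2 * phi.
  by rewrite /H3_axes !big_cons big_nil d0 d1 d2 d3 d4 d5 !dot_vec3; lra.
have g50 : \sum_(v <- H3_axes) dot v y1 ^+ 5 * dot (v3 1 0 0) v = 202 + 306 * phi.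
  by rewrite /H3_axes !big_cons big_nil d0 d1 d2 d3 d4 d5 !dot_vec3; lra.
have g51 : \sum_(v <- H3_axes) dot v y1 ^+ 5 * dot (v3 0 1 0) v = 376 + 618 * phi.
  by rewrite /H3_axes !big_cons big_nil d0 d1 d2 d3 d4 d5 !dot_vec3; lra.
have g52 : \sum_(v <- H3_axes) dot v y1 ^+ 5 * dot (v3 0 0 1) v = 232 + 356 * phi.
  by rewrite /H3_axes !big_cons big_nil d0 d1 d2 d3 d4 d5 !dot_vec3; lra.
have g90 : \sum_(v <- H3_axes) dot v y1 ^+ 9 * dot (v3 1 0 0) v = (190 * 100 + 60) + (307 * 100 + 10) * phi.
  by rewrite /H3_axes !big_cons big_nil d0 d1 d2 d3 d4 d5 !dot_vec3; lra.
have g91 : \sum_(v <- H3_axes) dot v y1 ^+ 9 * dot (v3 0 1 0) v = (582 * 100 + 86) + (943 * 100 + 38) * phi.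
  by rewrite /H3_axes !big_cons big_nil d0 d1 d2 d3 d4 d5 !dot_vec3; lra.
have g92 : \sum_(v <- H3_axes) dot v y1 ^+ 9 * dot (v3 0 0 1) v = (319 * 100 + 72) + (516 * 100 + 26) * phi.
  by rewrite /H3_axes !big_cons big_nil d0 d1 d2 d3 d4 d5 !dot_vec3; lra.
have e0 := grad_e (v3 1 0 0); rewrite g10 g50 g90 in e0.
(* Each equation is also multiplied by phi: after reduction by q0, q1 and q2, the numbers c j and
   phi c j satisfy a linear system with rational coefficients, which [lra] solves. *)
have f0 := congr1 (fun t => phi * t) e0; rewrite mulr0 in f0.
have e1 := grad_e (v3 0 1 0); rewrite g11 g51 g91 in e1.
have f1 := congr1 (fun t => phi * t) e1; rewrite mulr0 in f1.
have e2 := grad_e (v3 0 0 1); rewrite g12 g52 g92 in e2.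
have f2 := congr1 (fun t => phi * t) e2; rewrite mulr0 in f2.
have q0 : c 0 * (phi * phi) = c 0 * phi + c 0 by rewrite h2; ring.
have q1 : c 1 * (phi * phi) = c 1 * phi + c 1 by rewrite h2; ring.
have q2 : c 2 * (phi * phi) = c 2 * phi + c 2 by rewrite h2; ring.
clear grad_e h p2 p3 p4 p5 p6 p7 p8 p9 p10 g10 g11 g12 g50 g51 g52 g90 g91 g92.
have c0 : c 0 = 0 by lra.
have c1 : c 1 = 0 by lra.
have c2 : c 2 = 0 by lra.
by move=> j; have [->|[->|->]] := ord3P j.
Qed.
End H3.

Lemma mem_nth_ord (T : zmodType) (l : seq T) (a : T) : a \in l -> exists i : 'I_(size l), l`_i = a.
Proof.
rewrite -index_mem => il; exists (Ordinal il); apply: nth_index.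
by rewrite -index_mem.
Qed.

Lemma golden_facts (R : realType) :
  [/\ golden R * golden R = golden R + 1, 1618 / 1000 < golden R, golden R < 1619 / 1000
    & (golden R)^-1 = golden R - 1].
Proof.
have s5 : Num.sqrt 5 * Num.sqrt 5 = 5 :> R by rewrite -expr2 sqr_sqrtr // ler0n.
have s0 : 0 <= Num.sqrt 5 :> R by exact: sqrtr_ge0.
have sq : golden R * golden R = golden R + 1 by rewrite /golden; lra.
have lo : 1618 / 1000 < golden R by rewrite /golden; nra.
have hi : golden R < 1619 / 1000 by rewrite /golden; nra.
split=> //; have g0 : golden R != 0 by rewrite gt_eqF //; lra.
by apply: (mulfI g0); rewrite divff // mulrBr sq; ring.
Qed.

Lemma type_H3_meets (R : realType) (N : nat) (E : 'M[R]_(3, N)) (G : set 'M[R]_N)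
    (k : nat) (X : set 'cV[R]_N) :
  E^T *m E = 1%:M -> range (mulmx E : 'cV[R]_N -> 'cV[R]_3) = setT ->
  G = [set E^T *m h *m E | h in root_group (H3_simple_roots R)] ->
  reflection_group G -> X !=set0 -> (0 < k)%N -> (k <= N)%N -> sparse G k X ->
  X `&` flat_stratum G k !=set0.
Proof.
move=> EE rE; move: (square_realization EE rE) => N3; subst N.
have [phi_sq phi_lo phi_hi phi_inv] := golden_facts R; set phi := golden R in phi_sq phi_lo phi_hi phi_inv.
have -> : H3_simple_roots R = H3_simple phi.
  rewrite /H3_simple_roots -/phi phi_inv /H3_simple; congr [:: _; vec 3 [:: _; _; _]; _]; lra.
move=> GE Grefl [x0 Xx0] k0 k3 [q [qb [fs fsq XE]]].
set W := root_group _ in GE.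
pose a (i : 'I_(size (H3_mirrors phi))) := (H3_mirrors phi)`_i.
have simple0 s : s \in H3_simple phi -> s != 0.
  rewrite -dot_eq0 !inE => /or3P[] /eqP ->; rewrite dot_vec3 gt_eqF //; lra.
have aW i : W (reflmx (a i)).
  apply: (H3_mirrors_ind phi_sq (P := fun a => W (reflmx a))) => [s sS|s b sS Wb].
    exact: root_group_base.
  by apply: root_group_step => //; exact: simple0.
have aU i : [set: 'cV[R]_3] (a i) by [].
have ai : pairwise_independent a := H3_mirrors_indep phi_sq phi_lo phi_hi.
pose P := H3_invariant phi; pose d (j : 'I_3) := ((nth 0 [:: 1; 3; 5] j).*2)%N.
pose y1 : 'cV[R]_3 := vec 3 [:: 1; phi; 1].
have P_homog j : P j \is (d j).-homog by exact: vsum_homog.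
have P_inv0 j h y : W h -> peval (P j) (h *m y) = peval (P j) y.
  move=> Wh; apply: generated_invariant Wh y => g [s sS ->] y.
  apply: peval_vsum_reflmx.
  apply: (H3_simple_axes phi_sq (f := fun v => dot v y ^+ _)) => // v.
  exact: dotN_even.
have P_inv j h y : W h -> [set: 'cV[R]_3] y -> peval (P j) (h *m y) = peval (P j) y by move=> Wh _; exact: P_inv0.
have WU h y : W h -> [set: 'cV[R]_3] y -> [set: 'cV[R]_3] (h *m y) by [].
have y1U : [set: 'cV[R]_3] y1 by [].
have Py1 : \det (jac P y1) != 0 by exact: H3_jac.
have Py1E : \det (jac P y1 *m E) != 0.
  by rewrite det_mulmx mulf_neq0 //; have [_] := mulmx1_unit EE; rewrite unitmxE unitfE.
have d_count : (\sum_j d j <= #|'I_(size (H3_mirrors phi))| + 3)%N.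
  by rewrite card_ord !big_ord_recl big_ord0.
have d_lt (i j : 'I_3) : (i < j)%N -> (d i < d j)%N.
  by case: i j => [[|[|[|?]]] ?] [[|[|[|?]]] ?].
have P0 x : peval (P 0) x = 2 * (phi + 2) * dot x x.
  have [x1 [x2 [x3 ->]]] := vec3P x.
  by rewrite peval_vsum /H3_axes !big_cons big_nil !dot_vec3 /=; nra.
suff [y [yfib yflat]] : exists y, (forall j : 'I_3, (j < k)%N -> peval (P j) y = peval (P j) (E *m x0)) /\
    flat_stratum G k (E^T *m y).
  exists (E^T *m y); split=> //; rewrite XE; apply: (sparse_locus k3 fsq (y := x0)); last by rewrite -XE.
  have -> : x0 = E^T *m (E *m x0) by rewrite mulmxA EE mul1mx.
  move=> l lk; exact: (realized_fibre EE rE GE Grefl aW aU ai P_homog WU P_inv y1U Py1E d_count qb d_lt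
    _ _ yfib lk).
have [->|k3'] := eqVneq k 3%N.
  by exists (E *m x0); split=> //; exact: flat_stratum_full.
have [k2|k2'] := eqVneq k 2%N.
  have [x|x|y [i [iy yfib]]] := @corank_one_point R 2 _ a P 0 (E *m x0).
  - apply: (jac_neq0_off_mirrors ai P_homog) Py1 d_count => j i y; apply: P_inv0; exact: aW.
  - by rewrite P0; have := dot_ge0 x; nra.
  exists y; rewrite k2; split; last exact: (realized_flat_mirror EE rE GE aW ai iy).
  by move=> j j2; apply: yfib; rewrite -val_eqE /= ltn_eqF.
have k1 : k = 1%N by move: k0 k3 k3' k2'; case: (k) => [|[|[|[|]]]].
(* For k = 1 only the norm is fixed. The second axis is the line common to the mirrors of the first
   and third basis vectors, so a point of the right norm is taken on it. *)
pose y0 := E *m x0; pose c := Num.sqrt (dot y0 y0).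
exists (vec 3 [:: 0; c; 0]); rewrite k1; split.
  move=> j j1; have -> : j = 0 by move: j1; have [->|[->|->]] := ord3P j.
  rewrite !P0 dot_vec3 -/y0; congr (_ * _); rewrite !mul0r add0r addr0 -expr2 sqr_sqrtr //.
  exact: dot_ge0.
apply: (realized_flat_coords (J := [set 1]%SET) EE rE GE aW aU ai) => //; first by rewrite cards1.
move=> v _ hv /(_ 1) v1; have {}v1 : v 1 0 = 0 by apply: v1; rewrite inE.
have e0 : v 0 0 = 0.
  have [|i ia] := @mem_nth_ord _ (H3_mirrors phi) (vec 3 [:: 1; 0; 0]); first by rewrite !inE eqxx ?orbT.
  have := hv i; rewrite /a ia dot_vec3 => hv'.
  have [x1 [x2 [x3 vE]]] := vec3P v; move: hv'; rewrite vE dot_vec3 mxE /= => h.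
  by move: (h ltac:(ring)); lra.
have e2 : v 2 0 = 0.
  have [|i ia] := @mem_nth_ord _ (H3_mirrors phi) (vec 3 [:: 0; 0; -1]); first by rewrite !inE eqxx ?orbT.
  have := hv i; rewrite /a ia dot_vec3 => hv'.
  have [x1 [x2 [x3 vE]]] := vec3P v; move: hv'; rewrite vE dot_vec3 mxE /= => h.
  by move: (h ltac:(ring)); lra.
by apply/colP => j; rewrite [RHS]mxE; have [->|[->|->]] := ord3P j.
Qed.

(** * Type F_4 *)

Section F4.
Variables (R : realType).
Local Notation v4 a b c d := (@vec R 4 [:: a; b; c; d]).
Local Notation al1 := (v4 0 1 (- 1) 0).
Local Notation al2 := (v4 0 0 1 (- 1)).
Local Notation al3 := (v4 0 0 0 1).
Local Notation al4 := (v4 (1 / 2) (- (1 / 2)) (- (1 / 2)) (- (1 / 2))).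

(* The long roots up to sign. *)
Definition F4_axes : seq 'cV[R]_4 :=
  [:: v4 1 1 0 0;
      v4 1 (- 1) 0 0;
      v4 1 0 1 0;
      v4 1 0 (- 1) 0;
      v4 1 0 0 1;
      v4 1 0 0 (- 1);
      v4 0 1 1 0;
      v4 0 1 (- 1) 0;
      v4 0 1 0 1;
      v4 0 1 0 (- 1);
      v4 0 0 1 1;
      v4 0 0 1 (- 1)].

Lemma F4_axes_sum (V : zmodType) (F : 'cV[R]_4 -> V) : \sum_(v <- F4_axes) F v =
  F (v4 1 1 0 0) + (F (v4 1 (- 1) 0 0) + (F (v4 1 0 1 0) + (F (v4 1 0 (- 1) 0) +
  (F (v4 1 0 0 1) + (F (v4 1 0 0 (- 1)) + (F (v4 0 1 1 0) + (F (v4 0 1 (- 1) 0) +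
  (F (v4 0 1 0 1) + (F (v4 0 1 0 (- 1)) + (F (v4 0 0 1 1) + F (v4 0 0 1 (- 1)))))))))))).
Proof. by rewrite /F4_axes !big_cons big_nil addr0. Qed.

(** One root for each of the 24 mirrors, where 24 + 4 = 2 + 6 + 8 + 12, listed by increasing ratio
    of the products with (-2, 4, -1, 2) and (20, 7, 3, 1). *)
Definition F4_mirrors : seq 'cV[R]_4 :=
  [:: v4 0 0 1 (- 1);
      v4 (1 / 2) (- (1 / 2)) (- (1 / 2)) (- (1 / 2));
      v4 (1 / 2) (- (1 / 2)) (1 / 2) (- (1 / 2));
      v4 1 (- 1) 0 0;
      v4 0 0 1 0;
      v4 (1 / 2) (- (1 / 2)) (1 / 2) (1 / 2);
      v4 (1 / 2) (- (1 / 2)) (- (1 / 2)) (1 / 2);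
      v4 1 0 0 (- 1);
      v4 1 0 1 0;
      v4 1 0 0 0;
      v4 1 0 (- 1) 0;
      v4 (1 / 2) (1 / 2) (1 / 2) (- (1 / 2));
      v4 1 0 0 1;
      v4 (1 / 2) (1 / 2) (- (1 / 2)) (- (1 / 2));
      v4 1 1 0 0;
      v4 (1 / 2) (1 / 2) (1 / 2) (1 / 2);
      v4 (1 / 2) (1 / 2) (- (1 / 2)) (1 / 2);
      v4 0 0 1 1;
      v4 0 1 1 0;
      v4 0 1 0 (- 1);
      v4 0 1 0 0;
      v4 0 1 0 1;
      v4 0 1 (- 1) 0;
      v4 0 0 0 1].

(** As for H_3, each root arises from an earlier one by a simple reflection. The principle is used
    for the reflections of the group and again for [F4_reach]. *)
Lemma F4_mirrors_ind (P : 'cV[R]_4 -> Prop) :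
  (forall s, s \in F4_simple_roots R -> P s) ->
  (forall s a, s \in F4_simple_roots R -> P a -> P (reflmx s *m a)) ->
  forall i : 'I_(size F4_mirrors), P (F4_mirrors`_i).
Proof.
move=> base step.
have s0 : v4 0 1 (- 1) 0 \in F4_simple_roots R by rewrite !inE eqxx ?orbT.
have r0 := base _ s0.
have s1 : v4 0 0 1 (- 1) \in F4_simple_roots R by rewrite !inE eqxx ?orbT.
have r1 := base _ s1.
have s2 : v4 0 0 0 1 \in F4_simple_roots R by rewrite !inE eqxx ?orbT.
have r2 := base _ s2.
have s3 : v4 (1 / 2) (- (1 / 2)) (- (1 / 2)) (- (1 / 2)) \in F4_simple_roots R by rewrite !inE eqxx ?orbT.
have r3 := base _ s3.
have r4 : P (v4 0 1 0 (- 1)).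
  have <- : reflmx al2 *m v4 0 1 (- 1) 0 = v4 0 1 0 (- 1)
    by clear; apply: (@reflmx_vec4 R (- 1)); lra.
  exact: step s1 r0.
have r5 : P (v4 0 0 1 1).
  have <- : reflmx al3 *m v4 0 0 1 (- 1) = v4 0 0 1 1
    by clear; apply: (@reflmx_vec4 R (- 2)); lra.
  exact: step s2 r1.
have r6 : P (v4 0 0 1 0).
  have <- : reflmx al2 *m v4 0 0 0 1 = v4 0 0 1 0
    by clear; apply: (@reflmx_vec4 R (- 1)); lra.
  exact: step s1 r2.
have r7 : P (v4 (1 / 2) (- (1 / 2)) (- (1 / 2)) (1 / 2)).
  have <- : reflmx al4 *m v4 0 0 0 1 = v4 (1 / 2) (- (1 / 2)) (- (1 / 2)) (1 / 2)
    by clear; apply: (@reflmx_vec4 R (- 1)); lra.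
  exact: step s3 r2.
have r8 : P (v4 0 1 0 1).
  have <- : reflmx al3 *m v4 0 1 0 (- 1) = v4 0 1 0 1
    by clear; apply: (@reflmx_vec4 R (- 2)); lra.
  exact: step s2 r4.
have r9 : P (v4 1 (- 1) 0 0).
  have <- : reflmx al4 *m v4 0 0 1 1 = v4 1 (- 1) 0 0
    by clear; apply: (@reflmx_vec4 R (- 2)); lra.
  exact: step s3 r5.
have r10 : P (v4 0 1 0 0).
  have <- : reflmx al1 *m v4 0 0 1 0 = v4 0 1 0 0
    by clear; apply: (@reflmx_vec4 R (- 1)); lra.
  exact: step s0 r6.
have r11 : P (v4 (1 / 2) (- (1 / 2)) (1 / 2) (- (1 / 2))).
  have <- : reflmx al4 *m v4 0 0 1 0 = v4 (1 / 2) (- (1 / 2)) (1 / 2) (- (1 / 2))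
    by clear; apply: (@reflmx_vec4 R (- 1)); lra.
  exact: step s3 r6.
have r12 : P (v4 0 1 1 0).
  have <- : reflmx al2 *m v4 0 1 0 1 = v4 0 1 1 0
    by clear; apply: (@reflmx_vec4 R (- 1)); lra.
  exact: step s1 r8.
have r13 : P (v4 1 0 (- 1) 0).
  have <- : reflmx al4 *m v4 0 1 0 1 = v4 1 0 (- 1) 0
    by clear; apply: (@reflmx_vec4 R (- 2)); lra.
  exact: step s3 r8.
have r14 : P (v4 (1 / 2) (1 / 2) (- (1 / 2)) (- (1 / 2))).
  have <- : reflmx al4 *m v4 0 1 0 0 = v4 (1 / 2) (1 / 2) (- (1 / 2)) (- (1 / 2))
    by clear; apply: (@reflmx_vec4 R (- 1)); lra.
  exact: step s3 r10.
have r15 : P (v4 (1 / 2) (- (1 / 2)) (1 / 2) (1 / 2)).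
  have <- : reflmx al3 *m v4 (1 / 2) (- (1 / 2)) (1 / 2) (- (1 / 2)) = v4 (1 / 2) (- (1 / 2)) (1 / 2) (1 / 2)
    by clear; apply: (@reflmx_vec4 R (- 1)); lra.
  exact: step s2 r11.
have r16 : P (v4 1 0 0 (- 1)).
  have <- : reflmx al4 *m v4 0 1 1 0 = v4 1 0 0 (- 1)
    by clear; apply: (@reflmx_vec4 R (- 2)); lra.
  exact: step s3 r12.
have r17 : P (v4 (1 / 2) (1 / 2) (- (1 / 2)) (1 / 2)).
  have <- : reflmx al3 *m v4 (1 / 2) (1 / 2) (- (1 / 2)) (- (1 / 2)) = v4 (1 / 2) (1 / 2) (- (1 / 2)) (1 / 2)
    by clear; apply: (@reflmx_vec4 R (- 1)); lra.
  exact: step s2 r14.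
have r18 : P (v4 1 0 0 1).
  have <- : reflmx al3 *m v4 1 0 0 (- 1) = v4 1 0 0 1
    by clear; apply: (@reflmx_vec4 R (- 2)); lra.
  exact: step s2 r16.
have r19 : P (v4 (1 / 2) (1 / 2) (1 / 2) (- (1 / 2))).
  have <- : reflmx al2 *m v4 (1 / 2) (1 / 2) (- (1 / 2)) (1 / 2) = v4 (1 / 2) (1 / 2) (1 / 2) (- (1 / 2))
    by clear; apply: (@reflmx_vec4 R (- 1)); lra.
  exact: step s1 r17.
have r20 : P (v4 1 0 1 0).
  have <- : reflmx al2 *m v4 1 0 0 1 = v4 1 0 1 0
    by clear; apply: (@reflmx_vec4 R (- 1)); lra.
  exact: step s1 r18.
have r21 : P (v4 (1 / 2) (1 / 2) (1 / 2) (1 / 2)).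
  have <- : reflmx al3 *m v4 (1 / 2) (1 / 2) (1 / 2) (- (1 / 2)) = v4 (1 / 2) (1 / 2) (1 / 2) (1 / 2)
    by clear; apply: (@reflmx_vec4 R (- 1)); lra.
  exact: step s2 r19.
have r22 : P (v4 1 1 0 0).
  have <- : reflmx al1 *m v4 1 0 1 0 = v4 1 1 0 0
    by clear; apply: (@reflmx_vec4 R (- 1)); lra.
  exact: step s0 r20.
have r23 : P (v4 1 0 0 0).
  have <- : reflmx al4 *m v4 (1 / 2) (1 / 2) (1 / 2) (1 / 2) = v4 1 0 0 0
    by clear; apply: (@reflmx_vec4 R (- 1)); lra.
  exact: step s3 r21.
apply: nth_conj; rewrite /=; do ![split=> //].
Qed.

Lemma F4_mirrors_indep : pairwise_independent (fun i : 'I_(size F4_mirrors) => F4_mirrors`_i).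
Proof.
apply: (@pairwise_independent_sorted _ _ _ (v4 (- 2) 4 (- 1) 2) (v4 20 7 3 1)).
  by rewrite /= !dot_vec4; do ![apply/andP; split=> //]; lra.
by rewrite /= !dot_vec4; do ![apply/andP; split=> //]; lra.
Qed.

(** The simple reflections preserve root lengths, hence permute the long roots up to sign. *)
Lemma F4_simple_axes (f : 'cV[R]_4 -> R) s : (forall v, f (- v) = f v) -> s \in F4_simple_roots R ->
  \sum_(v <- F4_axes) f (reflmx s *m v) = \sum_(v <- F4_axes) f v.
Proof.
move=> fN; rewrite !inE => /or4P[] /eqP -> ; rewrite !big_cons !big_nil.
- have -> : reflmx al1 *m v4 1 1 0 0 = v4 1 0 1 0 by apply: (@reflmx_vec4 R 1); lra.
  have -> : reflmx al1 *m v4 1 (- 1) 0 0 = v4 1 0 (- 1) 0 by apply: (@reflmx_vec4 R (- 1)); lra.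
  have -> : reflmx al1 *m v4 1 0 1 0 = v4 1 1 0 0 by apply: (@reflmx_vec4 R (- 1)); lra.
  have -> : reflmx al1 *m v4 1 0 (- 1) 0 = v4 1 (- 1) 0 0 by apply: (@reflmx_vec4 R 1); lra.
  have -> : reflmx al1 *m v4 1 0 0 1 = v4 1 0 0 1 by apply: (@reflmx_vec4 R 0); lra.
  have -> : reflmx al1 *m v4 1 0 0 (- 1) = v4 1 0 0 (- 1) by apply: (@reflmx_vec4 R 0); lra.
  have -> : reflmx al1 *m v4 0 1 1 0 = v4 0 1 1 0 by apply: (@reflmx_vec4 R 0); lra.
  have -> : reflmx al1 *m v4 0 1 (- 1) 0 = - (v4 0 1 (- 1) 0) by rewrite vecN; apply: (@reflmx_vec4 R 2); lra.
  have -> : reflmx al1 *m v4 0 1 0 1 = v4 0 0 1 1 by apply: (@reflmx_vec4 R 1); lra.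
  have -> : reflmx al1 *m v4 0 1 0 (- 1) = v4 0 0 1 (- 1) by apply: (@reflmx_vec4 R 1); lra.
  have -> : reflmx al1 *m v4 0 0 1 1 = v4 0 1 0 1 by apply: (@reflmx_vec4 R (- 1)); lra.
  have -> : reflmx al1 *m v4 0 0 1 (- 1) = v4 0 1 0 (- 1) by apply: (@reflmx_vec4 R (- 1)); lra.
  rewrite ?fN; ring.
- have -> : reflmx al2 *m v4 1 1 0 0 = v4 1 1 0 0 by apply: (@reflmx_vec4 R 0); lra.
  have -> : reflmx al2 *m v4 1 (- 1) 0 0 = v4 1 (- 1) 0 0 by apply: (@reflmx_vec4 R 0); lra.
  have -> : reflmx al2 *m v4 1 0 1 0 = v4 1 0 0 1 by apply: (@reflmx_vec4 R 1); lra.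
  have -> : reflmx al2 *m v4 1 0 (- 1) 0 = v4 1 0 0 (- 1) by apply: (@reflmx_vec4 R (- 1)); lra.
  have -> : reflmx al2 *m v4 1 0 0 1 = v4 1 0 1 0 by apply: (@reflmx_vec4 R (- 1)); lra.
  have -> : reflmx al2 *m v4 1 0 0 (- 1) = v4 1 0 (- 1) 0 by apply: (@reflmx_vec4 R 1); lra.
  have -> : reflmx al2 *m v4 0 1 1 0 = v4 0 1 0 1 by apply: (@reflmx_vec4 R 1); lra.
  have -> : reflmx al2 *m v4 0 1 (- 1) 0 = v4 0 1 0 (- 1) by apply: (@reflmx_vec4 R (- 1)); lra.
  have -> : reflmx al2 *m v4 0 1 0 1 = v4 0 1 1 0 by apply: (@reflmx_vec4 R (- 1)); lra.
  have -> : reflmx al2 *m v4 0 1 0 (- 1) = v4 0 1 (- 1) 0 by apply: (@reflmx_vec4 R 1); lra.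
  have -> : reflmx al2 *m v4 0 0 1 1 = v4 0 0 1 1 by apply: (@reflmx_vec4 R 0); lra.
  have -> : reflmx al2 *m v4 0 0 1 (- 1) = - (v4 0 0 1 (- 1)) by rewrite vecN; apply: (@reflmx_vec4 R 2); lra.
  rewrite ?fN; ring.
- have -> : reflmx al3 *m v4 1 1 0 0 = v4 1 1 0 0 by apply: (@reflmx_vec4 R 0); lra.
  have -> : reflmx al3 *m v4 1 (- 1) 0 0 = v4 1 (- 1) 0 0 by apply: (@reflmx_vec4 R 0); lra.
  have -> : reflmx al3 *m v4 1 0 1 0 = v4 1 0 1 0 by apply: (@reflmx_vec4 R 0); lra.
  have -> : reflmx al3 *m v4 1 0 (- 1) 0 = v4 1 0 (- 1) 0 by apply: (@reflmx_vec4 R 0); lra.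
  have -> : reflmx al3 *m v4 1 0 0 1 = v4 1 0 0 (- 1) by apply: (@reflmx_vec4 R 2); lra.
  have -> : reflmx al3 *m v4 1 0 0 (- 1) = v4 1 0 0 1 by apply: (@reflmx_vec4 R (- 2)); lra.
  have -> : reflmx al3 *m v4 0 1 1 0 = v4 0 1 1 0 by apply: (@reflmx_vec4 R 0); lra.
  have -> : reflmx al3 *m v4 0 1 (- 1) 0 = v4 0 1 (- 1) 0 by apply: (@reflmx_vec4 R 0); lra.
  have -> : reflmx al3 *m v4 0 1 0 1 = v4 0 1 0 (- 1) by apply: (@reflmx_vec4 R 2); lra.
  have -> : reflmx al3 *m v4 0 1 0 (- 1) = v4 0 1 0 1 by apply: (@reflmx_vec4 R (- 2)); lra.
  have -> : reflmx al3 *m v4 0 0 1 1 = v4 0 0 1 (- 1) by apply: (@reflmx_vec4 R 2); lra.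
  have -> : reflmx al3 *m v4 0 0 1 (- 1) = v4 0 0 1 1 by apply: (@reflmx_vec4 R (- 2)); lra.
  rewrite ?fN; ring.
- have -> : reflmx al4 *m v4 1 1 0 0 = v4 1 1 0 0 by apply: (@reflmx_vec4 R 0); lra.
  have -> : reflmx al4 *m v4 1 (- 1) 0 0 = v4 0 0 1 1 by apply: (@reflmx_vec4 R 2); lra.
  have -> : reflmx al4 *m v4 1 0 1 0 = v4 1 0 1 0 by apply: (@reflmx_vec4 R 0); lra.
  have -> : reflmx al4 *m v4 1 0 (- 1) 0 = v4 0 1 0 1 by apply: (@reflmx_vec4 R 2); lra.
  have -> : reflmx al4 *m v4 1 0 0 1 = v4 1 0 0 1 by apply: (@reflmx_vec4 R 0); lra.
  have -> : reflmx al4 *m v4 1 0 0 (- 1) = v4 0 1 1 0 by apply: (@reflmx_vec4 R 2); lra.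
  have -> : reflmx al4 *m v4 0 1 1 0 = v4 1 0 0 (- 1) by apply: (@reflmx_vec4 R (- 2)); lra.
  have -> : reflmx al4 *m v4 0 1 (- 1) 0 = v4 0 1 (- 1) 0 by apply: (@reflmx_vec4 R 0); lra.
  have -> : reflmx al4 *m v4 0 1 0 1 = v4 1 0 (- 1) 0 by apply: (@reflmx_vec4 R (- 2)); lra.
  have -> : reflmx al4 *m v4 0 1 0 (- 1) = v4 0 1 0 (- 1) by apply: (@reflmx_vec4 R 0); lra.
  have -> : reflmx al4 *m v4 0 0 1 1 = v4 1 (- 1) 0 0 by apply: (@reflmx_vec4 R (- 2)); lra.
  have -> : reflmx al4 *m v4 0 0 1 (- 1) = v4 0 0 1 (- 1) by apply: (@reflmx_vec4 R 0); lra.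
  rewrite ?fN; ring.
Qed.

(** The degrees are 2, 6, 8 and 12. *)
Definition F4_invariant (j : 'I_4) : {mpoly R[4]} := vsum F4_axes (nth 0%N [:: 1; 3; 4; 6] j).

Lemma F4_jac : \det (jac F4_invariant (v4 1 2 3 5)) != 0.
Proof.
apply: jac_nonsingular => c h.
pose y1 : 'cV[R]_4 := v4 1 2 3 5.
have grad_e (w : 'cV[R]_4) : c 0 * (2 * \sum_(v <- F4_axes) dot v y1 ^+ 1 * dot w v) +
    c 1 * (6 * \sum_(v <- F4_axes) dot v y1 ^+ 5 * dot w v) +
    c 2 * (8 * \sum_(v <- F4_axes) dot v y1 ^+ 7 * dot w v) +
    c 3 * (12 * \sum_(v <- F4_axes) dot v y1 ^+ 11 * dot w v) = 0.
  have dl : \sum_j c j * dot w (grad (F4_invariant j) y1) = 0.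
    rewrite -[RHS](dot0r w) -h dot_sumr; apply: eq_bigr => j _.
    by rewrite dotZr.
  rewrite sum_ord4 in dl; rewrite -[RHS]dl.
  congr (_ * _ + _ * _ + _ * _ + _ * _); apply/esym.
  - exact: (dot_grad_vsum F4_axes 1 y1 w).
  - exact: (dot_grad_vsum F4_axes 3 y1 w).
  - exact: (dot_grad_vsum F4_axes 4 y1 w).
  - exact: (dot_grad_vsum F4_axes 6 y1 w).
have d0 : dot (v4 1 1 0 0) y1 = 3 by rewrite dot_vec4; lra.
have d1 : dot (v4 1 (- 1) 0 0) y1 = - 1 by rewrite dot_vec4; lra.
have d2 : dot (v4 1 0 1 0) y1 = 4 by rewrite dot_vec4; lra.
have d3 : dot (v4 1 0 (- 1) 0) y1 = - 2 by rewrite dot_vec4; lra.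
have d4 : dot (v4 1 0 0 1) y1 = 6 by rewrite dot_vec4; lra.
have d5 : dot (v4 1 0 0 (- 1)) y1 = - 4 by rewrite dot_vec4; lra.
have d6 : dot (v4 0 1 1 0) y1 = 5 by rewrite dot_vec4; lra.
have d7 : dot (v4 0 1 (- 1) 0) y1 = - 1 by rewrite dot_vec4; lra.
have d8 : dot (v4 0 1 0 1) y1 = 7 by rewrite dot_vec4; lra.
have d9 : dot (v4 0 1 0 (- 1)) y1 = - 3 by rewrite dot_vec4; lra.
have d10 : dot (v4 0 0 1 1) y1 = 8 by rewrite dot_vec4; lra.
have d11 : dot (v4 0 0 1 (- 1)) y1 = - 2 by rewrite dot_vec4; lra.
have dE := (d0, d1, d2, d3, d4, d5, d6, d7, d8, d9, d10, d11).
(* Numerals are unary, hence the splitting in base 100. *)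
have g1_0 : \sum_(v <- F4_axes) dot v y1 ^+ 1 * dot (v4 1 0 0 0) v = 6.
  by rewrite F4_axes_sum !dE !dot_vec4; ring.
have g1_1 : \sum_(v <- F4_axes) dot v y1 ^+ 1 * dot (v4 0 1 0 0) v = 12.
  by rewrite F4_axes_sum !dE !dot_vec4; ring.
have g1_2 : \sum_(v <- F4_axes) dot v y1 ^+ 1 * dot (v4 0 0 1 0) v = 18.
  by rewrite F4_axes_sum !dE !dot_vec4; ring.
have g1_3 : \sum_(v <- F4_axes) dot v y1 ^+ 1 * dot (v4 0 0 0 1) v = 30.
  by rewrite F4_axes_sum !dE !dot_vec4; ring.
have g5_0 : \sum_(v <- F4_axes) dot v y1 ^+ 5 * dot (v4 1 0 0 0) v = (79 * 100 + 86).
  by rewrite F4_axes_sum !dE !dot_vec4; ring.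
have g5_1 : \sum_(v <- F4_axes) dot v y1 ^+ 5 * dot (v4 0 1 0 0) v = (199 * 100 + 32).
  by rewrite F4_axes_sum !dE !dot_vec4; ring.
have g5_2 : \sum_(v <- F4_axes) dot v y1 ^+ 5 * dot (v4 0 0 1 0) v = (369 * 100 + 18).
  by rewrite F4_axes_sum !dE !dot_vec4; ring.
have g5_3 : \sum_(v <- F4_axes) dot v y1 ^+ 5 * dot (v4 0 0 0 1) v = (586 * 100 + 50).
  by rewrite F4_axes_sum !dE !dot_vec4; ring.
have g7_0 : \sum_(v <- F4_axes) dot v y1 ^+ 7 * dot (v4 1 0 0 0) v = ((28 * 100 + 19) * 100 + 94).
  by rewrite F4_axes_sum !dE !dot_vec4; ring.
have g7_1 : \sum_(v <- F4_axes) dot v y1 ^+ 7 * dot (v4 0 1 0 0) v = ((90 * 100 + 16) * 100 + 68).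
  by rewrite F4_axes_sum !dE !dot_vec4; ring.
have g7_2 : \sum_(v <- F4_axes) dot v y1 ^+ 7 * dot (v4 0 0 1 0) v = ((219 * 100 + 16) * 100 + 62).
  by rewrite F4_axes_sum !dE !dot_vec4; ring.
have g7_3 : \sum_(v <- F4_axes) dot v y1 ^+ 7 * dot (v4 0 0 0 1) v = ((321 * 100 + 93) * 100 + 30).
  by rewrite F4_axes_sum !dE !dot_vec4; ring.
have g11_0 : \sum_(v <- F4_axes) dot v y1 ^+ 11 * dot (v4 1 0 0 0) v = (((362 * 100 + 97) * 100 + 21) * 100 + 54).
  by rewrite F4_axes_sum !dE !dot_vec4; ring.
have g11_1 : \sum_(v <- F4_axes) dot v y1 ^+ 11 * dot (v4 0 1 0 0) v = ((((20 * 100 + 26) * 100 + 15) * 100 + 48) * 100 + 68).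
  by rewrite F4_axes_sum !dE !dot_vec4; ring.
have g11_2 : \sum_(v <- F4_axes) dot v y1 ^+ 11 * dot (v4 0 0 1 0) v = ((((86 * 100 + 42) * 100 + 95) * 100 + 70) * 100 + 22).
  by rewrite F4_axes_sum !dE !dot_vec4; ring.
have g11_3 : \sum_(v <- F4_axes) dot v y1 ^+ 11 * dot (v4 0 0 0 1) v = ((((109 * 100 + 34) * 100 + 43) * 100 + 18) * 100 + 90).
  by rewrite F4_axes_sum !dE !dot_vec4; ring.
have e0 := grad_e (v4 1 0 0 0); rewrite g1_0 g5_0 g7_0 g11_0 in e0.
have e1 := grad_e (v4 0 1 0 0); rewrite g1_1 g5_1 g7_1 g11_1 in e1.
have e2 := grad_e (v4 0 0 1 0); rewrite g1_2 g5_2 g7_2 g11_2 in e2.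
have e3 := grad_e (v4 0 0 0 1); rewrite g1_3 g5_3 g7_3 g11_3 in e3.
clear grad_e h dE d0 d1 d2 d3 d4 d5 d6 d7 d8 d9 d10 d11 g1_0 g1_1 g1_2 g1_3 g5_0 g5_1 g5_2 g5_3 g7_0 g7_1 g7_2 g7_3 g11_0 g11_1 g11_2 g11_3.
have c0 : c 0 = 0 by lra.
have c1 : c 1 = 0 by lra.
have c2 : c 2 = 0 by lra.
have c3 : c 3 = 0 by lra.
by move=> j; have [->|[->|[->|->]]] := ord4P j.
Qed.

End F4.

(** Cramer's rule: the cofactors combine the three equations into the determinant times one
    unknown. *)
Lemma det3_kernel (R : idomainType) (a11 a12 a13 a21 a22 a23 a31 a32 a33 x y z : R) :
  a11 * (a22 * a33 - a23 * a32) - a12 * (a21 * a33 - a23 * a31) + a13 * (a21 * a32 - a22 * a31) != 0 ->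
  a11 * x + a12 * y + a13 * z = 0 -> a21 * x + a22 * y + a23 * z = 0 ->
  a31 * x + a32 * y + a33 * z = 0 -> [/\ x = 0, y = 0 & z = 0].
Proof.
move=> D0 e1 e2 e3; split; apply: (mulfI D0); rewrite mulr0.
- transitivity ((a22 * a33 - a23 * a32) * (a11 * x + a12 * y + a13 * z)
    - (a12 * a33 - a13 * a32) * (a21 * x + a22 * y + a23 * z)
    + (a12 * a23 - a13 * a22) * (a31 * x + a32 * y + a33 * z)); first by ring.
  by rewrite e1 e2 e3 !mulr0 ?oppr0 !addr0.
- transitivity (- (a21 * a33 - a23 * a31) * (a11 * x + a12 * y + a13 * z)
    + (a11 * a33 - a13 * a31) * (a21 * x + a22 * y + a23 * z)
    - (a11 * a23 - a13 * a21) * (a31 * x + a32 * y + a33 * z)); first by ring.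
  by rewrite e1 e2 e3 !mulr0 ?oppr0 !addr0.
- transitivity ((a21 * a32 - a22 * a31) * (a11 * x + a12 * y + a13 * z)
    - (a11 * a32 - a12 * a31) * (a21 * x + a22 * y + a23 * z)
    + (a11 * a22 - a12 * a21) * (a31 * x + a32 * y + a33 * z)); first by ring.
  by rewrite e1 e2 e3 !mulr0 ?oppr0 !addr0.
Qed.

(** * Restriction of the F_4 invariants to a mirror *)

Section F4Slices.
Variable R : realType.
Local Notation v3 a b c := (@vec R 3 [:: a; b; c]).
Local Notation v4 a b c d := (@vec R 4 [:: a; b; c; d]).

(* slice 0 parametrises the mirror of e4 and slice 1 that of e3 - e4. *)
Definition slice (t : R) : 'M[R]_(4, 3) :=
  \matrix_(i, j) (if (i < 3)%N then (i == j :> nat)%:R else t * (j == 2)%:R).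

Lemma slice_vec t a b c : slice t *m v3 a b c = v4 a b c (t * c).
Proof.
apply/colP => i; rewrite !mxE sum_ord3 !mxE /=.
by case: i => [[|[|[|[|//]]]] hi] /=; ring.
Qed.

(** The pullback of a [vsum] is the [vsum] of the projected vectors. Degrees 2 and 6 are to be kept
    for k = 2, and the invariant of degree 8 is the one minimised. *)
Definition slice_invariant (t : R) (j : 'I_3) : {mpoly R[3]} :=
  vsum [seq (slice t)^T *m v | v <- F4_axes R] (nth 0%N [:: 1; 3; 4] j).

Lemma peval_slice_vsum t k x :
  peval (vsum [seq (slice t)^T *m v | v <- F4_axes R] k) x = peval (vsum (F4_axes R) k) (slice t *m x).
Proof. by rewrite !peval_vsum big_map; apply: eq_bigr => v _; rewrite dot_mulmx. Qed.

(** Up to the factors 2, 6 and 8 the sums s are the partial derivatives of the three restrictions;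
    the determinant is written out so that it can be factored by a ring identity. *)
Lemma slice_jac t x :
  let s m w := \sum_(v <- F4_axes R) dot v (slice t *m x) ^+ m * dot (slice t *m w) v in
  let e1 := v3 1 0 0 in let e2 := v3 0 1 0 in let e3 := v3 0 0 1 in
  s 1 e1 * (s 5 e2 * s 7 e3 - s 7 e2 * s 5 e3) - s 5 e1 * (s 1 e2 * s 7 e3 - s 7 e2 * s 1 e3)
    + s 7 e1 * (s 1 e2 * s 5 e3 - s 5 e2 * s 1 e3) != 0 ->
  \det (jac (slice_invariant t) x) != 0.
Proof.
move=> s e1 e2 e3 D0; apply: jac_nonsingular => c h.
have eq w : s 1%N w * (2 * c 0) + s 5%N w * (6 * c 1) + s 7%N w * (8 * c 2) = 0.
  have dl : \sum_j c j * dot w (grad (slice_invariant t j) x) = 0.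
    by rewrite -[RHS](dot0r w) -h dot_sumr; apply: eq_bigr => j _; rewrite dotZr.
  have sE m : \sum_(v <- [seq (slice t)^T *m v | v <- F4_axes R]) dot v x ^+ m * dot w v = s m w.
    by rewrite big_map; apply: eq_bigr => v _; rewrite -dot_mulmx [X in _ * X]dot_mulmx trmxK.
  rewrite sum_ord3 in dl; rewrite -[RHS]dl /slice_invariant [nth _ _ _]/=.
  rewrite !dot_grad_vsum !sE -[1.*2]/2%N -[3.*2]/6%N -[4.*2]/8%N; ring.
have [c0 c1 c2] := det3_kernel D0 (eq e1) (eq e2) (eq e3).
by move=> j; have [->|[->|->]] := ord3P j; [move: c0|move: c1|move: c2] => /eqP;
  rewrite mulf_eq0 pnatr_eq0 /= => /eqP.
Qed.

(* The mirrors that cut the slice, other than the slice itself, as indices in F4_mirrors. *)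
Definition short_cuts : seq nat := [:: 9; 20; 4; 14; 3; 8; 10; 18; 22; 15; 16; 5; 6].
Definition long_cuts : seq nat := [:: 9; 20; 4; 14; 3; 8; 10; 18; 22; 15; 13; 5; 1].

Lemma short_cuts_prod (V : comPzRingType) (F : 'cV[R]_4 -> V) :
  \prod_(i <- short_cuts) F (F4_mirrors R)`_i =
  F (v4 1 0 0 0) * (F (v4 0 1 0 0) * (F (v4 0 0 1 0) * (F (v4 1 1 0 0) * (F (v4 1 (- 1) 0 0) *
  (F (v4 1 0 1 0) * (F (v4 1 0 (- 1) 0) * (F (v4 0 1 1 0) * (F (v4 0 1 (- 1) 0) *
  (F (v4 (1 / 2) (1 / 2) (1 / 2) (1 / 2)) * (F (v4 (1 / 2) (1 / 2) (- (1 / 2)) (1 / 2)) *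
  (F (v4 (1 / 2) (- (1 / 2)) (1 / 2) (1 / 2)) *
   F (v4 (1 / 2) (- (1 / 2)) (- (1 / 2)) (1 / 2))))))))))))).
Proof. by rewrite /short_cuts !big_cons big_nil mulr1. Qed.

Lemma long_cuts_prod (V : comPzRingType) (F : 'cV[R]_4 -> V) :
  \prod_(i <- long_cuts) F (F4_mirrors R)`_i =
  F (v4 1 0 0 0) * (F (v4 0 1 0 0) * (F (v4 0 0 1 0) * (F (v4 1 1 0 0) * (F (v4 1 (- 1) 0 0) *
  (F (v4 1 0 1 0) * (F (v4 1 0 (- 1) 0) * (F (v4 0 1 1 0) * (F (v4 0 1 (- 1) 0) *
  (F (v4 (1 / 2) (1 / 2) (1 / 2) (1 / 2)) * (F (v4 (1 / 2) (1 / 2) (- (1 / 2)) (- (1 / 2))) *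
  (F (v4 (1 / 2) (- (1 / 2)) (1 / 2) (1 / 2)) *
   F (v4 (1 / 2) (- (1 / 2)) (- (1 / 2)) (- (1 / 2)))))))))))))).
Proof. by rewrite /long_cuts !big_cons big_nil mulr1. Qed.

(* The Jacobian is a multiple of the product of the cuts; the four halves in the
   cuts are generalised to h so that the identity holds over any ring. *)
Lemma short_jac x : \prod_(i <- short_cuts) dot (F4_mirrors R)`_i (slice 0 *m x) != 0 ->
  \det (jac (slice_invariant 0) x) != 0.
Proof.
have [a [b [c ->]]] := vec3P x.
rewrite (short_cuts_prod (fun v => dot v _)) => D0; apply: slice_jac; apply: contra D0 => /eqP D0.
have := congr1 ( *%R ((1 / 2) ^+ 4)) D0; rewrite mulr0 => {}D0.
(* The determinant is -720 times the product of the 13 cuts with the four roots that contain halves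
   doubled; its degree 1 + 5 + 7 is the number of cuts. *)
apply/eqP; apply: (mulfI (_ : - (24 * 30) != 0 :> R)); first by rewrite oppr_eq0 mulf_neq0 ?pnatr_eq0.
rewrite mulr0 -[RHS]D0 !F4_axes_sum !slice_vec !dot_vec4; generalize (1 / 2 : R) => h.
ring.
Qed.

Lemma long_jac x : \prod_(i <- long_cuts) dot (F4_mirrors R)`_i (slice 1 *m x) != 0 ->
  \det (jac (slice_invariant 1) x) != 0.
Proof.
have [a [b [c ->]]] := vec3P x.
rewrite (long_cuts_prod (fun v => dot v _)) => D0; apply: slice_jac; apply: contra D0 => /eqP D0.
have := congr1 ( *%R ((1 / 2) ^+ 4)) D0; rewrite mulr0 => {}D0.
(* Here the factor is -1440, again with the four roots that contain halves doubled. *)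
apply/eqP; apply: (mulfI (_ : - (24 * 60) != 0 :> R)); first by rewrite oppr_eq0 mulf_neq0 ?pnatr_eq0.
rewrite mulr0 -[RHS]D0 !F4_axes_sum !slice_vec !dot_vec4; generalize (1 / 2 : R) => h.
ring.
Qed.

Lemma F4_dot_le y : 6 * dot y y = peval (vsum (F4_axes R) 1) y.
Proof.
have [a [b [c [d ->]]]] := vec4P y.
by rewrite peval_vsum /F4_axes !big_cons big_nil !dot_vec4 -[1.*2]/2%N; ring.
Qed.

(** The form that k = 2 requires: from the mirror of b one gets to two mirrors at once, keeping the
    invariants of degrees 2 and 6. The two mirrors need not include that of b, so the property
    carries over along the group. *)
Definition F4_reach (b : 'cV[R]_4) : Prop :=
  forall y, dot b y = 0 -> exists z (i j : 'I_(size (F4_mirrors R))),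
    [/\ i != j, dot (F4_mirrors R)`_i z = 0, dot (F4_mirrors R)`_j z = 0,
        peval (vsum (F4_axes R) 1) z = peval (vsum (F4_axes R) 1) y
      & peval (vsum (F4_axes R) 3) z = peval (vsum (F4_axes R) 3) y].

(** Minimising inside the slice leads to one of the cuts, while the point stays on the mirror of the
    slice. *)
Lemma slice_reach t (l : seq nat) (i0 : 'I_(size (F4_mirrors R))) x1 :
  (forall x, \prod_(i <- l) dot (F4_mirrors R)`_i (slice t *m x) != 0 ->
     \det (jac (slice_invariant t) x) != 0) ->
  (forall x, dot (F4_mirrors R)`_i0 (slice t *m x) = 0) ->
  (forall y, dot (F4_mirrors R)`_i0 y = 0 -> exists x, y = slice t *m x) ->
  all (fun i => i < size (F4_mirrors R))%N l ->
  \prod_(i <- l) dot (F4_mirrors R)`_i (slice t *m x1) != 0 ->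
  F4_reach (F4_mirrors R)`_i0.
Proof.
move=> J0 i0_slice slice_i0 l_lt l_x1 y /slice_i0[x ->].
have [z zn|z|z [i [iz agree]]] := @corank_one_point R 2 _
    (fun i : 'I_(size l) => (slice t)^T *m (F4_mirrors R)`_(nth 0%N l i)) (slice_invariant t) 0 x.
- apply: J0; rewrite (big_nth 0%N) big_mkord; apply/prodf_neq0 => i _.
  by rewrite dot_mulmx; exact: zn.
- rewrite /slice_invariant peval_slice_vsum -F4_dot_le.
  have [a [b [c ->]]] := vec3P z; rewrite slice_vec dot_vec3 dot_vec4.
  by nra.
have il : (nth 0%N l i < size (F4_mirrors R))%N by apply: (allP l_lt); exact: mem_nth.
exists (slice t *m z), (Ordinal il), i0; split.
(* The cut is not the mirror of the slice, because its form is nonzero at x1. *)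
- apply: contraTneq l_x1 => ii0; rewrite (big_nth 0%N) big_mkord negbK; apply/prodf_eq0.
  by exists i => //; have := i0_slice x1; rewrite -ii0 => /= ->.
- by rewrite dot_mulmx.
- exact: i0_slice.
- by have := agree 0 erefl; rewrite !peval_slice_vsum.
- by have := agree 1 erefl; rewrite !peval_slice_vsum.
Qed.

End F4Slices.

Section F4Reach.
Variable R : realType.
Local Notation v3 a b c := (@vec R 3 [:: a; b; c]).
Local Notation v4 a b c d := (@vec R 4 [:: a; b; c; d]).

Lemma reach_short : F4_reach (v4 0 0 0 1).
Proof.
(* Entry 23 of the list is e4, and (1, 2, 5) is a point of the slice off all the cuts. *)
apply: (@slice_reach R 0 short_cuts (@Ordinal 24 23 erefl) (v3 1 2 5)) => //=.
- exact: short_jac.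
- by move=> x; have [a [b [c ->]]] := vec3P x; rewrite slice_vec dot_vec4; ring.
- move=> y; have [a [b [c [d ->]]]] := vec4P y; rewrite dot_vec4 => h.
  by exists (v3 a b c); rewrite slice_vec; congr (v4 _ _ _ _); lra.
rewrite (short_cuts_prod (fun v => dot v _)) !slice_vec !dot_vec4.
by do ?[apply: mulf_neq0]; apply/eqP => h; lra.
Qed.

Lemma reach_long : F4_reach (v4 0 0 1 (- 1)).
Proof.
apply: (@slice_reach R 1 long_cuts (@Ordinal 24 0 erefl) (v3 1 2 5)) => //=.
- exact: long_jac.
- by move=> x; have [a [b [c ->]]] := vec3P x; rewrite slice_vec dot_vec4; ring.
- move=> y; have [a [b [c [d ->]]]] := vec4P y; rewrite dot_vec4 => h.
  by exists (v3 a b c); rewrite slice_vec; congr (v4 _ _ _ _); lra.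
rewrite (long_cuts_prod (fun v => dot v _)) !slice_vec !dot_vec4.
by do ?[apply: mulf_neq0]; apply/eqP => h; lra.
Qed.

Lemma peval_F4_reflmx k s y : s \in F4_simple_roots R ->
  peval (vsum (F4_axes R) k) (reflmx s *m y) = peval (vsum (F4_axes R) k) y.
Proof.
move=> sS; apply: peval_vsum_reflmx; apply: (F4_simple_axes (f := fun v => dot v y ^+ _)) => // v.
exact: dotN_even.
Qed.

(** The reflection moves a point of the mirror of s(b) to that of b without changing the
    invariants. *)
Lemma reach_step s b : s \in F4_simple_roots R -> F4_reach b -> F4_reach (reflmx s *m b).
Proof.
move=> sS rb y; rewrite -dot_reflmx_sym => /rb[z [i [j [ij iz jz z1 z3]]]].
exists z, i, j; split=> //; [rewrite z1|rewrite z3]; exact: peval_F4_reflmx.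
Qed.

(* The Weyl group has two orbits of mirrors, those of e4 and of e3 - e4. *)
Lemma reach_mirrors (i : 'I_(size (F4_mirrors R))) : F4_reach (F4_mirrors R)`_i.
Proof.
move: i; apply: F4_mirrors_ind; last exact: reach_step.
have s1 : v4 0 1 (- 1) 0 \in F4_simple_roots R by rewrite !inE eqxx ?orbT.
have s2 : v4 0 0 1 (- 1) \in F4_simple_roots R by rewrite !inE eqxx ?orbT.
have s3 : v4 0 0 0 1 \in F4_simple_roots R by rewrite !inE eqxx ?orbT.
have s4 : v4 (1 / 2) (- (1 / 2)) (- (1 / 2)) (- (1 / 2)) \in F4_simple_roots R by rewrite !inE eqxx ?orbT.
move=> s; rewrite !inE => /or4P[] /eqP ->.
(* e2 - e3 is obtained from e3 - e4 by way of e2 - e4; in the last case the fourth simple root is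
   obtained from e4 by way of (1, -1, -1, 1) / 2. *)
- have := reach_step s2 (reach_step s1 reach_long).
  rewrite (@reflmx_vec4 R (- 1) _ _ _ _ _ _ _ _ 0 1 0 (- 1)); try lra.
  by rewrite (@reflmx_vec4 R 1 _ _ _ _ _ _ _ _ 0 1 (- 1) 0); try lra.
- exact: reach_long.
- exact: reach_short.
- have := reach_step s3 (reach_step s4 reach_short).
  rewrite (@reflmx_vec4 R (- 1) _ _ _ _ _ _ _ _ (1 / 2) (- (1 / 2)) (- (1 / 2)) (1 / 2)); try lra.
  by rewrite (@reflmx_vec4 R 1 _ _ _ _ _ _ _ _ (1 / 2) (- (1 / 2)) (- (1 / 2)) (- (1 / 2))); try lra.
Qed.

End F4Reach.

Lemma rank_two_rows (R : realType) (n : nat) (I : finType) (a : I -> 'cV[R]_n) (i j : I) :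
  pairwise_independent a -> i != j ->
  \rank (\matrix_(l < 2) (a (if l == 0 then i else j))^T) = 2%N.
Proof.
move=> [_ ai] ij; apply/eqP; apply: inj_row_free => v vA.
have e : v 0 0 *: a i + v 0 1 *: a j = 0.
  apply/colP => l; have := congr1 (fun B : 'rV[R]_n => B 0 l) vA.
  by rewrite !mxE sum_ord2 !mxE.
have e' : v 0 1 *: a j + v 0 0 *: a i = 0 by rewrite addrC.
apply/rowP => l; rewrite [RHS]mxE.
have [->|->] := ord2P l; first exact: ai e.
by apply: ai e'; rewrite eq_sym.
Qed.

Lemma type_F4_meets (R : realType) (N : nat) (E : 'M[R]_(4, N)) (G : set 'M[R]_N)
    (k : nat) (X : set 'cV[R]_N) :
  E^T *m E = 1%:M -> range (mulmx E : 'cV[R]_N -> 'cV[R]_4) = setT ->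
  G = [set E^T *m h *m E | h in root_group (F4_simple_roots R)] ->
  reflection_group G -> X !=set0 -> (0 < k)%N -> (k <= N)%N -> sparse G k X ->
  X `&` flat_stratum G k !=set0.
Proof.
move=> EE rE; move: (square_realization EE rE) => N4; subst N.
move=> GE Grefl [x0 Xx0] k0 k4 [q [qb [fs fsq XE]]].
set W := root_group _ in GE.
pose a (i : 'I_(size (F4_mirrors R))) := (F4_mirrors R)`_i.
have simple0 s : s \in F4_simple_roots R -> s != 0.
  rewrite -dot_eq0 !inE => /or4P[] /eqP ->; rewrite dot_vec4 gt_eqF //; lra.
have aW i : W (reflmx (a i)).
  apply: (F4_mirrors_ind (P := fun a => W (reflmx a))) => [s sS|s b sS Wb].
    exact: root_group_base.
  by apply: root_group_step => //; exact: simple0.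
have aU i : [set: 'cV[R]_4] (a i) by [].
have ai : pairwise_independent a := F4_mirrors_indep R.
pose P := @F4_invariant R; pose d (j : 'I_4) := ((nth 0 [:: 1; 3; 4; 6] j).*2)%N.
pose y1 : 'cV[R]_4 := vec 4 [:: 1; 2; 3; 5].
have P_homog j : P j \is (d j).-homog by exact: vsum_homog.
have P_inv0 j h y : W h -> peval (P j) (h *m y) = peval (P j) y.
  by move=> Wh; apply: generated_invariant Wh y => g [s sS ->] y; exact: peval_F4_reflmx.
have P_inv j h y : W h -> [set: 'cV[R]_4] y -> peval (P j) (h *m y) = peval (P j) y by move=> Wh _; exact: P_inv0.
have WU h y : W h -> [set: 'cV[R]_4] y -> [set: 'cV[R]_4] (h *m y) by [].
have y1U : [set: 'cV[R]_4] y1 by [].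
have Py1 : \det (jac P y1) != 0 by exact: F4_jac.
have Py1E : \det (jac P y1 *m E) != 0.
  by rewrite det_mulmx mulf_neq0 //; have [_] := mulmx1_unit EE; rewrite unitmxE unitfE.
have d_count : (\sum_j d j <= #|'I_(size (F4_mirrors R))| + 4)%N.
  by rewrite card_ord !big_ord_recl big_ord0.
have d_lt (i j : 'I_4) : (i < j)%N -> (d i < d j)%N.
  by case: i j => [[|[|[|[|?]]]] ?] [[|[|[|[|?]]]] ?].
have P0 x : peval (P 0) x = 6 * dot x x by rewrite F4_dot_le.
suff [y [yfib yflat]] : exists y, (forall j : 'I_4, (j < k)%N -> peval (P j) y = peval (P j) (E *m x0)) /\
    flat_stratum G k (E^T *m y).
  exists (E^T *m y); split=> //; rewrite XE; apply: (sparse_locus k4 fsq (y := x0)); last by rewrite -XE.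
  have -> : x0 = E^T *m (E *m x0) by rewrite mulmxA EE mul1mx.
  move=> l lk; exact: (realized_fibre EE rE GE Grefl aW aU ai P_homog WU P_inv y1U Py1E d_count qb d_lt
    _ _ yfib lk).
have [->|k4'] := eqVneq k 4%N.
  by exists (E *m x0); split=> //; exact: flat_stratum_full.
(* This point of a mirror agrees with the given one in degrees 2, 6 and 8. It settles k = 3 and is
   the starting point inside a mirror for k = 2. *)
have [x|x|y [i [iy yfib]]] := @corank_one_point R 3 _ a P 0 (E *m x0).
- apply: (jac_neq0_off_mirrors ai P_homog) Py1 d_count => j i y; apply: P_inv0; exact: aW.
- by rewrite P0; have := dot_ge0 x; nra.
have [k3|k3'] := eqVneq k 3%N.
  exists y; rewrite k3; split; last exact: (realized_flat_mirror EE rE GE aW ai iy).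
  by move=> j j3; apply: yfib; rewrite -val_eqE /= ltn_eqF.
have [k2|k2'] := eqVneq k 2%N.
  have [z [i1 [i2 [i12 iz1 iz2 z1 z3]]]] := reach_mirrors iy.
  exists z; rewrite k2; split=> [j j2|].
    rewrite -yfib; last by rewrite -val_eqE /= ltn_eqF // (leq_trans j2).
    by move: j2; have [->|[->|[->|->]]] := ord4P j.
  apply: (realized_flat_rank (t := fun l : 'I_2 => if l == 0 then i1 else i2) EE rE GE aW ai) => //.
    by move=> l; case: ifP.
  by rewrite (rank_two_rows ai i12).
have {k0 k4 k4' k3' k2'} k1 : k = 1%N by move: k0 k4 k4' k3' k2'; case: (k) => [|[|[|[|[|]]]]].
(* For k = 1 only the norm is fixed, and the first axis is the line common to the mirrors of e2, e3
   and e4. *)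
pose y0 := E *m x0; pose c := Num.sqrt (dot y0 y0).
exists (vec 4 [:: c; 0; 0; 0]); rewrite k1; split.
  move=> j j1; have -> : j = 0 by move: j1; have [->|[->|[->|->]]] := ord4P j.
  rewrite !P0 dot_vec4 -/y0; congr (_ * _); rewrite !mul0r !addr0 -expr2 sqr_sqrtr //.
  exact: dot_ge0.
apply: (realized_flat_coords (J := [set 0]%SET) EE rE GE aW aU ai) => //; first by rewrite cards1.
move=> v _ hv /(_ 0) v0; have {}v0 : v 0 0 = 0 by apply: v0; rewrite inE.
have axis u : u \in F4_mirrors R -> dot u (vec 4 [:: c; 0; 0; 0]) = 0 -> dot u v = 0.
  by move=> /mem_nth_ord[l <-]; exact: hv.
have h1 : dot (vec 4 [:: 0; 1; 0; 0]) v = 0.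
  by apply: axis; [rewrite !inE eqxx ?orbT | rewrite dot_vec4; ring].
have h2 : dot (vec 4 [:: 0; 0; 1; 0]) v = 0.
  by apply: axis; [rewrite !inE eqxx ?orbT | rewrite dot_vec4; ring].
have h3 : dot (vec 4 [:: 0; 0; 0; 1]) v = 0.
  by apply: axis; [rewrite !inE eqxx ?orbT | rewrite dot_vec4; ring].
have [x1 [x2 [x3 [x4 vE]]]] := vec4P v; move: v0 h1 h2 h3; rewrite vE !dot_vec4 mxE /= => -> h1 h2 h3.
have -> : x2 = 0 by lra. have -> : x3 = 0 by lra. have -> : x4 = 0 by lra.
by apply/colP => j; rewrite !mxE; have [->|[->|[->|->]]] := ord4P j.
Qed.

Theorem theorem2 (R : realType) (N : nat) (T : group_type) (G : set 'M[R]_N)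
    (k : nat) (X : set 'cV[R]_N) :
  reflection_group G ->
  has_type T G ->
  real_variety X ->
  invariant_set G X ->
  X !=set0 ->
  (1 <= k)%N -> (k <= N)%N ->
  sparse G k X ->
  X `&` flat_stratum G k !=set0.
Proof.
move=> Grefl GT _ _; case: T GT => [m|r|n|n||] /=.
- by move=> [m0 [E [EE rE GE]]]; exact: type_I2_meets m0 EE rE GE Grefl.
- move=> [] [E [EE rE GE]]; first exact: (type_A_meets (eps := false) EE rE GE Grefl).
  exact: (type_A_meets (eps := true) EE rE GE Grefl).
- by move=> [E [EE rE GE]]; exact: type_B_meets EE rE GE Grefl.
- by move=> [n2 [E [EE rE GE]]]; exact: type_D_meets n2 EE rE GE Grefl.
- by move=> [E [EE rE GE]]; exact: type_H3_meets EE rE GE Grefl.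
- by move=> [E [EE rE GE]]; exact: type_F4_meets EE rE GE Grefl.
Qed.
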